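(* Let $H$ be a finitely generated subgroup of the free group $F_k$. Then for every integer $0\le i\le \mathrm{rk}(H)+1$: 1. $\pi(H)=i$ if and only if $\phi(H)=i$; 2. if $\pi(H)=\phi(H)=i$, then $a_i(H)$ equals the number of $H$-critical subgroups of $F_k$.
   Context: $F_k$ is the free group of rank $k$. A subgroup $H\le J$ is a free factor of $J$ if $J=H*H'$ for some $H'\le J$. Primitivity rank: for finitely generated $H\le F_k$, $$\pi(H)=\min\{\mathrm{rk}(J) : H\le J\le F_k,\ H \text{ is not a free factor of } J\},$$ and $\pi(H)=\infty$ if no such $J$ exists. A subgroup $J$ attaining the minimum is called $H$-critical. For $n\ge1$ let $\alpha_n$ be a uniformly random homomorphism in $\mathrm{Hom}(F_k,S_n)$, where $S_n$ is the symmetric group on $\{1,\dots,n\}$, and set $$\Phi_H(n)=\mathrm{Prob}\big[\forall w\in H:\ \alpha_n(w)(1)=1\big]-\frac{1}{n^{\mathrm{rk}(H)}}.$$ There are integers $a_i(H)$, $i\ge 0$, depending only on $H$, such that for all large enough $n$, $\Phi_H(n)=\sum_{i=0}^\infty a_i(H)n^{-i}$ (for large $n$, $\Phi_H$ is a rational function of $n$). Define $\phi(H)$ to be the smallest $i$ with $a_i(H)\ne0$, and $\phi(H)=\infty$ if all $a_i(H)$ vanish. *)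

(* Defs.v *)
From HB Require Import structures.
From mathcomp Require Import all_boot all_order all_algebra all_fingroup.
From mathcomp Require Import finmap.
From mathcomp Require Import all_classical all_reals all_analysis.

Set Implicit Arguments.
Unset Strict Implicit.
Unset Printing Implicit Defensive.

Import Order.TTheory GRing.Theory Num.Theory.
Import numFieldNormedType.Exports.

Local Open Scope classical_set_scope.
Local Open Scope group_scope.

(* The letter (i, false) stands for the generator i and (i, true) for its
   inverse. *)
Definition letter (I : Type) : Type := (I * bool)%type.

Definition letter_inv (I : Type) (x : letter I) : letter I := (x.1, ~~ x.2).

Definition reduced (I : eqType) : pred (seq (letter I)) :=
  sorted (fun x y => y != letter_inv x).

Section FreeGroup.
Variable I : choiceType.
Implicit Types (x : letter I) (s t : seq (letter I)).

Record free_group := FreeGroup {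
  fgword :> seq (letter I);
  _ : reduced fgword }.

HB.instance Definition _ := [isSub for fgword].
HB.instance Definition _ := [Choice of free_group by <:].

Definition push x s :=
  if s is y :: s' then if y == letter_inv x then s' else x :: s else [:: x].

Lemma letter_invK : involutive (@letter_inv I).
Proof. by case=> i b; rewrite /letter_inv /= negbK. Qed.

Lemma reduced_push x s : reduced s -> reduced (push x s).
Proof.
case: s => //= y s hs; case: ifPn => [_|h]; first exact: path_sorted hs.
by rewrite /reduced /= h.
Qed.

Lemma reduced_foldr s t : reduced t -> reduced (foldr push t s).
Proof. by move=> ht; elim: s => //= x s; apply: reduced_push. Qed.

Lemma pushK x s : reduced s -> push x (push (letter_inv x) s) = s.
Proof.
case: s => [|y s] /=; first by rewrite eqxx.
rewrite letter_invK; case: eqP => [->|_ _] /=; last by rewrite eqxx.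
by case: s => //= z s /andP[/negbTE-> _].
Qed.

Lemma foldr_push x s t :
  reduced t -> foldr push t (push x s) = push x (foldr push t s).
Proof.
move=> ht; case: s => //= y s; case: eqP => //= ->.
by rewrite pushK // reduced_foldr.
Qed.

Lemma foldr_pushA s t u : reduced u ->
  foldr push u (foldr push t s) = foldr push (foldr push u t) s.
Proof. by move=> hu; elim: s => //= x s IH; rewrite foldr_push // IH. Qed.

Lemma foldr_push_nil s : reduced s -> foldr push [::] s = s.
Proof.
elim: s => //= x s IH hs; rewrite IH; last exact: path_sorted hs.
by case: s hs {IH} => //= y s /andP[/negbTE->].
Qed.

Lemma foldr_pushV s : foldr push s (rev (map (@letter_inv I) s)) = [::].
Proof.
elim: s => //= x s IH.
by rewrite rev_cons -cats1 foldr_cat /= letter_invK eqxx.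
Qed.

Lemma reduced_inv s : reduced s -> reduced (rev (map (@letter_inv I) s)).
Proof.
rewrite /reduced rev_sorted sorted_map; apply: sub_sorted => x y /=.
by rewrite letter_invK eq_sym.
Qed.

Definition fg_one := @FreeGroup [::] isT.
Definition fg_mul (u v : free_group) :=
  FreeGroup (reduced_foldr u (valP v)).
Definition fg_inv (u : free_group) := FreeGroup (reduced_inv (valP u)).

Lemma fg_mulA : associative fg_mul.
Proof. by move=> u v w; apply: val_inj; rewrite /= foldr_pushA ?(valP w). Qed.

Lemma fg_mul1 : left_id fg_one fg_mul.
Proof. by move=> u; apply: val_inj. Qed.

Lemma fg_mulr1 : right_id fg_one fg_mul.
Proof. by move=> u; apply: val_inj; rewrite /= foldr_push_nil ?(valP u). Qed.

Lemma fg_mulV : left_inverse fg_one fg_inv fg_mul.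
Proof. by move=> u; apply: val_inj; rewrite /= foldr_pushV. Qed.

Lemma fg_mulrV : right_inverse fg_one fg_inv fg_mul.
Proof.
move=> u; rewrite -[X in fg_mul X _](_ : fg_inv (fg_inv u) = u) ?fg_mulV //.
apply: val_inj => /=; rewrite map_rev revK -map_comp map_id_in // => x _.
exact: letter_invK.
Qed.

HB.instance Definition _ := isGroup.Build free_group
  fg_mulA fg_mul1 fg_mulr1 fg_mulV fg_mulrV.

End FreeGroup.

Section Subgroups.
Variable G : groupType.
Implicit Types H J A B : set G.

Definition is_subgroup H : Prop := group_closed [in H].

Definition subgroup_generated A : set G := smallest is_subgroup A.

Definition finitely_generated H : Prop :=
  exists s : seq G, H = subgroup_generated [set` s].

Definition word_eval (I : Type) (e : I -> G) (s : seq (letter I)) : G :=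
  \prod_(x <- s) (if x.2 then (e x.1)^-1 else e x.1).

Definition free_basis (I : eqType) J (e : I -> G) : Prop :=
  J = subgroup_generated (range e) /\
  forall s, reduced s -> s != [::] -> word_eval e s != 1.

(* [J = A * B] as an internal free product: [A] and [B] generate [J], and
   every nonempty product of nontrivial elements taken alternately from [A]
   (tag [true]) and from [B] (tag [false]) is nontrivial. *)
Definition free_product J A B : Prop :=
  J = subgroup_generated (A `|` B) /\
  forall s : seq (bool * G),
    (forall p, p \in s -> (if p.1 then A p.2 else B p.2) /\ p.2 <> 1) ->
    sorted (fun p q => p.1 != q.1) s -> s != [::] -> \prod_(p <- s) p.2 != 1.

Definition free_factor H J : Prop :=
  is_subgroup H /\ exists H', is_subgroup H' /\ free_product J H H'.

End Subgroups.

(* The minimum of a set of natural numbers, with [None] standing for the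
   infinite value taken on the empty set. *)
Definition least (P : set nat) : option nat :=
  if pselect (exists n, `[< P n >]) is left exP then Some (ex_minn exP)
  else None.

(* The number of elements of a free basis of [J]; all finite free bases have
   the same number of elements. *)
Definition free_rank (G : groupType) (J : set G) : option nat :=
  least [set r | exists e : 'I_r -> G, free_basis J e].

Section PrimitivityRank.
Variable G : groupType.
Implicit Types H J : set G.

Definition nonfree_extension H J : Prop :=
  [/\ is_subgroup J, H `<=` J & ~ free_factor H J].

Definition primitivity_rank H : option nat :=
  least [set r | exists J, nonfree_extension H J /\ free_rank J = Some r].

Definition critical H : set (set G) :=
  [set J | nonfree_extension H J /\ free_rank J = primitivity_rank H].

End PrimitivityRank.

(* Since [free_group 'I_k] and ['S_n] are groups, multiplicative maps between
   them are exactly group homomorphisms; there are finitely many of them. *)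
Definition homs (k n : nat) : set (free_group 'I_k -> 'S_n) :=
  [set f | {morph f : x y / x * y >-> x * y}].
Arguments homs : clear implicits.

(* ['S_n] acts on [0, ..., n.-1]; the point 0 plays the role of the point 1. *)
Definition fixing_homs (k n : nat) (H : set (free_group 'I_k)) :
    set (free_group 'I_k -> 'S_n) :=
  [set f | homs k n f /\
    forall w, H w -> forall i : 'I_n, i = 0%N :> nat -> f w i = i].
Arguments fixing_homs : clear implicits.

Section Phi.
Variables (R : realType) (k : nat).
Implicit Types H : set (free_group 'I_k).

Local Open Scope ring_scope.

(* If [H] had infinite rank, the subtracted term would be 0. *)
Definition Phi H (n : nat) : R :=
  #|` fset_set (fixing_homs k n H)|%:R / #|` fset_set (homs k n)|%:R
  - (if free_rank H is Some r then (n%:R ^+ r)^-1 else 0).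

Definition Phi_expansion H (a : nat -> int) : Prop :=
  \forall n \near \oo,
    series (fun i => (a i)%:~R / n%:R ^+ i : R) @ \oo --> Phi H n.

(* The coefficients are unique by the identity theorem for power series in
   1 / n. *)
Definition Phi_coef H : nat -> int := xget (fun=> 0) (Phi_expansion H).

Definition phi H : option nat := least [set i | Phi_coef H i != 0].

End Phi.

(* Main.v *)
Require Import Defs.
From mathcomp Require Import all_boot all_order all_algebra all_fingroup.
From mathcomp Require Import finmap.
From mathcomp Require Import all_classical all_reals all_analysis.
From mathcomp Require Import zify.

(** Sample the images of a finite prefix-closed set [P] of reduced words
    containing generators of [H].  The coincidences in the orbit of the base
    point are those of the coset space of a subgroup [M] generated by quotients
    of elements of [P] ([span M P = M]), and [H] fixes the base point iff
    [H <= M].  If the image of [P] in [M \ F] has [V] vertices and [E_j] edges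
    with label [j], the pattern of [M] occurs with probability
    [(n-1)...(n-V+1) / prod_j n(n-1)...(n-E_j+1)
     = n^(- rk M) (1 + (sum_j C(E_j,2) - C(V,2)) / n + ...)].
    All critical subgroups are among the [M]'s, as [span J P] is a free factor
    of [J]; an [M] <> [H] having [H] as a free factor has rank [> rk H].  This
    gives the claim for [i <= rk H].

    For [i = rk H + 1], when no [M <> H] has rank [<= rk H], it remains to show
    that the second coefficient of [H] cancels the number of [M = H * <t>].  Those are the subgroups obtained by
    identifying two vertices of the graph of [H].  Over a given [M], the ordered
    pairs of vertices fall into the two double cosets [H t H] and [H t^-1 H],
    and the pairs in one double coset form a finite subtree of the Cayley tree
    whose edges are pairs of edges of the graph; since a finite tree has one
    more vertex than edges, [2 #M = V (V-1) - sum_j E_j (E_j - 1)]. *)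

Set Implicit Arguments.
Unset Strict Implicit.
Unset Printing Implicit Defensive.

Import Order.TTheory GRing.Theory Num.Theory.
Import numFieldNormedType.Exports.

(** * Subgroups *)

(** The subtracted power of [n] cancels only the leading term of the pattern of [H]; every other
    pattern enters with coefficient 1 at its rank. The coefficient in the lowest nonfree rank is
    therefore a number of subgroups up to degree [rk H]. One degree further, a second coefficient is
    needed for [H] alone. Hence two terms of each expansion suffice, and the range of [i] ends at
    [rk H + 1].

    Freeness is the obstacle. A tree is grown leaf by leaf, and an edge joining two old vertices
    yields a new generator. It is shown to be free by letting the free group act on pairs of a coset
    and an element of an arbitrary group, with the action of one letter modified at two classes. The
    same action shows that the new generator identifies no further words of the tree, which allows
    leaves to be pruned in the search for the two vertices identified by [M = H * <t>].

    Invariance of the rank and the Hopf property come from counting homomorphisms to symmetric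
    groups. Hopf turns the [rk H + 1] obvious generators of [<H, t>] into a basis as soon as smaller
    ranks are excluded. *)

Section SubgroupTheory.
Local Open Scope classical_set_scope.
Local Open Scope group_scope.
Variable G : groupType.
Implicit Types (H J A B : set G) (x y z : G).

Lemma is_subgroupP H : is_subgroup H <->
  [/\ H 1, forall x y, H x -> H y -> H (x * y) & forall x, H x -> H x^-1].
Proof.
split=> [sH|[H1 HM HV]].
  split; first by have [] := sH; rewrite inE.
    by move=> x y Hx Hy; have := group_closedM sH; move/(_ x y); rewrite !inE; apply.
  by move=> x Hx; have := group_closedV sH; move/(_ x); rewrite !inE; apply.
split; first by rewrite inE.
by move=> x y; rewrite !inE => Hx Hy; apply: HM => //; apply: HV.
Qed.

Lemma subgroup1 H : is_subgroup H -> H 1.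
Proof. by case/is_subgroupP. Qed.

Lemma subgroupM H x y : is_subgroup H -> H x -> H y -> H (x * y).
Proof. by case/is_subgroupP=> _ HM _; apply: HM. Qed.

Lemma subgroupV H x : is_subgroup H -> H x -> H x^-1.
Proof. by case/is_subgroupP=> _ _; apply. Qed.

Lemma subgroup_trans H x y z :
  is_subgroup H -> H (x * y^-1) -> H (y * z^-1) -> H (x * z^-1).
Proof.
by move=> sH Hxy Hyz; have := subgroupM sH Hxy Hyz; rewrite mulgA mulgVK.
Qed.

Lemma subgroup_sym H x y : is_subgroup H -> H (x * y^-1) -> H (y * x^-1).
Proof. by move=> sH /(subgroupV sH); rewrite invgM invgK. Qed.

Lemma subgroupMl H x y : is_subgroup H -> H x -> H (x * y) -> H y.
Proof.
by move=> sH Hx /(subgroupM sH (subgroupV sH Hx)); rewrite mulKg.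
Qed.

Lemma subgroupMr H x y : is_subgroup H -> H y -> H (x * y) -> H x.
Proof.
by move=> sH Hy Hxy; rewrite -(mulgK y x); apply: subgroupM => //; apply: subgroupV.
Qed.

Lemma subgroup_prod (T : eqType) H (s : seq T) (f : T -> G) : is_subgroup H ->
  (forall t, t \in s -> H (f t)) -> H (\prod_(t <- s) f t).
Proof.
move=> sH; elim: s => [|t s IH] Hs; first by rewrite big_nil; apply: subgroup1.
rewrite big_cons; apply: subgroupM => //; first by apply: Hs; rewrite mem_head.
by apply: IH => t' ts; apply: Hs; rewrite inE ts orbT.
Qed.

Lemma sub_generated A : A `<=` subgroup_generated A.
Proof. exact: sub_smallest. Qed.

Lemma generated_subgroup A : is_subgroup (subgroup_generated A).
Proof.
apply/is_subgroupP; split=> [|x y Ax Ay|x Ax] B [sB AB].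
- exact: subgroup1.
- by apply: subgroupM => //; [apply: Ax|apply: Ay].
- by apply: subgroupV => //; apply: Ax.
Qed.

Lemma generated_min A H : is_subgroup H -> A `<=` H -> subgroup_generated A `<=` H.
Proof. by move=> sH AH; apply: smallest_sub. Qed.

Lemma generated_mono A B : A `<=` B -> subgroup_generated A `<=` subgroup_generated B.
Proof.
move=> AB; apply: generated_min; first exact: generated_subgroup.
by apply: subset_trans AB _; apply: sub_generated.
Qed.

Definition adjoin H x : set G := subgroup_generated (H `|` [set x]).

Lemma adjoin_subgroup H x : is_subgroup (adjoin H x).
Proof. exact: generated_subgroup. Qed.

Lemma sub_adjoin H x : H `<=` adjoin H x.
Proof. by move=> y Hy; apply: sub_generated; left. Qed.

Lemma mem_adjoin H x : adjoin H x x.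
Proof. by apply: sub_generated; right. Qed.

Lemma adjoin_min H x J : is_subgroup J -> H `<=` J -> J x -> adjoin H x `<=` J.
Proof. by move=> sJ HJ Jx; apply: generated_min => // y [/HJ //|->]. Qed.

Lemma adjoin_eq H x J : is_subgroup J -> H `<=` J -> J x -> J `<=` adjoin H x ->
  adjoin H x = J.
Proof. by move=> sJ HJ Jx Jadj; apply/seteqP; split=> //; apply: adjoin_min. Qed.

Lemma adjoinV H x : adjoin H x^-1 = adjoin H x.
Proof.
have aux y : adjoin H y^-1 `<=` adjoin H y.
  apply: adjoin_min; [exact: adjoin_subgroup|exact: sub_adjoin|].
  exact: (subgroupV (adjoin_subgroup H y) (@mem_adjoin H y)).
by apply/seteqP; split=> //; have := aux x^-1; rewrite invgK.
Qed.

(** The extension depends only on the double coset [H x H]; this is why vertex pairs can be sorted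
    by double cosets. *)
Lemma adjoin_dcoset H x y z : is_subgroup H -> H y -> H z ->
  adjoin H (y * x * z) = adjoin H x.
Proof.
move=> sH Hy Hz; have sA u := adjoin_subgroup H u.
have yA u : adjoin H u y by apply: sub_adjoin.
have zA u : adjoin H u z by apply: sub_adjoin.
have mA u : adjoin H u u := @mem_adjoin H u.
apply/seteqP; split; apply: adjoin_min => //; try exact: sub_adjoin.
  exact: (subgroupM (sA x) (subgroupM (sA x) (yA x) (mA x)) (zA x)).
have := mA (y * x * z); rewrite -mulgA.
by move/(subgroupMl (sA _) (yA _))/(subgroupMr (sA _) (zA _)).
Qed.

Lemma adjoin_id H x : is_subgroup H -> H x -> adjoin H x = H.
Proof. by move=> sH Hx; apply: adjoin_eq => //; apply: sub_adjoin. Qed.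

Lemma trivial_subgroup : is_subgroup [set 1 : G].
Proof.
by apply/is_subgroupP; split=> // [x y -> ->|x ->]; rewrite ?mulg1 ?invg1.
Qed.

(** A homomorphism on a subgroup is a total function on [G], multiplicative on [H] and arbitrary
    elsewhere. *)
Definition hom_on (Q : groupType) H (f : G -> Q) :=
  forall x y, H x -> H y -> f (x * y) = f x * f y.

Section HomOn.
Variables (Q : groupType) (H : set G) (f : G -> Q).
Hypotheses (sH : is_subgroup H) (fM : hom_on H f).

Lemma hom_on1 : f 1 = 1.
Proof.
have H1 := subgroup1 sH; have := fM H1 H1; rewrite mulg1 => f11.
by apply: (mulgI (f 1)); rewrite -f11 mulg1.
Qed.

Lemma hom_onV x : H x -> f x^-1 = (f x)^-1.
Proof.
move=> Hx; apply: (mulgI (f x)).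
by rewrite -fM ?mulgV ?hom_on1 //; apply: subgroupV.
Qed.

End HomOn.

End SubgroupTheory.

Section HomOnTheory.
Local Open Scope classical_set_scope.
Local Open Scope group_scope.

Lemma preimage_subgroup (G Q : groupType) (H : set G) (f : G -> Q) (K : set Q) :
  is_subgroup H -> hom_on H f -> is_subgroup K ->
  is_subgroup (H `&` f @^-1` K).
Proof.
move=> sH fM sK; apply/is_subgroupP; split => [|x y [Hx fx] [Hy fy]|x [Hx fx]].
- by split; [exact: (subgroup1 sH)|rewrite /= (hom_on1 sH fM); exact: (subgroup1 sK)].
- by split; [exact: (subgroupM sH)|rewrite /= fM //; exact: (subgroupM sK)].
- by split; [exact: (subgroupV sH)|rewrite /= (hom_onV sH fM) //; exact: (subgroupV sK)].
Qed.

End HomOnTheory.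

(** * Free groups and free products *)

Section FreeGroupTheory.
Local Open Scope classical_set_scope.
Local Open Scope group_scope.
Variable I : choiceType.
Implicit Types (u v w : free_group I) (x : letter I) (s t : seq (letter I)).

Definition fg_letter x : free_group I := @FreeGroup I [:: x] isT.
Definition fg_gen (i : I) : free_group I := fg_letter (i, false).

Lemma fgword_inj : injective (@fgword I).
Proof. exact: val_inj. Qed.

Lemma fgwordM u v : fgword (u * v) = foldr (@push I) v u.
Proof. by []. Qed.

Lemma fgword1 : fgword (1 : free_group I) = [::].
Proof. by []. Qed.

Lemma fg_reduced u : reduced (fgword u).
Proof. exact: valP. Qed.

Lemma fgwordV u : fgword u^-1 = rev (map (@letter_inv I) u).
Proof. by []. Qed.

Lemma fg_letterV x : (fg_letter x)^-1 = fg_letter (letter_inv x).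
Proof. exact: fgword_inj. Qed.

Lemma fg_nil u : (fgword u == [::]) = (u == 1).
Proof. by rewrite -fgword1 (inj_eq fgword_inj). Qed.

Lemma fgword_prod s : fgword (\prod_(x <- s) fg_letter x) = foldr (@push I) [::] s.
Proof.
elim: s => [|x s IH]; first by rewrite big_nil.
by rewrite big_cons fgwordM IH.
Qed.

Lemma fg_expand u : \prod_(x <- fgword u) fg_letter x = u.
Proof.
by apply: fgword_inj; rewrite fgword_prod foldr_push_nil // fg_reduced.
Qed.

Lemma reduced_rcons s x : reduced (rcons s x) -> reduced s.
Proof.
rewrite /reduced; case: s => //= y s; rewrite rcons_path.
by case/andP.
Qed.

Lemma fg_rcons x s u : fgword u = rcons s x ->
  exists2 v, fgword v = s & u = v * fg_letter x.
Proof.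
move=> us; have := fg_reduced u; rewrite us => /reduced_rcons rs.
exists (FreeGroup rs) => //; rewrite -(fg_expand u) us -cats1 big_cat big_seq1.
by rewrite -(fg_expand (FreeGroup rs)).
Qed.

(* [u * x] either extends the word [u] by the letter [x] or cancels its last
   letter. *)
Lemma fg_mul_letter u x :
  fgword (u * fg_letter x) = rcons u x \/
  fgword u = rcons (u * fg_letter x) (letter_inv x).
Proof.
move us: (fgword u) => w0; case: (lastP w0) us => [|s y] us.
  by left; rewrite fgwordM us.
have [v vs uE] := fg_rcons us.
case: (y =P letter_inv x) => [yx|yx].
  right; rewrite -vs yx; congr rcons; rewrite uE yx -fg_letterV.
  by rewrite mulgVK.
left; have r : reduced (rcons (rcons s y) x).
  have := fg_reduced u; rewrite us /reduced.
  case: s {us vs} => [|z s] /=; last rewrite !rcons_path last_rcons => ->.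
    by rewrite andbT => _; apply/eqP=> xy; apply: yx; rewrite xy letter_invK.
  by apply/eqP=> xy; apply: yx; rewrite xy letter_invK.
by rewrite -[RHS]foldr_push_nil // fgwordM us -[in RHS]cats1 foldr_cat.
Qed.

Section Eval.
Variables (G : groupType) (e : I -> G).

Definition letter_val x : G := if x.2 then (e x.1)^-1 else e x.1.

Lemma letter_valV x : letter_val (letter_inv x) = (letter_val x)^-1.
Proof. by case: x => i [] /=; rewrite /letter_val /= ?invgK. Qed.

Lemma word_eval_cons x s : word_eval e (x :: s) = letter_val x * word_eval e s.
Proof. by rewrite /word_eval big_cons. Qed.

Lemma word_eval_push x s : word_eval e (push x s) = letter_val x * word_eval e s.
Proof.
case: s => [|y s] /=; first by rewrite word_eval_cons.
case: eqP => [->|_]; rewrite !word_eval_cons // letter_valV.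
by rewrite mulVKg.
Qed.

Lemma word_eval_foldr s t :
  word_eval e (foldr (@push I) t s) = word_eval e s * word_eval e t.
Proof.
elim: s => [|x s IH] /=; first by rewrite /word_eval big_nil mul1g.
by rewrite word_eval_push IH word_eval_cons mulgA.
Qed.

Definition fg_eval u : G := word_eval e (fgword u).

Lemma fg_evalM : {morph fg_eval : u v / u * v}.
Proof. by move=> u v; rewrite /fg_eval fgwordM word_eval_foldr. Qed.

Lemma fg_eval1 : fg_eval 1 = 1.
Proof. by rewrite /fg_eval /word_eval big_nil. Qed.

Lemma fg_evalV u : fg_eval u^-1 = (fg_eval u)^-1.
Proof. by apply: (mulgI (fg_eval u)); rewrite -fg_evalM !mulgV fg_eval1. Qed.

Lemma fg_eval_letter x : fg_eval (fg_letter x) = letter_val x.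
Proof. by rewrite /fg_eval /word_eval big_seq1. Qed.

Lemma fg_eval_gen i : fg_eval (fg_gen i) = e i.
Proof. by rewrite fg_eval_letter. Qed.

End Eval.

Lemma morph1 (G Q : groupType) (f : G -> Q) : {morph f : x y / x * y} -> f 1 = 1.
Proof. by move=> fM; apply: (mulgI (f 1)); rewrite -fM !mulg1. Qed.

Lemma morphV (G Q : groupType) (f : G -> Q) : {morph f : x y / x * y} ->
  {morph f : x / x^-1}.
Proof.
by move=> fM x; apply: (mulgI (f x)); rewrite -fM !mulgV (morph1 fM).
Qed.

Lemma fg_morphE (Q : groupType) (f : free_group I -> Q) :
  {morph f : u v / u * v} -> f =1 fg_eval (f \o fg_gen).
Proof.
move=> fM u; rewrite -[in LHS](fg_expand u) /fg_eval /word_eval.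
elim: (fgword u) => [|x s IH]; first by rewrite !big_nil (morph1 fM).
rewrite !big_cons fM IH; congr (_ * _); case: x => i [] //=.
by rewrite -(morphV fM) /fg_gen fg_letterV.
Qed.

Lemma fg_eval_mem (G : groupType) (e : I -> G) (J : set G) u :
  is_subgroup J -> (forall i, J (e i)) -> J (fg_eval e u).
Proof.
move=> sJ Je; apply: subgroup_prod => // x _; case: ifP => _ //.
exact: (subgroupV sJ).
Qed.

Lemma fg_eval_generated (G : groupType) (e : I -> G) (x : G) :
  subgroup_generated (range e) x <-> exists u, fg_eval e u = x.
Proof.
split=> [|[u <-]]; last first.
  apply: (fg_eval_mem _ (generated_subgroup _)) => i.
  by apply: (@sub_generated _ (range e)); exists i.
move: x; apply: generated_min; last by move=> _ [i _ <-]; exists (fg_gen i); rewrite fg_eval_gen.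
apply/is_subgroupP; split => [|_ _ [u <-] [v <-]|_ [u <-]].
- by exists 1; rewrite fg_eval1.
- by exists (u * v); rewrite fg_evalM.
- by exists u^-1; rewrite fg_evalV.
Qed.

Lemma fg_generated : subgroup_generated (range fg_gen) = setT.
Proof.
apply/seteqP; split=> // u _; apply/fg_eval_generated; exists u.
by rewrite -(@fg_morphE _ id).
Qed.

Lemma free_basis_ev_inj (G : groupType) (J : set G) (e : I -> G) :
  free_basis J e -> injective (fg_eval e).
Proof.
move=> [_ fe] u v uv; apply/eqP; rewrite -divg_eq1 -fg_nil; apply/negP => /negP h.
have := fe _ (fg_reduced (u * v^-1)) h.
by rewrite -[word_eval _ _]/(fg_eval e (u * v^-1)) fg_evalM fg_evalV uv mulgV eqxx.
Qed.

Lemma free_basis_subgroup (G : groupType) (J : set G) (e : I -> G) :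
  free_basis J e -> is_subgroup J.
Proof. by case=> -> _; apply: generated_subgroup. Qed.

Lemma free_basis_mem (G : groupType) (J : set G) (e : I -> G) i :
  free_basis J e -> J (e i).
Proof. by case=> -> _; apply: (@sub_generated _ (range e)); exists i. Qed.

Lemma free_basis_coord (G : groupType) (J : set G) (e : I -> G) :
  free_basis J e -> exists th : G -> free_group I,
  [/\ hom_on J th, forall u, th (fg_eval e u) = u & forall x : G, J x -> fg_eval e (th x) = x].
Proof.
move=> fe; have ei := free_basis_ev_inj fe; pose th (x : G) := xget 1 [set u | fg_eval e u = x].
have thK u : th (fg_eval e u) = u by apply: ei; apply: (@xgetPex _ 1 [set v | _ v = _]); exists u.
have JE (x : G) : J x -> exists u, fg_eval e u = x by have [-> _] := fe; move/fg_eval_generated.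
exists th; split=> // [x y /JE[u <-] /JE[v <-]|x /JE[u <-]]; last by rewrite thK.
by rewrite -fg_evalM !thK.
Qed.

(** A homomorphism sending each [e i] back to the generator [i] is a left inverse of evaluation, so
    no nonempty reduced word evaluates to 1. Bases of free products and of one-generator extensions
    are recognised this way. *)
Lemma free_basis_hom (G : groupType) (J : set G) (e : I -> G) (th : G -> free_group I) :
  J = subgroup_generated (range e) -> hom_on J th -> (forall i, th (e i) = fg_gen i) ->
  free_basis J e.
Proof.
move=> JE thM the; split=> // s rs s0; have sJ : is_subgroup J by rewrite JE; exact: generated_subgroup.
have Je i : J (e i) by rewrite JE; apply: (@sub_generated _ (range e)); exists i.
apply/eqP => s1; have := congr1 th s1; rewrite (hom_on1 sJ thM).
rewrite -[word_eval e s]/(fg_eval e (FreeGroup rs)).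
suff -> : th (fg_eval e (FreeGroup rs)) = FreeGroup rs.
  by move/(congr1 (@fgword I)) => /= /eqP; apply/negP.
have thM' : {morph th \o fg_eval e : u v / u * v}.
  by move=> u v /=; rewrite fg_evalM thM //; apply: fg_eval_mem.
rewrite -[LHS]/((th \o fg_eval e) _) (fg_morphE thM').
transitivity (fg_eval (id \o fg_gen) (FreeGroup rs)); last by rewrite -(@fg_morphE _ id).
by apply: eq_bigr => x _; rewrite /= fg_eval_gen the.
Qed.

End FreeGroupTheory.

(** * The universal property of free products *)

Section FreeProductTheory.
Local Open Scope classical_set_scope.
Local Open Scope group_scope.
Variables (G : groupType) (J A B : set G).
Hypotheses (sA : is_subgroup A) (sB : is_subgroup B) (JAB : free_product J A B).

Let ok (p : bool * G) := if p.1 then A p.2 else B p.2.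

Let val (Q : groupType) (f g : G -> Q) (s : seq (bool * G)) :=
  \prod_(p <- s) (if p.1 then f p.2 else g p.2).

(** Drop trivial letters and merge neighbours from the same factor. The result does not depend on
    [f] and [g], so the instance with two identities compares the products in [G] itself. *)
Lemma alternating_form (s : seq (bool * G)) : (forall p, p \in s -> ok p) ->
  exists s', [/\ forall p, p \in s' -> ok p /\ p.2 <> 1, sorted (fun p q => p.1 != q.1) s'
  & forall (Q : groupType) (f g : G -> Q), hom_on A f -> hom_on B g -> val f g s' = val f g s].
Proof.
elim: s => [|p s IH] Hs; first by exists [::]; split.
have op : ok p by apply: Hs; rewrite mem_head.
have [|s' [os' ss' vs']] := IH.
  by move=> q qs; apply: Hs; rewrite inE qs orbT.
have H1 (Q : groupType) (f g : G -> Q) : hom_on A f -> hom_on B g -> p.2 = 1 ->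
    (if p.1 then f p.2 else g p.2) = 1.
  by move=> fM gM ->; case: ifP => _; [rewrite (hom_on1 sA fM)|rewrite (hom_on1 sB gM)].
case: (pselect (p.2 = 1)) => p1.
  exists s'; split=> // Q f g fM gM; rewrite vs' // /val big_cons H1 //.
  by rewrite mul1g.
case: s' os' ss' vs' => [|q s'] os' ss' vs'.
  exists [:: p]; split=> // [q|Q f g fM gM]; first by rewrite inE => /eqP ->.
  by rewrite /val !big_cons -/(val f g s) -vs' // /val big_nil.
case: (p.1 =P q.1) => pq; last first.
  exists [:: p, q & s']; split=> [r||Q f g fM gM].
  - by rewrite inE => /orP[/eqP ->//|/os'].
  - by rewrite /=; move: ss' => /= ->; rewrite andbT; apply/eqP.
  - by rewrite /val big_cons -/(val f g (q :: s')) vs' // /val big_cons.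
have [oq q1] := os' q (mem_head _ _).
have os'' r : r \in s' -> ok r /\ r.2 <> 1 by move=> rs; apply: os'; rewrite inE rs orbT.
have Hpq (Q : groupType) (f g : G -> Q) : hom_on A f -> hom_on B g ->
    (if p.1 then f (p.2 * q.2) else g (p.2 * q.2)) =
    (if p.1 then f p.2 else g p.2) * (if q.1 then f q.2 else g q.2).
  by move=> fM gM; move: op oq; rewrite /ok -pq; case: ifP => _ ? ?; rewrite (fM, gM).
have op' : ok (p.1, p.2 * q.2).
  move: op oq; rewrite /ok -pq /=; case: ifP => _; [exact: (subgroupM sA)|exact: (subgroupM sB)].
case: (pselect (p.2 * q.2 = 1)) => pq1.
  exists s'; split=> // [|Q f g fM gM]; first exact: path_sorted ss'.
  rewrite /val big_cons -/(val f g s) -vs' // /val big_cons mulgA -Hpq // pq1.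
  by case: ifP; rewrite ?(hom_on1 sA fM) ?(hom_on1 sB gM) mul1g.
exists ((p.1, p.2 * q.2) :: s'); split=> [r||Q f g fM gM].
- by rewrite inE => /orP[/eqP ->//|/os''].
- by move: ss'; rewrite /=; case: (s') => //= z s2; rewrite pq.
- rewrite [RHS]/val big_cons -/(val f g s) -vs' // /val !big_cons /= Hpq //.
  by rewrite mulgA.
Qed.

Let sJ : is_subgroup J.
Proof. by have [-> _] := JAB; apply: generated_subgroup. Qed.

Lemma free_product_word x : J x ->
  exists2 s, (forall p, p \in s -> ok p) & x = \prod_(p <- s) p.2.
Proof.
have [-> _] := JAB; move: x; apply: generated_min.
  apply/is_subgroupP; split=> [|x y [s os ->] [t ot ->]|x [s os ->]].
  - by exists [::]; rewrite ?big_nil.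
  - exists (s ++ t); last by rewrite big_cat.
    by move=> p; rewrite mem_cat => /orP[/os|/ot].
  - exists [seq (p.1, p.2^-1) | p <- rev s].
      move=> p /mapP[q]; rewrite mem_rev => /os; rewrite /ok => oq -> /=.
      by move: oq; case: ifP => _; [exact: (subgroupV sA)|exact: (subgroupV sB)].
    by rewrite big_map /= prodgV revK.
move=> x [Ax|Bx]; [exists [:: (true, x)]|exists [:: (false, x)]];
  rewrite ?big_seq1 // => p; by rewrite inE => /eqP ->.
Qed.

(** A word with product 1 has the empty alternating form, since nonempty ones have nontrivial
    product. Hence the value of a word under [f] and [g] depends only on its product. *)
Lemma free_product_hom (Q : groupType) (f g : G -> Q) : hom_on A f -> hom_on B g ->
  exists h, [/\ hom_on J h, forall x, A x -> h x = f x & forall x, B x -> h x = g x].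
Proof.
move=> fM gM.
have valE s : (forall p, p \in s -> ok p) -> \prod_(p <- s) p.2 = 1 -> val f g s = 1.
  move=> os s1; have [s' [os' ss' vs']] := alternating_form os.
  rewrite -vs' //; case: (altP (s' =P [::])) => [->|s'0]; first by rewrite /val big_nil.
  have [_ /(_ s' os' ss' s'0)] := JAB.
  suff -> : \prod_(p <- s') p.2 = 1 by rewrite eqxx.
  have := vs' G id id (fun _ _ _ _ => erefl) (fun _ _ _ _ => erefl).
  by rewrite /val; under eq_bigr do rewrite if_same; rewrite -/(val f g s) => ->;
     under eq_bigr do rewrite if_same.
pose wd x := xget [::] [set s | (forall p, p \in s -> ok p) /\ x = \prod_(p <- s) p.2].
have wdP x : J x -> (forall p, p \in wd x -> ok p) /\ x = \prod_(p <- wd x) p.2.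
  move=> /free_product_word[s os xs].
  by apply: (@xgetPex _ [::] [set s | (forall p, p \in s -> ok p) /\ x = \prod_(p <- s) p.2]); exists s.
have valU s x : J x -> (forall p, p \in s -> ok p) -> \prod_(p <- s) p.2 = x ->
    val f g s = val f g (wd x).
  move=> Jx os sx; have [ow wE] := wdP _ Jx.
  pose t := [seq (p.1, p.2^-1) | p <- rev (wd x)].
  have ot p : p \in t -> ok p.
    move=> /mapP[q]; rewrite mem_rev => /ow; rewrite /ok => oq -> /=.
    by move: oq; case: ifP => _; [exact: (subgroupV sA)|exact: (subgroupV sB)].
  have tE : \prod_(p <- t) p.2 = x^-1 by rewrite /t big_map /= prodgV revK -wE.
  have vt : val f g t = (val f g (wd x))^-1.
    rewrite /val -[in RHS](revK (wd x)) -prodgV /t big_map.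
    apply: eq_big_seq => p; rewrite mem_rev => /ow /=.
    rewrite /ok; case: ifP => _ ?; first by rewrite (hom_onV sA fM).
    by rewrite (hom_onV sB gM).
  have := valE (s ++ t); rewrite /val !big_cat /= -!/(val f g _) vt sx tE mulgV => h.
  apply/eqP; rewrite -divg_eq1; apply/eqP/h => // p.
  by rewrite mem_cat => /orP[/os|/ot].
exists (fun x => val f g (wd x)); split=> [x y Jx Jy|x Ax|x Bx].
- have [ox xE] := wdP _ Jx; have [oy yE] := wdP _ Jy.
  rewrite -(@valU (wd x ++ wd y)); [by rewrite /val big_cat|exact: (subgroupM sJ)| |].
    by move=> p; rewrite mem_cat => /orP[/ox|/oy].
  by rewrite big_cat -xE -yE.
- rewrite -(@valU [:: (true, x)]) ?/val ?big_seq1 //.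
    by have [-> _] := JAB; apply: (@sub_generated _ (A `|` B)); left.
  by move=> p; rewrite inE => /eqP ->.
- rewrite -(@valU [:: (false, x)]) ?/val ?big_seq1 //.
    by have [-> _] := JAB; apply: (@sub_generated _ (A `|` B)); right.
  by move=> p; rewrite inE => /eqP ->.
Qed.

End FreeProductTheory.

(** The number of distinct values depends only on which arguments are identified, so labels may be
    counted in place of cosets. *)
Lemma size_undup_map (T : eqType) (U V : eqType) (f : T -> U) (g : T -> V) (s : seq T) :
  {in s &, forall x y, f x = f y <-> g x = g y} ->
  size (undup (map f s)) = size (undup (map g s)).
Proof.
elim: s => //= x s IH fg.
have fgs : {in s &, forall y z, f y = f z <-> g y = g z}.
  by move=> y z ys zs; apply: fg; rewrite inE ?ys ?zs orbT.
have -> : (f x \in map f s) = (g x \in map g s).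
  apply/mapP/mapP => -[y ys xy]; exists y => //;
    by apply/fg; rewrite ?mem_head // inE ys orbT.
by case: ifP => _ /=; rewrite IH.
Qed.

Lemma sumn_map_const (T : eqType) (f : T -> nat) (c : nat) (s : seq T) :
  (forall t, t \in s -> f t = c) -> sumn (map f s) = (size s * c)%N.
Proof.
elim: s => //= t s IH fc; rewrite fc ?mem_head // mulSn IH // => u us.
by apply: fc; rewrite inE us orbT.
Qed.

(** * Counting homomorphisms to symmetric groups *)

Section Cosets.
Local Open Scope classical_set_scope.
Local Open Scope group_scope.
Variable G : groupType.
Implicit Types (M : set G) (y z : G).

(** The set under [xget] is the right coset [M y] itself, so the choice is constant on cosets and
    equality of cosets becomes equality of elements. *)
Definition coset_rep M y : G := xget 1 [set z | M (z * y^-1)].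

Lemma coset_repP M y : is_subgroup M -> M (coset_rep M y * y^-1).
Proof.
move=> sM; apply: (@xgetPex _ 1 [set z | M (z * y^-1)]); exists y => /=.
by rewrite mulgV; exact: (subgroup1 sM).
Qed.

Lemma coset_rep_eq M y z : is_subgroup M ->
  coset_rep M y = coset_rep M z <-> M (y * z^-1).
Proof.
move=> sM; split=> [yz|yz].
  apply: (subgroup_trans sM _ (coset_repP z sM)); rewrite -yz.
  exact: (subgroup_sym sM (coset_repP y sM)).
congr (xget 1 _); apply/seteqP; split=> t /= ty.
  exact: (subgroup_trans sM ty yz).
exact: (subgroup_trans sM ty (subgroup_sym sM yz)).
Qed.

Lemma coset_repK M y : is_subgroup M -> coset_rep M (coset_rep M y) = coset_rep M y.
Proof. by move=> sM; apply/(coset_rep_eq _ _ sM); exact: coset_repP. Qed.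

Definition ncosets M (s : seq G) := size (undup (map (coset_rep M) s)).

Lemma ncosets_cons M y s : is_subgroup M ->
  ncosets M (y :: s) = if `[< exists2 w, w \in s & M (y * w^-1) >]
                       then ncosets M s else (ncosets M s).+1.
Proof.
move=> sM; rewrite /ncosets /=.
suff -> : (coset_rep M y \in map (coset_rep M) s) =
   `[< exists2 w, w \in s & M (y * w^-1) >] by case: ifP.
apply/mapP/asboolP => -[w ws yw]; exists w => //; exact/(coset_rep_eq _ _ sM).
Qed.

End Cosets.

(** * Prefix-closed sets of reduced words *)

Section Trees.
Local Open Scope group_scope.
Variable I : choiceType.
Local Notation F := (free_group I).
Implicit Types (P : seq F) (x : letter I).

(* Finite prefix-closed sets of reduced words, listed so that each word comes
   before its prefixes. *)
Inductive tree : seq F -> Prop :=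
| tree_root : tree [:: 1]
| tree_leaf y P p x : tree P -> p \in P -> y \notin P ->
    fgword y = rcons (fgword p) x -> tree (y :: P).

Lemma tree_one P : tree P -> 1 \in P.
Proof. by elim=> [|y Q p x _ IH _ _ _]; rewrite inE ?eqxx // IH orbT. Qed.

Lemma fg_rcons_mul (y p : F) x : fgword y = rcons (fgword p) x -> y = p * fg_letter x.
Proof.
by move=> /fg_rcons[v vp ->]; congr (_ * _); apply: fgword_inj.
Qed.

Lemma tree_closed P y s x : tree P -> y \in P -> fgword y = rcons s x ->
  exists2 p, p \in P & fgword p = s.
Proof.
elim=> [|z Q p x' _ IH pQ zQ zp].
  by rewrite inE => /eqP -> /(congr1 size); rewrite size_rcons.
rewrite inE => /predU1P[->|yQ] yE.
  exists p; first by rewrite inE pQ orbT.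
  by move: yE; rewrite zp => /rcons_inj[].
by have [q qQ qs] := IH yQ yE; exists q => //; rewrite inE qQ orbT.
Qed.

(** Induction on the length of [w] adds its missing prefixes; the prefix-closed property [S]
    confines the extension to a given set. *)
Lemma tree_extend_in (S : F -> Prop) P (w : F) :
  (forall u v x, S u -> fgword u = rcons (fgword v) x -> S v) ->
  tree P -> (forall u, u \in P -> S u) -> S w ->
  exists Q, [/\ tree (Q ++ P), w \in Q ++ P & forall u, u \in Q ++ P -> S u].
Proof.
move=> Scl tP PS; move: {2}(size (fgword w)) (erefl (size (fgword w))) => n.
elim: n w => [|n IH] w wn Sw.
  exists [::]; split=> //; have -> : w = 1 by apply: fgword_inj; apply/size0nil.
  exact: tree_one.
move ws: (fgword w) wn => w0; case: (lastP w0) ws => [//|s x] ws sn.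
have [v vs wE] := fg_rcons ws; rewrite -vs in ws.
have [||Q [tQ vQ QS]] := IH v; [by rewrite vs; move: sn; rewrite size_rcons => -[]|exact: Scl ws|].
case: (boolP (w \in Q ++ P)) => wQ; first by exists Q.
exists (w :: Q); split; last 2 first.
- exact: mem_head.
- by move=> u; rewrite inE => /predU1P[->|/QS].
exact: (@tree_leaf w (Q ++ P) v x).
Qed.

Lemma tree_extend P (w : F) : tree P -> exists Q, tree (Q ++ P) /\ w \in Q ++ P.
Proof.
move=> tP; have [Q [tQ wQ _]] := @tree_extend_in (fun=> True) P w
  (fun _ _ _ _ _ => Logic.I) tP (fun _ _ => Logic.I) Logic.I.
by exists Q.
Qed.

Lemma prefix_closed_tree (s : seq F) : 1 \in s ->
  (forall u v x, u \in s -> fgword u = rcons (fgword v) x -> v \in s) ->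
  exists2 P, tree P & P =i s.
Proof.
move=> s1 scl.
suff [P [tP sP Ps]] : exists P, [/\ tree P, {subset s <= P} & {subset P <= s}].
  by exists P => // u; apply/idP/idP => [/Ps|/sP].
suff h (t : seq F) : {subset t <= s} ->
    exists P, [/\ tree P, {subset t <= P} & {subset P <= s}] by apply: h.
elim: t => [_|w t IH ts].
  by exists [:: 1]; split=> [||u /[!inE] /eqP ->] //; exact: tree_root.
have [|P [tP tsP Ps]] := IH; first by move=> u ut; apply: ts; rewrite inE ut orbT.
have [|Q [tQ wQ QS]] := tree_extend_in scl tP Ps (w := w); first by apply: ts; rewrite mem_head.
exists (Q ++ P); split=> // u; rewrite inE => /predU1P[->//|/tsP uP].
by rewrite mem_cat uP orbT.
Qed.

Lemma tree_extend_all P (s : seq F) : tree P ->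
  exists Q, tree (Q ++ P) /\ {subset s <= Q ++ P}.
Proof.
move=> tP; elim: s => [|w s [Q [tQ sQ]]]; first by exists [::].
have [Q' [tQ' wQ']] := tree_extend w tQ; exists (Q' ++ Q); rewrite -catA; split=> //.
by move=> u; rewrite inE => /predU1P[-> //|/sQ uQ]; rewrite mem_cat uQ orbT.
Qed.

End Trees.

(** * Extending partial injections to permutations *)

Section PermExtension.
Variable T : finType.

Lemma perm_extend (A : {set T}) (f : T -> T) : {in A &, injective f} ->
  exists s : {perm T}, {in A, s =1 f}.
Proof.
move: {2}#|A| (erefl #|A|) => n; elim: n A => [|n IH] A An fi.
  by exists 1%g => x; rewrite (cards0_eq An) inE.
have [x xA] : exists x, x \in A by apply/card_gt0P; rewrite An.
have [|y z|s sf] := IH (A :\ x).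
- by apply/eqP; rewrite -(eqn_add2l 1) -[X in (X + _)%N == _]/((true : nat)) -xA -cardsD1 An.
- by rewrite !inE => /andP[_ yA] /andP[_ zA]; apply: fi.
(* Correct [s] at [x] by a transposition; it moves only [s x] and [f x], which are not values of [s]
   on the rest of [A]. *)
exists (s * tperm (s x) (f x))%g => y yA; rewrite permM.
case: (y =P x) => [->|/eqP yx]; first by rewrite tpermL.
have yA' : y \in A :\ x by rewrite !inE yx.
have h1 : s x != s y by rewrite (inj_eq perm_inj) eq_sym.
have h2 : f x != s y by rewrite sf //; apply: contra yx => /eqP/fi ->.
by rewrite tpermD // sf.
Qed.

(** Given one extension [s], all others are [u * s] with [u] a permutation of the complement of
    [A]. *)
Lemma card_perm_extend (A : {set T}) (f : T -> T) : {in A &, injective f} ->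
  #|[set s : {perm T} | [forall x in A, s x == f x]]| = (#|T| - #|A|)`!.
Proof.
move=> /perm_extend[s sf].
have -> : (#|T| - #|A|)%N = #|~: A| by rewrite [RHS]cardsCs finset.setCK.
rewrite -card_perm -[RHS](card_imset _ (mulIg s)).
apply: eq_card => t; rewrite inE; apply/forall_inP/imsetP => [tf|[u uA ->] x xA].
  exists (t * s^-1)%g; last by rewrite mulgVK.
  rewrite unfold_in; apply/fintype.subsetP => x; rewrite !inE; apply: contra => xA.
  by rewrite permM (eqP (tf x xA)) -sf // permK.
rewrite permM -sf // (out_perm uA) //; by rewrite inE xA.
Qed.

End PermExtension.

(** * Homomorphisms with a prescribed orbit pattern *)

Section Counting.
Local Open Scope classical_set_scope.
Local Open Scope group_scope.
Variables k n : nat.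
Local Notation F := (free_group 'I_k).
Implicit Types (P : seq F) (M : set F) (a : {ffun 'I_k -> 'S_n.+1}).

Definition edges_at (P : seq F) (j : 'I_k) : seq F := [seq w <- P | w * fg_gen j \in P].

Definition orbit_pt a (w : F) : 'I_n.+1 := fg_eval a w ord0.

Definition coset_label M P (f : F -> 'I_n.+1) : Prop :=
  {in P &, forall w w', f w = f w' <-> M (w * w'^-1)}.

Lemma orbit_ptM a w j : orbit_pt a (w * fg_gen j) = a j (orbit_pt a w).
Proof. by rewrite /orbit_pt fg_evalM permM fg_eval_gen. Qed.

(** The orbit of the base point grows one edge at a time. A leaf reached by an inverse letter is an
    edge read backwards, and injectivity of [a j] determines its label. *)
Lemma tree_orbitP P a (f : F -> 'I_n.+1) : tree P -> f 1 = ord0 ->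
  {in P, orbit_pt a =1 f} <->
  (forall j, {in edges_at P j, forall w, a j (f w) = f (w * fg_gen j)}).
Proof.
move=> tP f1; split=> [af j w|].
  by rewrite mem_filter => /andP[wP' wP]; rewrite -!af // orbit_ptM.
elim: tP => [|y Q p x tQ IH pQ yQ yp] af w.
  by rewrite inE => /eqP ->; rewrite f1 /orbit_pt fg_eval1 perm1.
have {}IH : {in Q, orbit_pt a =1 f}.
  apply: IH => j u; rewrite mem_filter => /andP[uQ' uQ]; apply: af.
  by rewrite mem_filter !inE uQ uQ' !orbT.
rewrite inE => /predU1P[->|/IH //].
have yE := fg_rcons_mul yp; case: x yE {yp} => j [] yE.
  have yp : y * fg_gen j = p by rewrite yE -[fg_gen j]invgK fg_letterV mulgK.
  apply: (@perm_inj _ (a j)); rewrite -orbit_ptM yp IH // af ?yp //.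
  by rewrite mem_filter yp !inE pQ eqxx orbT.
rewrite yE orbit_ptM IH // af //.
by rewrite mem_filter -[p * _]yE !inE pQ eqxx orbT.
Qed.

(** An edge with label [j] is determined by its source, so counting cosets of sources counts edges
    of the image graph. *)
Definition nedges M P j := ncosets M (edges_at P j).

Lemma edges_atP P j w : reflect (w \in P /\ w * fg_gen j \in P) (w \in edges_at P j).
Proof. by rewrite mem_filter andbC; apply: andP. Qed.

(** Once the labels are fixed, the constraints separate over the generators: each [a j] has to
    extend a partial injection defined on [nedges M P j] points. *)
Lemma card_label_orbits M P (f : F -> 'I_n.+1) : is_subgroup M -> tree P ->
  f 1 = ord0 -> coset_label M P f ->
  #|[set a | [forall i : 'I_(size P), orbit_pt a (nth 1 P i) == f (nth 1 P i)]]%SET| =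
  (\prod_(j < k) (n.+1 - nedges M P j)`!)%N.
Proof.
move=> sM tP f1 fM.
pose A j := [set i | i \in map f (edges_at P j)]%SET.
(* [index] picks the first source with label [i]. As labels separate exactly the cosets of [M], the
   target label is independent of this choice and distinct sources have distinct targets. *)
pose g j i := f (nth 1 (edges_at P j) (index i (map f (edges_at P j))) * fg_gen j).
have gE j w : w \in edges_at P j -> g j (f w) = f (w * fg_gen j).
  move=> wP; have fwP := map_f f wP.
  set u := nth 1 (edges_at P j) (index (f w) (map f (edges_at P j))).
  have iP : (index (f w) (map f (edges_at P j)) < size (edges_at P j))%N.
    by rewrite -(size_map f) index_mem.
  have uP : u \in edges_at P j by apply: mem_nth.
  have fu : f u = f w by rewrite -(nth_map 1 ord0) // nth_index.
  have [uP1 uP2] := edges_atP _ _ _ uP; have [wP1 wP2] := edges_atP _ _ _ wP.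
  apply/(fM _ _ uP2 wP2); rewrite invgM mulgA mulgK.
  exact/(fM _ _ uP1 wP1).
have gi j : {in A j &, injective (g j)}.
  move=> _ _ /[!inE] /mapP[w wP ->] /mapP[w' wP' ->]; rewrite !gE //.
  have [P1 P2] := edges_atP _ _ _ wP; have [P1' P2'] := edges_atP _ _ _ wP'.
  move/(fM _ _ P2 P2'); rewrite invgM mulgA mulgK => /(fM _ _ P1 P1').
  by [].
have cA j : #|A j| = nedges M P j.
  rewrite /nedges /ncosets -(@size_undup_map _ _ _ f).
    rewrite cardsE -(card_uniqP (undup_uniq _)); apply: eq_card => i.
    by rewrite mem_undup.
  move=> w w' /edges_atP[wP _] /edges_atP[wP' _].
  by rewrite (fM _ _ wP wP') (coset_rep_eq _ _ sM).
rewrite (eq_card (B := family (fun j => [set s : 'S_n.+1 | [forall i in A j, s i == g j i]]%SET))).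
  rewrite card_family /= foldrE big_map enumT; apply: eq_bigr => j _.
  by rewrite card_perm_extend // card_ord cA.
move=> a; rewrite inE; apply/forallP/familyP => [af j|af i].
  rewrite inE; apply/forall_inP => _ /[!inE] /mapP[w wP ->].
  rewrite gE //; apply/eqP; move: j w wP; apply/(tree_orbitP a tP f1) => w wP.
  have iP : (index w P < size P)%N by rewrite index_mem.
  by have /eqP := af (Ordinal iP); rewrite /= nth_index.
have {}af : {in P, orbit_pt a =1 f}.
  apply/(tree_orbitP a tP f1) => j w wP; have := af j; rewrite inE => /forall_inP.
  by move/(_ (f w)); rewrite inE map_f // => /(_ isT)/eqP ->; rewrite gE.
by apply/eqP/af/mem_nth.
Qed.

Lemma ncosets_gt0 M P : tree P -> (0 < ncosets M P)%N.
Proof.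
move=> tP; rewrite /ncosets; set s := undup _.
suff : coset_rep M 1 \in s by case: s.
by rewrite mem_undup map_f // tree_one.
Qed.

Lemma labelings M P : is_subgroup M -> tree P ->
  exists B : seq (seq 'I_n.+1),
  [/\ uniq B, size B = (n ^_ (ncosets M P).-1)%N & forall t, t \in B <->
    exists f, [/\ t = map f P, f 1 = ord0 & coset_label M P f]].
Proof.
move=> sM; elim=> [|y Q p x tQ [B [uB sB BP]] pQ yQ _].
  exists [:: [:: ord0]]; split=> // t; rewrite inE; split=> [/eqP ->|[f [-> f1 _]]].
    exists (fun=> ord0); split=> // w w' /[!inE] /eqP -> /eqP ->; rewrite mulgV.
    by split=> // _; exact: (subgroup1 sM).
  by rewrite /= f1.
have y1 : 1 != y by apply: contra yQ => /eqP <-; apply: tree_one.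
rewrite ncosets_cons //; case: asboolP => [[w wQ yw]|yn].
  have idx (f : F -> 'I_n.+1) : nth ord0 (map f Q) (index w Q) = f w.
    by rewrite (nth_map 1) ?index_mem // nth_index.
  exists (map (fun t => nth ord0 t (index w Q) :: t) B); split.
  - by rewrite map_inj_uniq // => s t [].
  - by rewrite size_map.
  move=> t; split=> [/mapP[_ /BP[f [-> f1 fM]] ->]|[f [-> f1 fM]]].
    (* Only the values of [f] on [Q] are controlled; composing with [z] gives the leaf the label of
       the equivalent word [w]. *)
    pose z u := if u == y then w else u.
    have zQ u : u \in y :: Q -> z u \in Q.
      by rewrite inE /z; case: eqP => [|_] //.
    have zM u : M (u * (z u)^-1).
      by rewrite /z; case: eqP => [-> //|_]; rewrite mulgV; exact: (subgroup1 sM).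
    exists (f \o z); split.
    - rewrite idx /= /z eqxx; congr (_ :: _); apply/eq_in_map => u uQ /=.
      by case: eqP => // uy; rewrite -uy uQ in yQ.
    - by rewrite /= /z (negbTE y1).
    move=> u v /zQ uQ /zQ vQ /=; rewrite (fM _ _ uQ vQ); split=> h.
      exact: (subgroup_trans sM (zM u) (subgroup_trans sM h (subgroup_sym sM (zM v)))).
    exact: (subgroup_trans sM (subgroup_sym sM (zM u)) (subgroup_trans sM h (zM v))).
  apply/mapP; exists (map f Q).
    apply/BP; exists f; split=> // u v uQ vQ; apply: fM; by rewrite inE ?uQ ?vQ orbT.
  rewrite idx /=; congr (_ :: _); apply/(fM y w) => //; by rewrite inE ?eqxx // wQ orbT.
have szB t : t \in B -> size [seq v <- enum 'I_n.+1 | v \notin t] = (n.+1 - ncosets M Q)%N.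
  move=> /BP[f [-> f1 fM]].
  rewrite -(card_uniqP (filter_uniq _ (enum_uniq _))).
  have -> : ncosets M Q = #|map f Q|.
    rewrite /ncosets -(@size_undup_map _ _ _ f).
      by rewrite -(card_uniqP (undup_uniq _)); apply: eq_card => i; rewrite mem_undup.
    by move=> u v uQ vQ; rewrite (fM _ _ uQ vQ) (coset_rep_eq _ _ sM).
  rewrite -[X in (X - _)%N](card_ord n.+1) -(cardC (mem (map f Q))) addKn.
  by apply: eq_card => i; rewrite mem_filter mem_enum andbT.
exists [seq v :: t | t <- B, v <- [seq v <- enum 'I_n.+1 | v \notin t]]; split.
- apply: allpairs_uniq_dep => // [t _|[t v] [t' v'] _ _ [-> ->] //].
  by apply: filter_uniq; apply: enum_uniq.
- rewrite size_allpairs_dep (sumn_map_const szB) sB /=.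
  have := ncosets_gt0 M tQ; case: (ncosets M Q) => // V _ /=.
  by rewrite ffactnSr mulnC subSS.
move=> t; split=> [/allpairsPdep[s [v [/BP[f [-> f1 fM]]]]]|[f [-> f1 fM]]].
  rewrite mem_filter => /andP[vs _] ->.
  pose g u := if u == y then v else f u.
  have gf u : u \in Q -> g u = f u.
    by rewrite /g; case: eqP => // -> yQ'; rewrite yQ' in yQ.
  exists g; split.
  - have gy : g y = v by rewrite /g eqxx.
    rewrite [RHS]map_cons gy; congr cons.
    by apply/eq_in_map => u uQ; rewrite gf.
  - by rewrite gf // tree_one.
  have gy u : u \in Q -> (g y = g u <-> M (y * u^-1)) /\ (g u = g y <-> M (u * y^-1)).
    move=> uQ; rewrite (gf u) //; have -> : g y = v by rewrite /g eqxx.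
    have vfu : v <> f u by move=> vu; rewrite vu map_f in vs.
    have nM : ~ M (y * u^-1) by move=> yu; apply: yn; exists u.
    split; split=> //; first by move/esym.
    by move/(subgroup_sym sM).
  move=> u u' /[!inE] /predU1P[->|uQ] /predU1P[->|uQ'].
  - by split=> // _; rewrite mulgV; exact: (subgroup1 sM).
  - by have [] := gy _ uQ'.
  - by have [] := gy _ uQ.
  - by rewrite !gf //; apply: fM.
apply/allpairsPdep; exists (map f Q), (f y); split=> //.
  apply/BP; exists f; split=> // u v uQ vQ; apply: fM; by rewrite inE ?uQ ?vQ orbT.
rewrite mem_filter mem_enum andbT; apply/mapP => -[u uQ fyu]; apply: yn; exists u => //.
by apply/(fM y u) => //; rewrite inE ?eqxx // uQ orbT.
Qed.

(** Pairs of indices rather than of words make patterns a finite type, over which homomorphisms can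
    be partitioned. *)
Definition orbit_pattern P a : {set 'I_(size P) * 'I_(size P)} :=
  [set ij : 'I_(size P) * 'I_(size P) | orbit_pt a (nth 1 P ij.1) == orbit_pt a (nth 1 P ij.2)]%SET.

Definition coset_pattern M P : {set 'I_(size P) * 'I_(size P)} :=
  [set ij : 'I_(size P) * 'I_(size P) | `[< M (nth 1 P ij.1 * (nth 1 P ij.2)^-1) >]]%SET.

Lemma mem_coset_pattern M P i j :
  (i, j) \in coset_pattern M P <-> M (nth 1 P i * (nth 1 P j)^-1).
Proof. by rewrite inE /=; split=> /asboolP. Qed.

Lemma coset_patternP M P w w' (i := index w P) (j := index w' P)
    (iP : (i < size P)%N) (jP : (j < size P)%N) :
  (Ordinal iP, Ordinal jP) \in coset_pattern M P <-> M (w * w'^-1).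
Proof.
rewrite inE /= !nth_index -?index_mem //; split; first by move/asboolP.
by move=> h; apply/asboolP.
Qed.

Lemma orbit_patternP M P a : (orbit_pattern P a == coset_pattern M P) <->
  coset_label M P (orbit_pt a).
Proof.
split=> [/eqP aM w w' wP wP'|aM].
  have iP : (index w P < size P)%N by rewrite index_mem.
  have jP : (index w' P < size P)%N by rewrite index_mem.
  rewrite -(coset_patternP M iP jP) -aM inE /= !nth_index //; split; by move/eqP.
apply/eqP/setP => -[i j]; rewrite !inE /=.
have h := aM _ _ (mem_nth 1 (ltn_ord i)) (mem_nth 1 (ltn_ord j)).
by apply/eqP/asboolP => /h.
Qed.

(** Each homomorphism with this pattern realises exactly one labelling, its own orbit, and all
    labellings are realised equally often. *)
Lemma card_orbit_pattern M P : is_subgroup M -> tree P ->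
  #|[set a | orbit_pattern P a == coset_pattern M P]%SET| =
  (n ^_ (ncosets M P).-1 * \prod_(j < k) (n.+1 - nedges M P j)`!)%N.
Proof.
move=> sM tP; have [B [uB sB BP]] := labelings sM tP.
rewrite -sB -sum1_card.
transitivity (\sum_(a : {ffun 'I_k -> 'S_n.+1}) \sum_(t <- B) (map (orbit_pt a) P == t))%N.
  rewrite big_mkcond; apply: eq_bigr => a _; rewrite inE.
  transitivity (map (orbit_pt a) P \in B : nat); last first.
    rewrite -count_uniq_mem // -sum1_count big_mkcond; apply: eq_bigr => t _ /=.
    by rewrite eq_sym; case: eqP.
  suff -> : (orbit_pattern P a == coset_pattern M P) = (map (orbit_pt a) P \in B).
    by case: (_ \in B).
  apply/idP/idP => [/orbit_patternP aM|/BP[f [fP f1 fM]]].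
    apply/BP; exists (orbit_pt a); split=> //.
    by rewrite /orbit_pt fg_eval1 perm1.
  apply/orbit_patternP => w w' wP wP'; move/eq_in_map: fP => fP.
  by rewrite !fP //; apply: fM.
rewrite exchange_big /= mulnC -[(_ * size B)%N]addn0 -iter_addn -count_predT -big_const_seq.
apply: eq_big_seq => t /BP[f [-> f1 fM]].
rewrite -(card_label_orbits sM tP f1 fM) -sum1_card [RHS]big_mkcond.
apply: eq_bigr => a _; rewrite inE; congr (nat_of_bool _).
apply/eqP/forallP => [/eq_in_map aP i|aP]; first by apply/eqP/aP/mem_nth.
apply/eq_in_map => w wP; have iP : (index w P < size P)%N by rewrite index_mem.
by have /eqP := aP (Ordinal iP); rewrite /= nth_index.
Qed.

End Counting.

(** * Ranks and free bases *)

Section Ranks.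
Local Open Scope classical_set_scope.
Local Open Scope group_scope.

(** A tree containing [u] fits injectively into [size P + 1] points, so the pattern of the trivial
    subgroup occurs, and there [u] moves the base point. *)
Lemma free_group_residually_finite k (u : free_group 'I_k) : u != 1 ->
  exists n (a : {ffun 'I_k -> 'S_n.+1}), fg_eval a u != 1.
Proof.
move=> u1; have [Q [tQ uQ]] := tree_extend u (tree_root 'I_k).
set P := Q ++ _ in tQ uQ; pose n := size P; exists n.
have sM := trivial_subgroup (free_group 'I_k).
have : (0 < #|[set a : {ffun 'I_k -> 'S_n.+1} | orbit_pattern P a == coset_pattern [set 1%g] P]%SET|)%N.
  rewrite card_orbit_pattern // muln_gt0 ffact_gt0 prodn_gt0 ?andbT => [|j]; last exact: fact_gt0.
  rewrite (leq_trans (leq_pred _)) // /ncosets (leq_trans (size_undup _)) //.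
  by rewrite size_map.
case/card_gt0P => a; rewrite inE => /orbit_patternP aP; exists a.
apply/negP => /eqP au; have /(_ _ _ uQ (tree_one tQ)) := aP.
rewrite /orbit_pt au fg_eval1 invg1 mulg1 => -[/(_ erefl)/= u1' _].
by rewrite u1' eqxx in u1.
Qed.

Variable G : groupType.
Implicit Types (J : set G).

Lemma fg_eval_comp (I : choiceType) (Q : groupType) (I' : choiceType)
    (t : I' -> free_group I) (f : I -> Q) (v : free_group I') :
  fg_eval f (fg_eval t v) = fg_eval (fun i => fg_eval f (t i)) v.
Proof.
have fM : {morph (fg_eval f \o fg_eval t) : u v / u * v}.
  by move=> u w; rewrite /= !fg_evalM.
rewrite -[LHS]/((fg_eval f \o fg_eval t) v) (fg_morphE fM).
by apply: eq_bigr => x _; rewrite /= !fg_eval_gen.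
Qed.

(** Restriction to the generators [e'] embeds the homomorphisms from [J] to ['S_2] into the families
    of [m'] permutations, so [2^m <= 2^m']. *)
Lemma free_basis_rank_le m m' J (e : 'I_m -> G) (e' : 'I_m' -> G) :
  free_basis J e -> J = subgroup_generated (range e') -> (m <= m')%N.
Proof.
move=> fe JE; have [th [thM thK thE]] := free_basis_coord fe.
have Je' i : J (e' i) by rewrite JE; apply: (@sub_generated _ (range e')); exists i.
have sur u : exists v, fg_eval (th \o e') v = u.
  have : J (fg_eval e u) by apply: (fg_eval_mem _ (free_basis_subgroup fe)) => i;
    exact: (free_basis_mem i fe).
  rewrite JE => /fg_eval_generated[v ve]; exists v; rewrite -[RHS]thK -ve.
  have hM : {morph th \o fg_eval e' : u v / u * v}.
    by move=> x y /=; rewrite fg_evalM thM //; apply: (fg_eval_mem _ (free_basis_subgroup fe)).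
  rewrite -[RHS]/((th \o fg_eval e') v) (fg_morphE hM).
  by apply: eq_bigr => x _; rewrite /= !fg_eval_gen.
pose Phi (a : {ffun 'I_m -> 'S_2}) : {ffun 'I_m' -> 'S_2} := [ffun i => fg_eval a (th (e' i))].
have Pi : injective Phi.
  move=> a b ab; apply/ffunP => j; rewrite -(fg_eval_gen a) -(fg_eval_gen b).
  have [v <-] := sur (fg_gen j); rewrite !fg_eval_comp; apply: eq_bigr => x _ /=.
  by have /ffunP/(_ x.1) := ab; rewrite !ffunE => ->.
have := leq_card _ Pi; rewrite !card_ffun !card_Sn !card_ord.
by rewrite leq_exp2l.
Qed.

Lemma free_basis_rank_uniq m m' J (e : 'I_m -> G) (e' : 'I_m' -> G) :
  free_basis J e -> free_basis J e' -> m = m'.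
Proof.
move=> fe fe'; apply/eqP; rewrite eqn_leq (free_basis_rank_le fe (proj1 fe')).
exact: (free_basis_rank_le fe' (proj1 fe)).
Qed.

Lemma least_eq (P : set nat) m : P m -> (forall n, P n -> (m <= n)%N) -> least P = Some m.
Proof.
move=> Pm mP; rewrite /least; case: pselect => [exP|[]]; last by exists m; apply/asboolP.
congr Some; case: ex_minnP => n /asboolP /mP mn nP; apply/eqP.
by rewrite eqn_leq mn andbT; apply: nP; apply/asboolP.
Qed.

Lemma least_Some (P : set nat) m : least P = Some m -> P m /\ forall n, P n -> (m <= n)%N.
Proof.
rewrite /least; case: pselect => // exP [<-]; case: ex_minnP => n /asboolP Pn nP.
by split=> // j Pj; apply: nP; apply/asboolP.
Qed.

Lemma least_None (P : set nat) m : least P = None -> ~ P m.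
Proof.
by rewrite /least; case: pselect => // nP _ Pm; apply: nP; exists m; apply/asboolP.
Qed.

Lemma free_rank_basis m J (e : 'I_m -> G) : free_basis J e -> free_rank J = Some m.
Proof.
move=> fe; apply: least_eq; first by exists e.
by move=> n [e' fe']; rewrite (free_basis_rank_uniq fe fe').
Qed.

Lemma free_rank_Some m J : free_rank J = Some m -> exists e : 'I_m -> G, free_basis J e.
Proof. by case/least_Some. Qed.

(* The Hopf property: precomposition with a surjective endomorphism permutes
   the finitely many homomorphisms to any given finite group, and these
   separate the elements of a free group. *)
Lemma free_basis_hopf m J (e e' : 'I_m -> G) :
  free_basis J e -> J = subgroup_generated (range e') -> free_basis J e'.
Proof.
move=> fe JE; have [th [thM thK thE]] := free_basis_coord fe.
have sJ := free_basis_subgroup fe.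
have Je' i : J (e' i) by rewrite JE; apply: (@sub_generated _ (range e')); exists i.
have the' v : th (fg_eval e' v) = fg_eval (th \o e') v.
  have hM : {morph th \o fg_eval e' : u v / u * v}.
    by move=> x y /=; rewrite fg_evalM thM //; apply: (fg_eval_mem _ sJ).
  rewrite -[LHS]/((th \o fg_eval e') v) (fg_morphE hM).
  by apply: eq_bigr => x _; rewrite /= !fg_eval_gen.
have sur u : exists v, fg_eval (th \o e') v = u.
  have : J (fg_eval e u) by apply: (fg_eval_mem _ sJ) => i; exact: (free_basis_mem i fe).
  by rewrite JE => /fg_eval_generated[v ve]; exists v; rewrite -[RHS]thK -ve the'.
split=> // s rs s0; apply/negP => /eqP s1; pose u := FreeGroup rs.
have u1 : u != 1 by rewrite -fg_nil.
have tu : fg_eval (th \o e') u = 1.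
  by rewrite -the' [fg_eval e' u]s1 (hom_on1 sJ thM).
have [n [a]] := free_group_residually_finite u1; apply/negP; rewrite negbK.
pose Phi (b : {ffun 'I_m -> 'S_n.+1}) : {ffun 'I_m -> 'S_n.+1} := [ffun i => fg_eval b (th (e' i))].
have Pi : injective Phi.
  move=> b c bc; apply/ffunP => j; rewrite -(fg_eval_gen b) -(fg_eval_gen c).
  have [v <-] := sur (fg_gen j); rewrite !fg_eval_comp; apply: eq_bigr => x _ /=.
  by have /ffunP/(_ x.1) := bc; rewrite !ffunE => ->.
rewrite -[a](f_invF Pi); set b := invF Pi a.
have -> : fg_eval (Phi b) u = fg_eval b (fg_eval (th \o e') u).
  by rewrite fg_eval_comp; apply: eq_bigr => x _; rewrite ffunE.
by rewrite tu fg_eval1.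
Qed.

End Ranks.

(** * Bases of free products *)

Section BasisSums.
Local Open Scope classical_set_scope.
Local Open Scope group_scope.
Variable G : groupType.
Implicit Types (J A B : set G).

Definition cat_family (T : Type) m n (e : 'I_m -> T) (f : 'I_n -> T) (i : 'I_(m + n)) : T :=
  match fintype.split i with inl j => e j | inr j => f j end.

Lemma cat_familyl (T : Type) m n (e : 'I_m -> T) (f : 'I_n -> T) i :
  cat_family e f (lshift n i) = e i.
Proof. by rewrite /cat_family -/(unsplit (inl i)) unsplitK. Qed.

Lemma cat_familyr (T : Type) m n (e : 'I_m -> T) (f : 'I_n -> T) i :
  cat_family e f (rshift m i) = f i.
Proof. by rewrite /cat_family -/(unsplit (inr i)) unsplitK. Qed.

Lemma range_cat_family (T : Type) m n (e : 'I_m -> T) (f : 'I_n -> T) :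
  range (cat_family e f) = range e `|` range f.
Proof.
apply/seteqP; split=> [_ [i _ <-]|x [[i _ <-]|[i _ <-]]].
- by rewrite /cat_family; case: fintype.split => j; [left|right]; exists j.
- by exists (lshift n i) => //; rewrite cat_familyl.
- by exists (rshift m i) => //; rewrite cat_familyr.
Qed.

Lemma free_product_subgroup J A B : free_product J A B -> is_subgroup J.
Proof. by case=> -> _; apply: generated_subgroup. Qed.

Lemma free_productl J A B : free_product J A B -> A `<=` J.
Proof. by case=> -> _ x Ax; apply: (@sub_generated _ (A `|` B)); left. Qed.

Lemma free_productr J A B : free_product J A B -> B `<=` J.
Proof. by case=> -> _ x Ax; apply: (@sub_generated _ (A `|` B)); right. Qed.

Lemma generatedU (X Y : set G) : subgroup_generated (subgroup_generated X `|` subgroup_generated Y) =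
  subgroup_generated (X `|` Y).
Proof.
apply/seteqP; split.
  apply: generated_min; first exact: generated_subgroup.
  by move=> x [|] xX; move: x xX; apply: generated_mono => y; [left|right].
by apply: generated_mono => x [xX|xY]; [left|right]; exact: sub_generated.
Qed.

Lemma free_basis_cat m n J A B (e : 'I_m -> G) (f : 'I_n -> G) :
  free_basis A e -> free_basis B f -> free_product J A B ->
  free_basis J (cat_family e f).
Proof.
move=> eA fB JAB; have sA := free_basis_subgroup eA; have sB := free_basis_subgroup fB.
have [a [aM aK aE]] := free_basis_coord eA; have [b [bM bK bE]] := free_basis_coord fB.
pose L := free_group 'I_(m + n).
pose a' x : L := fg_eval (fun i => fg_gen (lshift n i)) (a x).
pose b' x : L := fg_eval (fun i => fg_gen (rshift m i)) (b x).
have aM' : hom_on A a' by move=> x y Ax Ay; rewrite /a' aM // fg_evalM.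
have bM' : hom_on B b' by move=> x y Bx By; rewrite /b' bM // fg_evalM.
have [h [hM ha hb]] := free_product_hom sA sB JAB aM' bM'.
apply: (free_basis_hom _ hM).
  by rewrite range_cat_family -generatedU -(proj1 eA) -(proj1 fB) (proj1 JAB).
move=> i; rewrite -[i]splitK; case: (fintype.split i) => j /=.
  rewrite cat_familyl ha; last exact: (free_basis_mem _ eA).
  have -> : e j = fg_eval e (fg_gen j) by rewrite fg_eval_gen.
  by rewrite /a' aK fg_eval_gen.
rewrite cat_familyr hb; last exact: (free_basis_mem _ fB).
have -> : f j = fg_eval f (fg_gen j) by rewrite fg_eval_gen.
by rewrite /b' bK fg_eval_gen.
Qed.

Lemma word_eval_map (I I' : Type) (e : I -> G) (s : seq (letter I')) (g : I' -> I) :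
  word_eval e [seq (g x.1, x.2) | x <- s] = word_eval (e \o g) s.
Proof. by rewrite /word_eval big_map. Qed.

Lemma reduced_map (I I' : eqType) (s : seq (letter I')) (g : I' -> I) : injective g ->
  reduced [seq (g x.1, x.2) | x <- s] = reduced s.
Proof.
move=> gi; rewrite /reduced sorted_map; apply: eq_sorted => x y /=.
by rewrite /letter_inv /= !xpair_eqE (inj_eq gi).
Qed.

Lemma reduced_cat (I : eqType) (s t : seq (letter I)) (x0 : letter I) :
  reduced s -> reduced t -> s != [::] -> t != [::] ->
  head x0 t != letter_inv (last x0 s) -> reduced (s ++ t).
Proof.
case: s t => // x s [//|y t] rs rt _ _ /= h; rewrite /reduced /= cat_path.
by apply/andP; split => //=; apply/andP; split.
Qed.

(** Each syllable is a nonempty reduced word in its own half of the basis; at a junction the letters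
    come from different halves, so nothing cancels. *)
Lemma free_basis_product m n J (e : 'I_m -> G) (f : 'I_n -> G) :
  free_basis J (cat_family e f) ->
  free_product J (subgroup_generated (range e)) (subgroup_generated (range f)).
Proof.
move=> bJ; have [JE fJ] := bJ; split; first by rewrite generatedU -range_cat_family.
set A := subgroup_generated (range e); set B := subgroup_generated (range f).
pose side (x : letter 'I_(m + n)) := if fintype.split x.1 is inl _ then true else false.
have wd (p : bool * G) : (if p.1 then A p.2 else B p.2) -> p.2 <> 1 ->
    exists s, [/\ reduced s, s != [::], all (fun x => side x == p.1) s &
       word_eval (cat_family e f) s = p.2].
  case: p => [] [] g /= /fg_eval_generated[u ug] g1;
    [exists [seq (lshift n x.1, x.2) | x <- fgword u]|exists [seq (rshift m x.1, x.2) | x <- fgword u]];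
    split; rewrite ?reduced_map ?fg_reduced ?word_eval_map //.
  - exact: lshift_inj.
  - have : fgword u != [::] by rewrite fg_nil; apply/eqP=> u1; apply: g1; rewrite -ug u1 fg_eval1.
    by case: (fgword u).
  - by rewrite all_map; apply/allP => x _ /=; rewrite /side /= -/(unsplit (inl x.1)) unsplitK.
  - by rewrite -ug; apply: eq_bigr => x _; rewrite /= cat_familyl.
  - exact: rshift_inj.
  - have : fgword u != [::] by rewrite fg_nil; apply/eqP=> u1; apply: g1; rewrite -ug u1 fg_eval1.
    by case: (fgword u).
  - by rewrite all_map; apply/allP => x _ /=; rewrite /side /= -/(unsplit (inr x.1)) unsplitK.
  - by rewrite -ug; apply: eq_bigr => x _; rewrite /= cat_familyr.
move=> s os ss s0.
(* The induction carries the side of the first letter, which excludes cancellation at the next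
   junction. *)
suff [w [rw w0 _ <-]] : exists w, [/\ reduced w, w != [::],
    (forall x0, side (head x0 w) = (head (true, 1) s).1)
    & word_eval (cat_family e f) w = \prod_(p <- s) p.2] by apply: fJ.
elim: s os ss s0 => // p s IH os ss _.
have [op p1] := os p (mem_head _ _); have [w [rw w0 /allP aw wp]] := wd p op p1.
have hw x0 : side (head x0 w) = p.1.
  by case: w w0 aw {rw wp} => // x w _ aw; apply/eqP/aw; rewrite mem_head.
case: s IH os ss => [|q s] IH os ss.
  by exists w; split=> //; rewrite big_seq1.
have [q' qs||//|v [rv v0 hv vs]] := IH; first by apply: os; rewrite inE qs orbT.
  exact: path_sorted ss.
have x0 : letter 'I_(m + n) by case: (w) w0.
exists (w ++ v); split.
- apply: (@reduced_cat _ _ _ x0) => //; apply/eqP => hl.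
  have := hv x0; rewrite hl /side /letter_inv /=.
  have : side (last x0 w) = p.1.
    by case: w w0 aw {rw wp hw hl} => // x w _ aw; apply/eqP/aw; rewrite /= mem_last.
  by rewrite /side => -> /= pq; move: ss; rewrite /= pq eqxx.
- by case: (w) w0.
- by move=> x1; rewrite -(hw x1); case: (w) w0.
- by rewrite big_cons -vs -wp /word_eval big_cat.
Qed.

(** The retraction of [J] onto [B] that kills [A] carries generators of [J] to generators of [B].
    Finite generation then provides the complement with a basis. *)
Lemma complement_generated J A B (s : seq G) : is_subgroup A -> is_subgroup B ->
  free_product J A B -> J = subgroup_generated [set` s] ->
  exists s' : seq G, B = subgroup_generated [set` s'].
Proof.
move=> sA sB JAB JE; have sJ := free_product_subgroup JAB.
have [||h [hM hA hB]] := @free_product_hom _ J A B sA sB JAB G (fun=> 1) id.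
- by move=> x y _ _; rewrite mulg1.
- by [].
exists (map h s); apply/seteqP; split=> [x Bx|].
  rewrite -(hB x Bx); have := free_productr JAB Bx; rewrite JE.
  move: x {Bx}; set S := subgroup_generated [set` map h s].
  suff : subgroup_generated [set` s] `<=` J `&` h @^-1` S by move=> sub x /sub[].
  apply: generated_min; first exact: (preimage_subgroup sJ hM (generated_subgroup _)).
  move=> x xs; split; first by rewrite JE; exact: sub_generated.
  by apply: sub_generated; rewrite /= map_f.
have hJB : J `<=` J `&` h @^-1` B.
  rewrite {1}(proj1 JAB); apply: generated_min.
    exact: (preimage_subgroup sJ hM sB).
  move=> x [Ax|Bx]; split.
  - exact: (free_productl JAB).
  - by rewrite /= hA //; exact: (subgroup1 sB).
  - exact: (free_productr JAB).
  - by rewrite /= hB.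
apply: generated_min => // _ /mapP[x xs ->].
by have [|_] := hJB x; first by rewrite JE; exact: sub_generated.
Qed.

End BasisSums.

(** * Subgroups generated over a finite tree *)

Section Span.
Local Open Scope classical_set_scope.
Local Open Scope group_scope.
Variable I : choiceType.
Local Notation F := (free_group I).
Implicit Types (P : seq F) (J M : set F) (x : letter I).

(* The fundamental group of the image of the tree [P] in the Schreier graph
   of [J]. *)
Definition span J P : set F :=
  subgroup_generated [set z | J z /\ exists u v, [/\ u \in P, v \in P & z = u * v^-1]].

Lemma span_subgroup J P : is_subgroup (span J P).
Proof. exact: generated_subgroup. Qed.

Lemma span_sub J P : is_subgroup J -> span J P `<=` J.
Proof. by move=> sJ; apply: generated_min => // z []. Qed.

Lemma mem_span J P u v : u \in P -> v \in P -> J (u * v^-1) -> span J P (u * v^-1).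
Proof. by move=> uP vP Juv; apply: sub_generated; split=> //; exists u, v. Qed.

Lemma span_min J P M : is_subgroup M ->
  (forall u v, u \in P -> v \in P -> J (u * v^-1) -> M (u * v^-1)) -> span J P `<=` M.
Proof.
move=> sM h; apply: generated_min => // z [Jz [u [v [uP vP zE]]]].
by move: Jz; rewrite zE; apply: h.
Qed.

Lemma span_mono J P P' : {subset P <= P'} -> span J P `<=` span J P'.
Proof.
move=> PP'; apply: span_min; first exact: span_subgroup.
by move=> u v uP vP; apply: mem_span; apply: PP'.
Qed.

Lemma span_mono_l J M P : J `<=` M -> span J P `<=` span M P.
Proof.
move=> JM; apply: span_min; first exact: span_subgroup.
by move=> u v uP vP /JM; apply: mem_span.
Qed.

Lemma span_span J P : is_subgroup J -> span (span J P) P = span J P.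
Proof.
move=> sJ; apply/seteqP; split; first exact: (span_sub (span_subgroup J P)).
apply: span_min; first exact: span_subgroup.
move=> u v uP vP Juv; apply: mem_span => //; exact: mem_span.
Qed.

Lemma span_full J P P' : is_subgroup J -> span J P = J -> {subset P <= P'} -> span J P' = J.
Proof.
move=> sJ JP PP'; apply/seteqP; split; first exact: span_sub.
by rewrite -{1}JP; exact: span_mono.
Qed.

End Span.

(** * Adding an edge between two vertices of the coset graph *)

Section Swap.
Local Open Scope classical_set_scope.
Local Open Scope group_scope.
Variable I : choiceType.
Local Notation F := (free_group I).
Variables (M : set F) (P : seq F) (p w : F) (x : letter I).
Hypotheses (sM : is_subgroup M) (tP : tree P) (MP : span M P = M).
Hypotheses (pP : p \in P) (wP : w \in P) (nt : ~ M (p * fg_letter x * w^-1)).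
(** In the image of [P] no edge with label [x] leaves the vertex of [p], and by [no_in] none enters
    the vertex of [w]. Redirecting the letter there disturbs no path of [P]. *)
Hypothesis no_out : forall u, u \in P -> u * fg_letter x \in P -> ~ M (u * p^-1).
Hypothesis no_in : forall u, u \in P -> u * fg_letter x \in P -> ~ M (u * fg_letter x * w^-1).

Section WithHom.
Variables (Q : groupType) (th : F -> Q) (b : Q).
Hypothesis thM : hom_on M th.
Let px := p * fg_letter x.

(* [nf y q] stands for the class of [(y, q)] in the quotient of [F * Q] by
   [(m y, q) ~ (y, q th(m))], on which [F] acts on the right.  The new action
   lets the generator [x] be followed by the exchange of the classes of
   [(p x, q)] and [(w, q b)]. *)
Let nf (y : F) (q : Q) : F * Q := (coset_rep M y, q * th (y * (coset_rep M y)^-1)).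

Let MC y : M (y * (coset_rep M y)^-1).
Proof. by have /(subgroupV sM) := coset_repP y sM; rewrite invgM invgK. Qed.

Let nfM y z q : M (y * z^-1) -> nf y q = nf z (q * th (y * z^-1)).
Proof.
move=> yz; have yzE : coset_rep M y = coset_rep M z by apply/(coset_rep_eq _ _ sM).
rewrite /nf yzE; congr pair; rewrite -mulgA -thM //.
by rewrite mulgA mulgVK.
Qed.

Let nf_rep y z q q' : nf y q = nf z q' -> M (y * z^-1).
Proof. by case=> /(coset_rep_eq _ _ sM). Qed.

Let nf_inj y : injective (nf y).
Proof. by move=> q q' [] /mulIg. Qed.

Let st0 (s : F * Q) (a : letter I) := nf (s.1 * fg_letter a) s.2.

Let st0E y q a : st0 (nf y q) a = nf (y * fg_letter a) q.
Proof.
rewrite /st0 /= [RHS](@nfM _ (coset_rep M y * fg_letter a)); last first.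
  by rewrite invgM mulgA mulgK.
by rewrite invgM mulgA mulgK.
Qed.

(** The inverse factors pass from the chosen representative back to [px] or [w], which makes the
    exchange independent of representatives. *)
Let tau (s : F * Q) : F * Q :=
  if s.1 == coset_rep M px then nf w (s.2 * (th (px * (coset_rep M px)^-1))^-1 * b)
  else if s.1 == coset_rep M w then nf px (s.2 * (th (w * (coset_rep M w)^-1))^-1 * b^-1)
  else s.

Let tau_px q : tau (nf px q) = nf w (q * b).
Proof. by rewrite /tau /= eqxx mulgK. Qed.

Let tau_w q : tau (nf w q) = nf px (q * b^-1).
Proof.
rewrite /tau /=; case: eqP => [/(coset_rep_eq _ _ sM)/(subgroup_sym sM) //|_].
by rewrite eqxx mulgK.
Qed.

Let tau_id y q : ~ M (y * px^-1) -> ~ M (y * w^-1) -> tau (nf y q) = nf y q.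
Proof.
move=> ypx yw; rewrite /tau /=; case: eqP => [/(coset_rep_eq _ _ sM) //|_].
by case: eqP => [/(coset_rep_eq _ _ sM)|].
Qed.

Let tau_nf y q : exists z r, tau (nf y q) = nf z r.
Proof.
rewrite /tau; case: ifP => _; first by eexists; eexists.
by case: ifP => _; eexists; eexists.
Qed.

Let tauK y q : tau (tau (nf y q)) = nf y q.
Proof.
case: (pselect (M (y * px^-1))) => [ypx|nypx].
  by rewrite (nfM q ypx) tau_px tau_w mulgK.
case: (pselect (M (y * w^-1))) => [yw|nyw].
  by rewrite (nfM q yw) tau_w tau_px mulgVK.
by rewrite !tau_id.
Qed.

(** The letter [x] moves and then exchanges; its inverse exchanges and then moves. As [tau] is an
    involution on classes, the two undo each other and the action respects free reduction. *)
Let step (s : F * Q) (a : letter I) :=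
  if a == x then tau (st0 s a) else if a == letter_inv x then st0 (tau s) a else st0 s a.

Let step_nf y q a : exists z r, step (nf y q) a = nf z r.
Proof.
rewrite /step st0E; case: ifP => _; first exact: tau_nf.
case: ifP => _; last by eexists; eexists.
by have [z [r ->]] := tau_nf y q; rewrite st0E; eexists; eexists.
Qed.

Let stepK y q a : step (step (nf y q) a) (letter_inv a) = nf y q.
Proof.
have ix (c : letter I) : (letter_inv c == c) = false.
  by case: c => i [] /=; rewrite xpair_eqE /= andbF.
have iK (c : letter I) z : z * fg_letter c * fg_letter (letter_inv c) = z.
  by rewrite -fg_letterV mulgK.
rewrite /step; case: (a =P x) => [->|ax].
  rewrite ix eqxx st0E; have [z [r zE]] := tau_nf (y * fg_letter x) q.
  by rewrite tauK st0E iK.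
case: (a =P letter_inv x) => [->|aix].
  rewrite letter_invK eqxx; have [z [r zE]] := tau_nf y q.
  rewrite zE st0E; rewrite st0E; have -> : z * fg_letter (letter_inv x) * fg_letter x = z.
    by rewrite -{2}(letter_invK x) iK.
  by rewrite -zE tauK.
case: eqP => [aE|_]; first by rewrite -aE letter_invK in aix.
case: eqP => [aE|_]; last by rewrite !st0E iK.
by move: ax; rewrite -(letter_invK a) aE letter_invK.
Qed.

Let act (s : F * Q) (u : F) := foldl step s (fgword u).

Let foldl_nf y q (s : seq (letter I)) : exists z r, foldl step (nf y q) s = nf z r.
Proof.
elim: s y q => [|a s IH] y q /=; first by eexists; eexists.
by have [z [r ->]] := step_nf y q a.
Qed.

Let foldl_push y q a (s : seq (letter I)) :
  foldl step (nf y q) (push a s) = foldl step (step (nf y q) a) s.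
Proof.
case: s => //= c s; case: eqP => [->|//] /=.
by rewrite stepK.
Qed.

Let actM y q u v : act (nf y q) (u * v) = act (act (nf y q) u) v.
Proof.
rewrite /act fgwordM; elim: (fgword u) y q => //= a s IH y q.
by rewrite foldl_push; have [z [r ->]] := step_nf y q a.
Qed.

Let act_letter y q a : act (nf y q) (fg_letter a) = step (nf y q) a.
Proof. by []. Qed.

Let act_path u : u \in P -> forall c, act (nf 1 c) u = nf u c.
Proof.
suff h S : tree S -> {subset S <= P} -> forall v, v \in S -> forall c, act (nf 1 c) v = nf v c.
  by apply: (h P).
elim=> [_ v|y R r a _ IH rR _ yE RP v]; first by rewrite inE => /eqP ->.
have RP' : {subset R <= P} by move=> z zR; apply: RP; rewrite inE zR orbT.
rewrite inE => /predU1P[->|vR] c; last exact: IH.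
have yra := fg_rcons_mul yE; have rP := RP' r rR.
have yP : y \in P by apply: RP; rewrite mem_head.
rewrite yra actM IH // act_letter /step st0E.
case: eqP => [ax|_].
  rewrite tau_id // -?ax -?yra.
    rewrite /px invgM mulgA yra ax mulgK; apply: no_out => //; by rewrite -ax -yra.
  rewrite yra ax; apply: no_in => //; by rewrite -ax -yra.
case: eqP => [ax|//]; rewrite tau_id ?st0E //.
  have rE : r = y * fg_letter x by rewrite yra ax -fg_letterV mulgVK.
  by rewrite /px rE invgM mulgA mulgK; apply: no_out => //; rewrite -rE.
have rE : r = y * fg_letter x by rewrite yra ax -fg_letterV mulgVK.
by rewrite rE; apply: no_in => //; rewrite -rE.
Qed.

Let act_pathV u : u \in P -> forall c, act (nf u c) u^-1 = nf 1 c.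
Proof. by move=> uP c; rewrite -act_path // -actM mulgV. Qed.

(** [u] maps the fibre over the base coset to itself as right multiplication by [q]. Being
    multiplicative and single-valued, this relation is the graph of the extended homomorphism. *)
Let Rel u q := forall c, act (nf 1 c) u = nf 1 (c * q).

Let Rel1 : Rel 1 1.
Proof. by move=> c; rewrite mulg1. Qed.

Let RelM u v q r : Rel u q -> Rel v r -> Rel (u * v) (q * r).
Proof. by move=> uq vr c; rewrite actM uq vr mulgA. Qed.

Let RelV u q : Rel u q -> Rel u^-1 q^-1.
Proof.
move=> uq c; have := uq (c * q^-1); rewrite mulgVK => <-.
by rewrite -actM mulgV.
Qed.

Let Rel_uniq u q r : Rel u q -> Rel u r -> q = r.
Proof. by move=> uq ur; have := uq 1; rewrite ur !mul1g => /nf_inj. Qed.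

Let Rel_hom m : M m -> Rel m (th m).
Proof.
suff : M `<=` [set m | M m /\ Rel m (th m)] by move=> h /h[].
rewrite -{1}MP; apply: span_min => [|u v uP vP Muv].
  apply/is_subgroupP; split=> [|y z [My Ry] [Mz Rz]|y [My Ry]].
  - split; first exact: (subgroup1 sM).
    by rewrite (hom_on1 sM thM).
  - by split; [exact: (subgroupM sM)|rewrite thM //; exact: RelM].
  - by split; [exact: (subgroupV sM)|rewrite (hom_onV sM thM) //; exact: RelV].
by split=> // c; rewrite actM act_path // (nfM c Muv) act_pathV.
Qed.

Let Rel_swap : Rel (px * w^-1) b.
Proof.
move=> c; rewrite /px !actM act_path // act_letter /step eqxx st0E tau_px.
by rewrite act_pathV.
Qed.

Let Rel_adjoin u : adjoin M (px * w^-1) u -> exists q, Rel u q.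
Proof.
move: u; apply: adjoin_min; last by exists b.
  apply/is_subgroupP; split=> [|y z [q yq] [r zr]|y [q yq]].
  - by exists 1.
  - by exists (q * r); exact: RelM.
  - by exists q^-1; exact: RelV.
by move=> m Mm; exists (th m); exact: Rel_hom.
Qed.

(** The universal property of the free product of [M] with the cyclic group on the new generator:
    its value [b] is arbitrary, and the extension is read off from the modified action. *)
Lemma swap_hom : exists th' : F -> Q, [/\ hom_on (adjoin M (px * w^-1)) th',
  forall m, M m -> th' m = th m & th' (px * w^-1) = b].
Proof.
pose th' u := xget 1 [set q | Rel u q].
have th'E u q : Rel u q -> th' u = q.
  by move=> uq; apply: (@Rel_uniq u) => //; apply: (@xgetPex _ 1 [set q | Rel u q]); exists q.
exists th'; split=> [u v /Rel_adjoin[q uq] /Rel_adjoin[r vr]|m Mm|]; last exact: th'E.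
  by rewrite (th'E _ _ uq) (th'E _ _ vr); apply/th'E/RelM.
exact/th'E/Rel_hom.
Qed.

Lemma swap_trace_aux u v : u \in P -> v \in P ->
  adjoin M (px * w^-1) (u * v^-1) -> M (u * v^-1).
Proof.
move=> uP vP /Rel_adjoin[q /(_ 1)]; rewrite actM act_path // => uv.
suff /nf_rep : nf u 1 = nf v (1 * q) by [].
have [z [r zr]] := foldl_nf u 1 (fgword v^-1).
have := congr1 (fun s => act s v) uv; rewrite -actM mulVg act_path //.
Qed.

End WithHom.

(** With trivial coefficients, words of [P] still lead from the base to their own cosets of [M],
    while elements of the extension fix the base coset. So the new generator identifies no further
    words of [P]. *)
Lemma swap_trace u v : u \in P -> v \in P ->
  adjoin M (p * fg_letter x * w^-1) (u * v^-1) -> M (u * v^-1).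
Proof.
by apply: (@swap_trace_aux F (fun=> 1) 1) => y z _ _; rewrite mulg1.
Qed.

(** Take for [Q] the free group of rank [m + 1], for the homomorphism the coordinates on [M], and
    for [b] the last generator. *)
Lemma swap_basis m (e : 'I_m -> F) : free_basis M e ->
  free_basis (adjoin M (p * fg_letter x * w^-1))
    (cat_family e (fun _ : 'I_1 => p * fg_letter x * w^-1)).
Proof.
move=> eM; have [a [aM aK _]] := free_basis_coord eM.
pose a' y : free_group 'I_(m + 1) := fg_eval (fun i => fg_gen (lshift 1 i)) (a y).
have a'M : hom_on M a' by move=> y z My Mz; rewrite /a' aM // fg_evalM.
have [h [hM ha ht]] := swap_hom (fg_gen (rshift m ord0)) a'M.
apply: (free_basis_hom _ hM) => [|i].
  rewrite range_cat_family -generatedU -(proj1 eM) /adjoin.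
  apply/seteqP; split; apply: generated_min; try exact: generated_subgroup.
    move=> y [My|->]; first by apply: sub_generated; left.
    by apply: sub_generated; right; apply: sub_generated; exists ord0.
  move=> y [My|]; first by apply: sub_generated; left.
  move: y; apply: generated_min; first exact: generated_subgroup.
  by move=> _ [_ _ <-]; apply: sub_generated; right.
rewrite -[i]splitK; case: (fintype.split i) => j /=.
  rewrite cat_familyl ha; last exact: (free_basis_mem _ eM).
  have -> : e j = fg_eval e (fg_gen j) by rewrite fg_eval_gen.
  by rewrite /a' aK fg_eval_gen.
by rewrite cat_familyr ht (ord1 j).
Qed.

End Swap.

Section Reindex.
Local Open Scope classical_set_scope.
Local Open Scope group_scope.
Variable G : groupType.
Implicit Types (J : set G).

Lemma free_basis_reindex (I I' : eqType) J (e : I -> G) (g : I' -> I) :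
  bijective g -> free_basis J e -> free_basis J (e \o g).
Proof.
move=> bg [JE eJ]; have gi := bij_inj bg; case: bg => g' gK g'K.
split=> [|s rs s0].
  rewrite JE; congr subgroup_generated; apply/seteqP; split=> _ [i _ <-].
    by exists (g' i) => //=; rewrite g'K.
  by exists (g i).
rewrite -word_eval_map; apply: eJ; first by rewrite reduced_map.
by case: (s) s0.
Qed.

Lemma eq_free_basis (I : eqType) J (e e' : I -> G) : e =1 e' -> free_basis J e -> free_basis J e'.
Proof. by move=> /funext ->. Qed.

Lemma cat_familyA (T : Type) m n l (e : 'I_m -> T) (f : 'I_n -> T) (g : 'I_l -> T) i :
  cat_family e (cat_family f g) i = cat_family (cat_family e f) g (cast_ord (addnA m n l) i).
Proof.
rewrite -[i]splitK; case: (fintype.split i) => j /=.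
  rewrite cat_familyl (_ : cast_ord _ _ = lshift l (lshift n j)); last exact: val_inj.
  by rewrite !cat_familyl.
rewrite cat_familyr -[j]splitK; case: (fintype.split j) => t /=.
  rewrite cat_familyl (_ : cast_ord _ _ = lshift l (rshift m t)); last exact: val_inj.
  by rewrite cat_familyl cat_familyr.
rewrite cat_familyr (_ : cast_ord _ _ = rshift (m + n) t).
  by rewrite cat_familyr.
by apply: val_inj => /=; rewrite addnA.
Qed.

Lemma free_basis_catA J m n l (e : 'I_m -> G) (f : 'I_n -> G) (g : 'I_l -> G) :
  free_basis J (cat_family (cat_family e f) g) -> free_basis J (cat_family e (cat_family f g)).
Proof.
move=> /(free_basis_reindex (g := cast_ord (addnA m n l))) h.
apply: eq_free_basis (h _); first by move=> i; rewrite [RHS]cat_familyA.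
by exists (cast_ord (esym (addnA m n l))); [apply: cast_ordK|apply: cast_ordKV].
Qed.

Lemma free_basis_cat0 J m (e : 'I_m -> G) (f : 'I_0 -> G) :
  free_basis J e -> free_basis J (cat_family e f).
Proof.
move=> /(free_basis_reindex (g := cast_ord (addn0 m))) h.
apply: eq_free_basis (h _).
  move=> i; rewrite -[i in RHS]splitK; case: (fintype.split i) (splitK i) => [j|[]//] /= <-.
  by rewrite cat_familyl; congr e; apply: val_inj.
by exists (cast_ord (esym (addn0 m))); [apply: cast_ordK|apply: cast_ordKV].
Qed.

End Reindex.

(** * The preimage of the graph in the Cayley tree is a subtree *)

Section Convexity.
Local Open Scope classical_set_scope.
Local Open Scope group_scope.
Variable I : choiceType.
Local Notation F := (free_group I).
Variables (M : set F) (P : seq F).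
Hypotheses (sM : is_subgroup M) (tP : tree P).
Implicit Types (x : letter I) (s t : seq (letter I)) (y z : F).

(* The preimages, in the Cayley tree of the free group, of the vertices and
   edges of the image of [P] in the Schreier graph of [M]. *)
Definition covered y := exists2 w, w \in P & M (y * w^-1).
Definition covered_edge y x := exists u, [/\ u \in P, u * fg_letter x \in P & M (y * u^-1)].

Fixpoint walk y s : Prop :=
  if s is x :: s' then covered_edge y x /\ walk (y * fg_letter x) s' else True.

Lemma covered_mem y : y \in P -> covered y.
Proof. by move=> yP; exists y => //; rewrite mulgV; exact: (subgroup1 sM). Qed.

Lemma coveredM y m : M m -> covered y -> covered (m * y).
Proof.
by move=> Mm [w wP yw]; exists w => //; rewrite -mulgA; exact: (subgroupM sM).
Qed.

Lemma covered_edge_start y x : covered_edge y x -> covered y.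
Proof. by move=> [u [uP _ yu]]; exists u. Qed.

Lemma covered_edge_end y x : covered_edge y x -> covered (y * fg_letter x).
Proof.
by move=> [u [uP uxP yu]]; exists (u * fg_letter x) => //; rewrite invgM mulgA mulgK.
Qed.

Lemma covered_edgeV y x : covered_edge y x ->
  covered_edge (y * fg_letter x) (letter_inv x).
Proof.
move=> [u [uP uxP yu]]; exists (u * fg_letter x); rewrite -fg_letterV mulgK.
by split=> //; rewrite invgM mulgA mulgK.
Qed.

Lemma covered_edgeM y x m : M m -> covered_edge y x -> covered_edge (m * y) x.
Proof.
move=> Mm [u [uP uxP yu]]; exists u; split=> //.
by rewrite -mulgA; exact: (subgroupM sM).
Qed.

Lemma walk_cat y s t : walk y (s ++ t) <->
  walk y s /\ walk (y * \prod_(x <- s) fg_letter x) t.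
Proof.
elim: s y => [|x s IH] y /=; first by rewrite big_nil mulg1; split=> // -[].
rewrite big_cons mulgA; split=> [[h /IH[h1 h2]]|[[h1 h2] h3]] //.
by split=> //; apply/IH.
Qed.

(** Free reduction only removes backtracking, so a walk stays within the covered edges. *)
Lemma walk_push y x s : walk y (x :: s) -> walk y (push x s).
Proof.
case: s => //= c s; case: eqP => [->|//] [_ [_]].
by rewrite -fg_letterV mulgK.
Qed.

Lemma walk_foldr y s t : walk y (s ++ t) -> walk y (foldr (@push I) t s).
Proof.
elim: s y => //= x s IH y [h /IH hs]; exact: walk_push.
Qed.

Lemma walkM y u v : walk y (fgword u) -> walk (y * u) (fgword v) -> walk y (fgword (u * v)).
Proof.
by move=> h1 h2; rewrite fgwordM; apply: walk_foldr; apply/walk_cat; rewrite fg_expand.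
Qed.

Lemma walkV y u : walk y (fgword u) -> walk (y * u) (fgword u^-1).
Proof.
rewrite -{2}(fg_expand u) fgwordV; elim: (fgword u) y => //= x s IH y [h /IH hs].
rewrite rev_cons -cats1; apply/walk_cat; split; first by rewrite big_cons mulgA.
have -> : \prod_(x0 <- rev [seq letter_inv i | i <- s]) fg_letter x0 = (\prod_(c <- s) fg_letter c)^-1.
  rewrite -map_rev big_map -{2}(revK s) -prodgV.
  by apply: eq_bigr => c _; rewrite fg_letterV.
by rewrite big_cons mulgA mulgK /=; split=> //; exact: covered_edgeV.
Qed.

Lemma walk_translate y m s : M m -> walk y s -> walk (m * y) s.
Proof.
move=> Mm; elim: s y => //= x s IH y [h /IH hs].
by split; [exact: covered_edgeM|rewrite -mulgA].
Qed.

Lemma walk_tree u : u \in P -> walk 1 (fgword u).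
Proof.
suff h S : tree S -> {subset S <= P} -> forall v, v \in S -> walk 1 (fgword v) by apply: (h P).
elim=> [_ v|y S' p x _ IH pS _ yp SP v]; first by rewrite inE => /eqP ->.
have SP' : {subset S' <= P} by move=> z zS; apply: SP; rewrite inE zS orbT.
rewrite inE => /predU1P[->|vS]; last exact: IH.
rewrite yp -cats1; apply/walk_cat; split; first exact: IH.
rewrite fg_expand mul1g /=; split=> //; exists p; rewrite -(fg_rcons_mul yp) mulgV.
by split; [exact: SP'|apply: SP; rewrite mem_head|exact: (subgroup1 sM)].
Qed.

Hypothesis MP : span M P = M.

Lemma walk_subgroup m : M m -> walk 1 (fgword m).
Proof.
suff : M `<=` [set m | M m /\ walk 1 (fgword m)] by move=> h /h[].
rewrite -{1}MP; apply: span_min => [|u v uP vP uv].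
  apply/is_subgroupP; split=> [|y z [My yw] [Mz zw]|y [My yw]].
  - by split; first exact: (subgroup1 sM).
  - split; first exact: (subgroupM sM).
    by apply: walkM => //; rewrite mul1g -[y]mulg1; exact: walk_translate.
  - split; first exact: (subgroupV sM).
    have := walk_translate (subgroupV sM My) (walkV yw).
    by rewrite mul1g mulVg.
split=> //; apply: walkM; first exact: walk_tree.
rewrite mul1g -[u in walk u](mulgVK v).
by apply: walk_translate => //; rewrite -[v in walk v]mul1g; exact/walkV/walk_tree.
Qed.

(** Walk from [y] along a translate of the tree to a point of [M], along an element of [M], then up
    another translate to [z]; reduction leaves the geodesic. The middle part stays covered because
    [M] is generated over [P]. *)
Lemma covered_convex y z : covered y -> covered z -> walk y (fgword (y^-1 * z)).
Proof.
move=> [u uP yu] [v vP zv].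
have [m Mm yE] : exists2 m, M m & y = m * u by exists (y * u^-1); rewrite ?mulgVK.
have [m' Mm' zE] : exists2 m, M m & z = m * v by exists (z * v^-1); rewrite ?mulgVK.
rewrite yE zE invgM !mulgA; apply: walkM; last first.
  have -> : m * u * (u^-1 * m^-1 * m') = m' * 1 by rewrite !mulgA mulgK mulgV mul1g mulg1.
  by apply: walk_translate => //; exact: walk_tree.
rewrite -mulgA; apply: walkM.
  by apply: walk_translate => //; rewrite -[u in walk u]mul1g; exact/walkV/walk_tree.
rewrite mulgK -[m in walk m]mulg1; apply: walk_translate => //.
by apply: walk_subgroup; apply: (subgroupM sM) => //; exact: (subgroupV sM).
Qed.

(** The geodesic between neighbours is their edge, so convexity covers it. *)
Lemma covered_edgeP y x : covered_edge y x <-> covered y /\ covered (y * fg_letter x).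
Proof.
split=> [h|[yc yxc]]; first by split; [exact: covered_edge_start h|exact: covered_edge_end].
by have := covered_convex yc yxc; rewrite mulKg => -[].
Qed.

End Convexity.

(** * Growing the tree by one leaf *)

Section Leaf.
Local Open Scope classical_set_scope.
Local Open Scope group_scope.

Lemma ncosets_eq_mem (G : groupType) (M : set G) (s t : seq G) : s =i t -> ncosets M s = ncosets M t.
Proof.
move=> st; apply: perm_size; apply: uniq_perm; rewrite ?undup_uniq // => y.
by rewrite !mem_undup; apply: eq_mem_map.
Qed.

Variable k : nat.
Local Notation F := (free_group 'I_k).
Implicit Types (P : seq F) (J M H : set F).

Lemma tree_uniq P : tree P -> uniq P.
Proof. by elim=> //= y Q p x _ -> _ ->. Qed.

Section LeafStep.
Variables (J : set F) (P : seq F) (y p : F) (x : letter 'I_k).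
Hypotheses (sJ : is_subgroup J) (tP : tree P) (pP : p \in P) (yP : y \notin P).
Hypothesis yp : fgword y = rcons (fgword p) x.

Let yE : y = p * fg_letter x := fg_rcons_mul yp.

(** The edge from [p] to the new leaf is already in the image of [P] in the coset graph of [J]. *)
Definition leaf_edge := exists u, [/\ u \in P, u * fg_letter x \in P & J (u * p^-1)].

(** Edges are recorded at their source for the positive generator: this is the leaf when [x] is an
    inverse letter, and [p] otherwise. *)
Let src j := if x == (j, true) then [:: y] else if x == (j, false) then [:: p] else [::].

Let genE j : fg_gen j = fg_letter (j, false) :> F. Proof. by []. Qed.
Let genV j : (fg_gen j)^-1 = fg_letter (j, true) :> F. Proof. exact: fg_letterV. Qed.

Lemma edges_at_leaf j : edges_at (y :: P) j =i src j ++ edges_at P j.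
Proof.
have yj u : u \in P -> u * fg_gen j = y -> x = (j, false) /\ u = p.
  move=> uP uy; have [|] := fg_mul_letter u (j, false); rewrite -genE uy.
    rewrite yp => /rcons_inj[pu xj]; split=> //.
    exact: (fgword_inj (esym pu)).
  by move=> /(tree_closed tP uP)[z zP /fgword_inj zy]; move: yP; rewrite -zy zP.
have yj2 : y * fg_gen j \in P -> x = (j, true).
  move=> yjP; have [h|] := fg_mul_letter y (j, false).
    by have [z zP /fgword_inj zy] := tree_closed tP yjP h; move: yP; rewrite -zy zP.
  by rewrite yp => /rcons_inj[].
have yjn : y * fg_gen j != y.
  by apply/eqP => /(congr1 (mul y^-1)); rewrite mulKg mulVg => /(congr1 (@fgword _)).
move=> u; rewrite mem_cat; apply/edges_atP/orP => [[]|].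
  rewrite inE => /predU1P[->|uP].
    rewrite inE (negbTE yjn) /= => /yj2 xj; left.
    by rewrite /src xj eqxx mem_head.
  rewrite inE => /predU1P[/(yj u uP)[xj ->]|ujP]; last by right; apply/edges_atP.
  by left; rewrite /src xj eqxx xpair_eqE andbF mem_head.
move=> [|/edges_atP[uP ujP]]; last by rewrite !inE uP ujP !orbT.
rewrite /src; case: eqP => [xj|_].
  rewrite inE => /eqP ->; rewrite mem_head inE; split=> //.
  by rewrite yE xj -genV mulgVK pP orbT.
case: eqP => [xj|//]; rewrite inE => /eqP ->.
by rewrite genE -xj -yE mem_head inE pP orbT.
Qed.

Lemma nedges_leaf j : nedges J (y :: P) j =
  (nedges J P j + (j == x.1) * ~~ `[< leaf_edge >])%N.
Proof.
rewrite /nedges (ncosets_eq_mem _ (edges_at_leaf j)) /src.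
case: eqP => [xj|xj].
  rewrite xj eqxx mul1n ncosets_cons //.
  suff -> : `[< exists2 w, w \in edges_at P j & J (y * w^-1) >] = `[< leaf_edge >].
    by case: asboolP => _; rewrite ?addn0 ?addn1.
  have py : p = y * fg_gen j by rewrite yE xj -genV mulgVK.
  apply/asboolP/asboolP => [[v /edges_atP[vP vjP] yv]|[u [uP uxP up]]].
    exists (v * fg_gen j); split=> //; first by rewrite xj -genV mulgK.
    by rewrite py invgM mulgA mulgK; exact: (subgroup_sym sJ yv).
  exists (u * fg_letter x).
    by apply/edges_atP; split=> //; rewrite {1}xj -genV mulgVK.
  by rewrite yE invgM mulgA mulgK; exact: (subgroup_sym sJ up).
case: eqP => [xj'|xj'] /=; last first.
  suff -> : (j == x.1) = false by rewrite mul0n addn0.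
  by apply/eqP => jx; case: (x) xj xj' jx => i [] /= h1 h2 jx; [apply: h1|apply: h2]; rewrite jx.
rewrite xj' eqxx mul1n ncosets_cons //.
suff -> : `[< exists2 w, w \in edges_at P j & J (p * w^-1) >] = `[< leaf_edge >].
  by case: asboolP => _; rewrite ?addn0 ?addn1.
apply/asboolP/asboolP => [[v /edges_atP[vP vjP] pv]|[u [uP uxP up]]].
  by exists v; split=> //; [rewrite xj'|exact: (subgroup_sym sJ pv)].
exists u; first by apply/edges_atP; split=> //; rewrite genE -xj'.
exact: (subgroup_sym sJ up).
Qed.

Lemma sum_nedges_leaf : (\sum_(j < k) nedges J (y :: P) j =
  \sum_(j < k) nedges J P j + ~~ `[< leaf_edge >])%N.
Proof.
under eq_bigr do rewrite nedges_leaf; rewrite big_split /=; congr addn.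
rewrite (bigD1 x.1) //= eqxx mul1n big1 ?addn0 // => j /negbTE ->.
by rewrite mul0n.
Qed.

Lemma span_leaf_eq : (forall w, w \in P -> J (y * w^-1) -> span J P (y * w^-1)) ->
  span J (y :: P) = span J P.
Proof.
move=> h; apply/seteqP; split; last by apply: span_mono => u uP; rewrite inE uP orbT.
apply: span_min; first exact: span_subgroup.
have sS := span_subgroup J P.
move=> u v; rewrite !inE => /predU1P[->|uP] /predU1P[->|vP] Juv.
- by rewrite mulgV; exact: (subgroup1 sS).
- exact: h.
- by apply: (subgroup_sym sS); apply: h => //; exact: (subgroup_sym sJ).
- exact: mem_span.
Qed.

Lemma span_leaf_edge : leaf_edge -> span J (y :: P) = span J P.
Proof.
move=> [u [uP uxP up]]; apply: span_leaf_eq => w wP yw.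
have pu : span J P (p * u^-1) by apply: mem_span => //; exact: (subgroup_sym sJ).
have -> : y * w^-1 = (p * u^-1) * ((u * fg_letter x) * w^-1).
  by rewrite yE !mulgA mulgVK.
apply: (subgroupM (span_subgroup J P)) => //; apply: mem_span => //.
have := subgroupM sJ up yw; by rewrite yE !mulgA mulgVK.
Qed.

Lemma ncosets_leaf_edge : leaf_edge -> ncosets J (y :: P) = ncosets J P.
Proof.
move=> [u [uP uxP up]]; rewrite ncosets_cons //; case: asboolP => // -[]; exists (u * fg_letter x) => //.
by rewrite yE invgM mulgA mulgK; exact: (subgroup_sym sJ).
Qed.

Lemma span_leaf_adjoin w : w \in P -> J (y * w^-1) ->
  span J (y :: P) = adjoin (span J P) (y * w^-1).
Proof.
move=> wP yw; have sA := adjoin_subgroup (span J P) (y * w^-1).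
have SA : span J P `<=` adjoin (span J P) (y * w^-1) := @sub_adjoin _ _ _.
have yA : adjoin (span J P) (y * w^-1) (y * w^-1) := @mem_adjoin _ _ _.
apply/seteqP; split.
  have h v : v \in P -> J (y * v^-1) -> adjoin (span J P) (y * w^-1) (y * v^-1).
    move=> vP yv; apply: (subgroup_trans sA yA); apply: SA; apply: mem_span => //.
    exact: (subgroup_trans sJ (subgroup_sym sJ yw) yv).
  apply: span_min => // u v; rewrite !inE => /predU1P[->|uP] /predU1P[->|vP] Juv.
  - by rewrite mulgV; exact: (subgroup1 sA).
  - exact: h.
  - by apply: (subgroup_sym sA); apply: h => //; exact: (subgroup_sym sJ).
  - by apply: SA; exact: mem_span.
apply: adjoin_min; first exact: span_subgroup.
  by apply: span_mono => u uP; rewrite inE uP orbT.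
by apply: mem_span => //; rewrite inE ?eqxx // wP orbT.
Qed.

(** An old edge changes nothing, a new edge to an old vertex adds one free generator, and a new edge
    to a new vertex adds none. The equation says that the rank grows by the increase of [E - V]. *)
Lemma span_leaf_basis m (e : 'I_m -> F) : free_basis (span J P) e ->
  exists n (f : 'I_n -> F), free_basis (span J (y :: P)) (cat_family e f) /\
   (n + ncosets J (y :: P) + \sum_(j < k) nedges J P j =
    ncosets J P + \sum_(j < k) nedges J (y :: P) j)%N.
Proof.
move=> eS; rewrite sum_nedges_leaf; case: asboolP => [le|nle] /=.
  exists 0, (fun=> 1); rewrite span_leaf_edge // ncosets_leaf_edge //.
  by split; [exact: free_basis_cat0|rewrite addn0].
rewrite (ncosets_cons y P sJ); case: asboolP => [[w wP yw]|nyw].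
  case: (pselect (span J P (y * w^-1))) => Syw.
    (* If the generator were already in the span, both ends of the edge would be covered, and by
       convexity the edge would be old. *)
    have [] : covered_edge (span J P) P p x.
      apply/(covered_edgeP (span_subgroup J P) tP (span_span P sJ)); rewrite -yE.
      by split; [exact: (covered_mem (span_subgroup J P))|exists w].
    by move=> u [uP uxP /(span_sub sJ)/(subgroup_sym sJ) up]; case: nle; exists u.
  exists 1%N, (fun=> y * w^-1); rewrite (span_leaf_adjoin wP yw); split; last by lia.
  have nout u : u \in P -> u * fg_letter x \in P -> ~ span J P (u * p^-1).
    by move=> uP uxP /(span_sub sJ) up; apply: nle; exists u.
  rewrite yE; apply: (swap_basis (span_subgroup J P) tP (span_span P sJ) pP wP) => //.
    by rewrite -yE.
  move=> u uP uxP /(span_sub sJ) uxw; apply: nle; exists u; split=> //.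
  have := subgroup_trans sJ uxw (subgroup_sym sJ yw).
  by rewrite yE invgM mulgA mulgK.
exists 0, (fun=> 1); split; last by lia.
apply: free_basis_cat0; rewrite span_leaf_eq // => w wP yw.
by case: nyw; exists w.
Qed.

End LeafStep.
End Leaf.

(** * The rank formula and free factors *)

Section Extension.
Local Open Scope classical_set_scope.
Local Open Scope group_scope.
Variable k : nat.
Local Notation F := (free_group 'I_k).
Implicit Types (P Q : seq F) (J M H : set F).

Lemma tree_leaf_inv y P : tree (y :: P) -> P != [::] ->
  exists p x, [/\ tree P, p \in P, y \notin P & fgword y = rcons (fgword p) x].
Proof. by move=> tP; inversion tP => // _; exists p, x. Qed.

(** Each leaf only prolongs the basis, so the span over a tree is a free factor of the span over a
    larger one. *)
Lemma span_extension J P Q m (e : 'I_m -> F) : is_subgroup J -> tree (Q ++ P) -> P != [::] ->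
  free_basis (span J P) e ->
  exists n (f : 'I_n -> F), free_basis (span J (Q ++ P)) (cat_family e f) /\
   (n + ncosets J (Q ++ P) + \sum_(j < k) nedges J P j =
    ncosets J P + \sum_(j < k) nedges J (Q ++ P) j)%N.
Proof.
move=> sJ + P0 eP; elim: Q => [_|y Q IH]; last rewrite cat_cons => tQ.
  by exists 0, (fun=> 1); split; [exact: free_basis_cat0|].
have QP0 : Q ++ P != [::] by case: (Q) => //; case: (P) P0.
have [p [x [tQP pQP yQP yE]]] := tree_leaf_inv tQ QP0.
have [n [f [fQ nE]]] := IH tQP.
have [l [g [gQ lE]]] := span_leaf_basis sJ tQP pQP yQP yE fQ.
exists (n + l)%N, (cat_family f g); split; first exact: free_basis_catA.
by lia.
Qed.

Lemma tree_root_suffix P : tree P -> exists Q, P = Q ++ [:: 1].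
Proof.
by elim=> [|y R p x _ [Q ->] _ _ _]; [exists [::]|exists (y :: Q)].
Qed.

Lemma span_root J : is_subgroup J -> span J [:: 1] = [set 1].
Proof.
move=> sJ; apply/seteqP; split; last by move=> z ->; exact: (subgroup1 (span_subgroup _ _)).
apply: span_min; first exact: trivial_subgroup.
by move=> u v /[!inE] /eqP -> /eqP -> _; rewrite mulgV.
Qed.

Lemma free_basis_trivial (G : groupType) (e : 'I_0 -> G) : free_basis [set 1] e.
Proof.
split=> [|[|[[]]]//]; apply/seteqP; split=> [z ->|].
  exact: (subgroup1 (generated_subgroup _)).
apply: generated_min; first exact: trivial_subgroup.
by move=> z [[]].
Qed.

(** From the root alone, with [V = 1], no edges and trivial span, the increments add up to
    [rk = E - V + 1]. *)
Lemma span_basis J P : is_subgroup J -> tree P ->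
  exists m (e : 'I_m -> F), free_basis (span J P) e /\
    (m + ncosets J P = (\sum_(j < k) nedges J P j).+1)%N.
Proof.
move=> sJ /[dup] tP /tree_root_suffix[Q PE]; rewrite PE in tP *.
have b0 : free_basis (span J [:: 1]) (fun i : 'I_0 => 1).
  by rewrite span_root //; apply: free_basis_trivial.
have [n [f [fP nE]]] := span_extension sJ tP isT b0.
exists n, f; split.
  have bg : bijective (cast_ord (esym (add0n n))).
    by exists (cast_ord (add0n n)); [apply: cast_ordKV|apply: cast_ordK].
  apply: eq_free_basis (free_basis_reindex bg fP) => i /=.
  rewrite (_ : cast_ord _ i = rshift 0 i); last exact: val_inj.
  exact: cat_familyr.
move: nE; have -> : (\sum_(j < k) nedges J [:: 1%g] j)%N = 0%N.
  apply: big1 => j _; rewrite /nedges.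
  have : forall u, u \notin edges_at [:: 1%g] j.
    move=> u; apply/negP => /edges_atP[/[!inE] /eqP -> /eqP].
    by rewrite mul1g => /(congr1 (@fgword _)).
  by case: (edges_at _ _) => // u s /(_ u); rewrite mem_head.
by rewrite addn0 /ncosets /= => ->.
Qed.

Lemma span_generated H (s : seq F) P : H = subgroup_generated [set` s] -> tree P ->
  {subset s <= P} -> span H P = H.
Proof.
move=> HE tP sP; have sH : is_subgroup H by rewrite HE; exact: generated_subgroup.
apply/seteqP; split; first exact: span_sub.
rewrite {1}HE; apply: generated_min; first exact: span_subgroup.
move=> h hs; have Hh : H h by rewrite HE; exact: sub_generated.
by rewrite -[h]mulg1 -invg1; apply: mem_span; rewrite ?invg1 ?mulg1 ?tree_one //; exact: sP.
Qed.

(** Nielsen-Schreier for finitely generated subgroups: over a tree containing the generators the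
    span is all of [H]. *)
Lemma finitely_generated_basis H (s : seq F) : H = subgroup_generated [set` s] ->
  exists m (e : 'I_m -> F), free_basis H e.
Proof.
move=> HE; have [Q [tP sP]] := tree_extend_all s (tree_root 'I_k).
have sH : is_subgroup H by rewrite HE; exact: generated_subgroup.
have [m [e [eP _]]] := span_basis sH tP; exists m, e.
by rewrite -(span_generated HE tP sP).
Qed.

Lemma free_basis_generated (G : groupType) (J : set G) m (e : 'I_m -> G) : free_basis J e ->
  J = subgroup_generated [set` codom e].
Proof.
move=> [-> _]; congr subgroup_generated; apply/seteqP; split=> x /=.
  by move=> [i _ <-]; apply: codom_f.
by move=> /codomP[i ->]; exists i.
Qed.

(** The complement is finitely generated, hence free, and its basis completes that of [H]. *)
Lemma free_factor_basis (H J : set F) r m (e : 'I_r -> F) (g : 'I_m -> F) :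
  free_basis H e -> free_basis J g -> free_factor H J ->
  exists n (f : 'I_n -> F), free_basis J (cat_family e f).
Proof.
move=> eH gJ [sH [B [sB JHB]]].
have [s' BE] := complement_generated sH sB JHB (free_basis_generated gJ).
have [n [f fB]] := finitely_generated_basis BE.
by exists n, f; exact: free_basis_cat JHB.
Qed.

Lemma basis_free_factor (G : groupType) (H J : set G) r n (e : 'I_r -> G) (f : 'I_n -> G) :
  free_basis H e -> free_basis J (cat_family e f) -> free_factor H J.
Proof.
move=> eH /free_basis_product; rewrite -(proj1 eH) => JHf.
split; first exact: free_basis_subgroup eH.
by exists (subgroup_generated (range f)); split; first exact: generated_subgroup.
Qed.

Lemma free_factor_sub (G : groupType) (H J : set G) : free_factor H J -> H `<=` J.
Proof. by move=> [_ [B [_ /free_productl]]]. Qed.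

Lemma free_factor_refl (G : groupType) (H : set G) m (e : 'I_m -> G) : free_basis H e -> free_factor H H.
Proof.
move=> eH; apply: (basis_free_factor (f := fun _ : 'I_0 => 1) eH).
exact: free_basis_cat0.
Qed.

Lemma free_factor_trans (H M J : set F) r m n (e : 'I_r -> F) (f : 'I_m -> F) (g : 'I_n -> F) :
  free_basis H e -> free_basis M f -> free_basis J g ->
  free_factor H M -> free_factor M J -> free_factor H J.
Proof.
move=> eH fM gJ HM MJ; have [a [u uM]] := free_factor_basis eH fM HM.
have [b [v vJ]] := free_factor_basis uM gJ MJ.
exact: (basis_free_factor eH (free_basis_catA vJ)).
Qed.

Lemma free_factor_rank (H J : set F) r m (e : 'I_r -> F) (g : 'I_m -> F) :
  free_basis H e -> free_basis J g -> free_factor H J -> (m <= r)%N -> H = J.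
Proof.
move=> eH gJ HJ mr; have [n [f fJ]] := free_factor_basis eH gJ HJ.
have := free_basis_rank_uniq gJ fJ => mE; have n0 : n = 0%N by lia.
move: f fJ; rewrite n0 => f [-> _]; rewrite range_cat_family (proj1 eH).
congr subgroup_generated; apply/seteqP; split=> x; first by left.
by move=> [//|[[]]].
Qed.

Lemma free_factor_adjoin (H J : set F) r (e : 'I_r -> F) (g : 'I_r.+1 -> F) :
  free_basis H e -> free_basis J g -> free_factor H J ->
  exists t, J = adjoin H t /\ free_basis J (cat_family e (fun _ : 'I_1 => t)).
Proof.
move=> eH gJ HJ; have [n [f fJ]] := free_factor_basis eH gJ HJ.
have := free_basis_rank_uniq gJ fJ => mE; have n1 : n = 1%N by lia.
move: f fJ; rewrite n1 => f fJ.
have fE : f = (fun=> f ord0) by apply: funext => i; rewrite (ord1 i).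
exists (f ord0); rewrite -fE; split=> //.
rewrite (proj1 fJ) range_cat_family /adjoin (proj1 eH).
apply/seteqP; split; apply: generated_min; try exact: generated_subgroup.
  move=> x [xe|[i _ <-]].
    by apply: sub_generated; left; exact: sub_generated.
  by apply: sub_generated; right; rewrite (ord1 i).
move=> x [|->]; first by apply: generated_mono => y; left.
by apply: sub_generated; right; exists ord0.
Qed.

End Extension.

(** * The vertices identified by a one-generator extension *)

Section MeetingVertex.
Local Open Scope classical_set_scope.
Local Open Scope group_scope.
Variable I : choiceType.
Local Notation F := (free_group I).
Variables (H M : set F) (P : seq F).
Hypotheses (sH : is_subgroup H) (sM : is_subgroup M) (tP : tree P).
Hypotheses (HP : span H P = H) (MP : span M P = M) (nMH : ~ M `<=` H).

(** If no edge of [R] with label [x] ended at the vertex of [w], then [M] would arise by adding that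
    edge, would identify no further words of [R], and would lie in [H]. Along the existing edge both
    points step back to covered ones. *)
Let leaf_step R y0 p x d y : tree R -> span H R = H -> span M R = M -> p \in R ->
  y0 = p * fg_letter x -> ~ covered H R y0 -> M = adjoin H d ->
  H (y * y0^-1) -> covered H R (d * y) -> exists z, covered H R z /\ covered H R (d * z).
Proof.
move=> tR HR MR pR y0E y0R ME yy0 [w wR dyw].
case: (pselect (exists u, [/\ u \in R, u * fg_letter x \in R & H (u * fg_letter x * w^-1)])) => [|nu].
  move=> [u [uR uxR uxw]]; exists (y * (fg_letter x)^-1); split.
    by exists p => //; move: yy0; rewrite y0E invgM mulgA.
  exists u => //; have := subgroup_trans sH dyw (subgroup_sym sH uxw).
  by rewrite invgM !mulgA.
have AE : adjoin H (p * fg_letter x * w^-1) = M.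
  have dE : d = (d * y * w^-1) * (w * y0^-1) * (y0 * y^-1).
    by rewrite !mulgA !mulgVK mulgK.
  rewrite -y0E ME [in RHS]dE adjoin_dcoset //; last exact: (subgroup_sym sH).
  by rewrite -(adjoinV H (y0 * w^-1)) invgM invgK.
case: nMH; rewrite -MR; apply: span_min => // u v uR vR Muv.
have Auv : adjoin H (p * fg_letter x * w^-1) (u * v^-1) by rewrite AE.
apply: (swap_trace sH tR HR pR wR _ _ _ uR vR Auv).
- by move=> pxw; apply: y0R; exists w => //; rewrite y0E.
- move=> u' u'R u'xR u'p; apply: y0R; exists (u' * fg_letter x) => //.
  by rewrite y0E invgM mulgA mulgK; exact: (subgroup_sym sH).
- by move=> u' u'R u'xR u'xw; apply: nu; exists u'.
Qed.

(* Prune the leaves of a tree containing [g]: a leaf can only be a meeting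
   point of the two translates if its edge is, as otherwise [M] would not be
   generated over the smaller tree. *)
Lemma meeting_vertex g : M = adjoin H g ->
  exists y, covered H P y /\ covered H P (g * y).
Proof.
move=> ME; have [Q [tQ gQ]] := tree_extend g tP.
have : exists y, covered H (Q ++ P) y /\ covered H (Q ++ P) (g * y).
  by exists 1; rewrite mulg1; split; apply: covered_mem => //; apply: tree_one.
elim: Q tQ {gQ} => // y0 Q IH tQ [y [yc gyc]].
have QP0 : Q ++ P != [::] by have := tree_one tP; case: (Q) => //; case: (P).
have [p [x [tR pR y0R y0E]]] : exists p x, [/\ tree (Q ++ P), p \in Q ++ P, y0 \notin Q ++ P &
    fgword y0 = rcons (fgword p) x].
  by move: QP0; inversion tQ => // _; exists p, x.
apply: IH => //; set R := Q ++ P in tR pR y0R *.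
have PR : {subset P <= R} by move=> u uP; rewrite mem_cat uP orbT.
have HR := span_full sH HP PR; have MR := span_full sM MP PR.
have coverS z : covered H (y0 :: R) z -> covered H R z \/ H (z * y0^-1).
  by move=> [w /[!inE] /predU1P[->|wR] zw]; [right|left; exists w].
have y0x := fg_rcons_mul y0E.
case: (pselect (covered H R y0)) => [[w wR y0w]|y0n].
  have cR z : covered H (y0 :: R) z -> covered H R z.
    by move=> /coverS[//|zy0]; exists w => //; exact: (subgroup_trans sH zy0 y0w).
  by exists y; split; exact: cR.
case: (coverS _ yc) (coverS _ gyc) => [yR|yy0] [gyR|gyy0].
- by exists y.
- have ME' : M = adjoin H g^-1 by rewrite adjoinV.
  have [|z [zR gzR]] := leaf_step tR HR MR pR y0x y0n ME' gyy0; first by rewrite mulKg.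
  by exists (g^-1 * z); rewrite mulVKg.
- exact: (leaf_step tR HR MR pR y0x y0n ME yy0 gyR).
(* Both points lie over the leaf, which puts [g] in [H]. *)
- case: nMH; rewrite ME adjoin_id //.
  by have := subgroup_trans sH gyy0 (subgroup_sym sH yy0); rewrite mulgK.
Qed.

End MeetingVertex.

(** * Adjoining one free generator *)

Section FreeAdjunction.
Local Open Scope classical_set_scope.
Local Open Scope group_scope.
Variables (G : groupType) (H : set G) (g : G) (r : nat) (e : 'I_r -> G).
Hypothesis eH : free_basis H e.
Let M := adjoin H g.
Hypothesis egM : free_basis M (cat_family e (fun _ : 'I_1 => g)).

Let sH : is_subgroup H := free_basis_subgroup eH.
Let C := subgroup_generated (range (fun _ : 'I_1 => g)).

Definition dcoset (x y : G) := exists h1 h2, [/\ H h1, H h2 & x = h1 * y * h2].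

Let MHC : free_product M H C.
Proof. by have := free_basis_product egM; rewrite -(proj1 eH). Qed.

Let Cg : C g. Proof. by apply: sub_generated; exists ord0. Qed.
Let sC : is_subgroup C := generated_subgroup _.

Let g1 : g <> 1.
Proof.
move=> g1; have [_ /(_ [:: (rshift r ord0, false)] isT isT)] := egM.
by rewrite /word_eval big_seq1 /= cat_familyr g1 eqxx.
Qed.

Let gg1 : g * g <> 1.
Proof.
move=> gg; have [_ /(_ [:: (rshift r ord0, false); (rshift r ord0, false)])] := egM.
rewrite /reduced /= /letter_inv /= xpair_eqE andbF => /(_ isT isT).
by rewrite /word_eval !big_cons big_nil /= cat_familyr mulg1 gg eqxx.
Qed.

Let gV1 : g^-1 <> 1.
Proof. by move=> gv; apply: g1; rewrite -[g]invgK gv invg1. Qed.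

Lemma free_adjoin_notin : ~ H g.
Proof.
move=> Hg; have [_ /(_ [:: (true, g); (false, g^-1)])] := MHC.
rewrite !big_cons big_nil /= mulg1 mulgV eqxx => h; suff : false by []; apply: h => // p.
rewrite !inE => /orP[|] /eqP -> /=; split=> //; exact: (subgroupV sC).
Qed.

(** Otherwise [g h g^-1 h'^-1] would be an alternating word with product 1. This gives the
    injectivity in the correspondence between points of the Cayley tree and vertex pairs. *)
Lemma free_adjoin_conj h h' : H h -> H h' -> g * h = h' * g -> h = 1.
Proof.
move=> Hh Hh' gh; apply: contrapT => h1.
have hE : g * h * g^-1 = h' by rewrite gh mulgK.
have h'1 : h'^-1 <> 1.
  move=> h'1; apply: h1; apply: (mulgI g); rewrite gh mulg1.
  by rewrite -[h']invgK h'1 invg1 mul1g.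
have [_ /(_ [:: (false, g); (true, h); (false, g^-1); (true, h'^-1)])] := MHC.
rewrite !big_cons big_nil /= mulg1 !mulgA hE mulgV eqxx => k; suff : false by []; apply: k => // p.
rewrite !inE => /or4P[] /eqP -> /=; split=> //.
  exact: (subgroupV sC).
exact: (subgroupV sH).
Qed.

(** The retraction onto the cyclic factor that kills [H] would give [g = g^-1]. *)
Lemma free_adjoin_dcosetV : ~ dcoset g g^-1.
Proof.
move=> [h1 [h2 [Hh1 Hh2 gE]]].
have [||h [hM hH hC]] := @free_product_hom _ M H C sH sC MHC G (fun=> 1) id.
- by move=> x y _ _; rewrite mulg1.
- by [].
have sM := free_product_subgroup MHC.
have HM := free_productl MHC; have CM := free_productr MHC.
have CgV : C g^-1 := subgroupV sC Cg.
have := congr1 h gE; rewrite !hM; try by [apply: HM|apply: CM|apply: (subgroupM sM); [apply: HM|apply: CM]].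
rewrite (hC g) // (hC g^-1) // !hH // mul1g mulg1 => ggV.
by apply: gg1; rewrite {1}ggV mulVg.
Qed.

End FreeAdjunction.

(** * Elements generating the same extension of the subgroup *)

Section Transport.
Local Open Scope classical_set_scope.
Local Open Scope group_scope.
Variables (G : groupType) (H : set G) (g g' : G) (r : nat) (e : 'I_r -> G).
Hypothesis eH : free_basis H e.
Hypothesis egM : free_basis (adjoin H g) (cat_family e (fun _ : 'I_1 => g)).
Hypothesis gg' : adjoin H g' = adjoin H g.

Let L := free_group 'I_(r + 1).
Let c := cat_family e (fun _ : 'I_1 => g).
Let phi := fg_eval c : L -> G.
Let X (i : 'I_r) : L := fg_gen (lshift 1 i).
Let t : L := fg_gen (rshift r ord0).
Let H1 : set L := subgroup_generated (range X).
Let P1 : seq L := [seq fg_gen i | i <- enum 'I_(r + 1)] ++ [:: 1].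

Let sH : is_subgroup H := free_basis_subgroup eH.
Let sH1 : is_subgroup H1 := generated_subgroup _.
Let phi_inj : injective phi := free_basis_ev_inj egM.
Let phit : phi t = g. Proof. by rewrite /phi /t fg_eval_gen /c cat_familyr. Qed.
Let phiX i : phi (X i) = e i. Proof. by rewrite /phi /X fg_eval_gen /c cat_familyl. Qed.

Let phi_H1 u : H1 u -> H (phi u).
Proof.
move: u; apply: generated_min.
  apply/is_subgroupP; split=> [|u v uH vH|u uH].
  - by rewrite /phi fg_eval1; exact: (subgroup1 sH).
  - by rewrite /phi fg_evalM; exact: (subgroupM sH).
  - by rewrite /phi fg_evalV; exact: (subgroupV sH).
by move=> _ [i _ <-]; rewrite phiX; exact: free_basis_mem eH.
Qed.

Let H_phi x : H x -> exists2 u, H1 u & phi u = x.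
Proof.
rewrite (proj1 eH) => /fg_eval_generated[v <-]; exists (fg_eval X v).
  by apply: (fg_eval_mem v sH1) => i; apply: (@sub_generated _ (range X)); exists i.
rewrite /phi fg_eval_comp; apply: eq_bigr => y _.
by rewrite -/(phi _) phiX.
Qed.

Let tP1 : tree P1.
Proof.
rewrite /P1; elim: (enum _) (enum_uniq 'I_(r + 1)) => [|i s IH] /=; first by move=> _; exact: tree_root.
move=> /andP[is_ us]; apply: (@tree_leaf _ (fg_gen i) _ 1 (i, false)) => //; first exact: IH.
  by rewrite mem_cat mem_head orbT.
rewrite mem_cat inE negb_or; apply/andP; split.
  by apply/mapP => -[j js /(congr1 (@fgword _))] [ij]; rewrite ij js in is_.
by apply/eqP => /(congr1 (@fgword _)).
Qed.

Let genP1 i : fg_gen i \in P1.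
Proof. by rewrite mem_cat map_f ?mem_enum. Qed.

Let oneP1 : 1 \in P1. Proof. exact: tree_one. Qed.

Let span_gens (J : set L) (A : set 'I_(r + 1)) : is_subgroup J ->
  J = subgroup_generated [set fg_gen i | i in A] -> span J P1 = J.
Proof.
move=> sJ JE; apply/seteqP; split; first exact: span_sub.
rewrite {1}JE; apply: generated_min; first exact: span_subgroup.
move=> _ [i Ai <-]; rewrite -[fg_gen i]mulg1 -invg1; apply: mem_span => //.
by rewrite invg1 mulg1 JE; apply: sub_generated; exists i.
Qed.

Let covered_P1 y : covered H1 P1 y -> H1 y \/ H1 (y * t^-1).
Proof.
move=> [w]; rewrite mem_cat inE => /orP[/mapP[i _ ->]|/eqP ->]; last by rewrite invg1 mulg1; left.
rewrite -[i]splitK; case: (fintype.split i) => j /=; last by rewrite (ord1 j); right.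
move=> yj; left; apply: (subgroupMr sH1 _ yj); apply: (subgroupV sH1).
by apply: (@sub_generated _ (range X)); exists j.
Qed.

(* In the free group on the basis of [H] and [g], the star of all generators
   is a tree, whose image in the Schreier graph of [H] has two vertices only. *)
Lemma free_adjoin_uniq : dcoset H g' g \/ dcoset H g' g^-1.
Proof.
have Hg : ~ H g := free_adjoin_notin eH egM.
have Mg' : adjoin H g g' by rewrite -gg'; exact: (@mem_adjoin _ H g').
have [u phiu] : exists u, phi u = g'.
  by move: Mg'; rewrite (proj1 egM) => /fg_eval_generated[u uE]; exists u.
have LE : (setT : set L) = adjoin H1 u.
  apply/seteqP; split=> // v _.
  have : adjoin H g' `<=` [set x | exists2 v, adjoin H1 u v & phi v = x].
    have sA := adjoin_subgroup H1 u.
    apply: adjoin_min.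
    - apply/is_subgroupP; split=> [|_ _ [a aA <-] [b bA <-]|_ [a aA <-]].
      + by exists 1; rewrite /phi ?fg_eval1 //; exact: (subgroup1 sA).
      + by exists (a * b); rewrite /phi ?fg_evalM //; exact: (subgroupM sA).
      + by exists a^-1; rewrite /phi ?fg_evalV //; exact: (subgroupV sA).
    - by move=> x /H_phi[a aH <-]; exists a => //; exact: sub_adjoin.
    - by exists u => //; exact: (@mem_adjoin _ H1 u).
  have vM : adjoin H g' (phi v) by rewrite gg' (proj1 egM); apply/fg_eval_generated; exists v.
  by move=> /(_ _ vM)[w wA /phi_inj <-].
have sT : is_subgroup (setT : set L) by apply/is_subgroupP.
have nT : ~ (setT : set L) `<=` H1.
  by move=> /(_ t I)/phi_H1; rewrite phit.
have H1P : span H1 P1 = H1.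
  apply: (@span_gens _ [set i | exists j, i = lshift 1 j]) => //.
  congr subgroup_generated; apply/seteqP; split=> x [i].
    by move=> _ <-; exists (lshift 1 i) => //; exists i.
  by move=> [j ->] <-; exists j.
have TP : span (setT : set L) P1 = setT.
  by apply: (@span_gens _ setT) => //; rewrite fg_generated.
have [y [yc uyc]] := meeting_vertex sH1 sT tP1 H1P TP nT LE.
have uH1 : ~ H1 u by move=> uH1; apply: nT; rewrite LE adjoin_id.
have toG a b d : H1 a -> H1 b -> u = a * d * b -> dcoset H g' (phi d).
  move=> aH bH uE; exists (phi a), (phi b); split; [exact: phi_H1|exact: phi_H1|].
  by rewrite -phiu uE /phi !fg_evalM.
(* As [u] is not in [H1], the points [y] and [u y] lie over different vertices; which of them lies
   over [t] decides between [g] and its inverse. *)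
case: (covered_P1 yc) (covered_P1 uyc) => [yH|yt] [uyH|uyt].
- by case: uH1; exact: (subgroupMr sH1 yH uyH).
- left; rewrite -phit; apply: (toG (u * y * t^-1) y^-1) => //; first exact: (subgroupV sH1).
  by rewrite mulgVK mulgK.
- right; rewrite -phit -fg_evalV; apply: (toG (u * y) (t * y^-1)) => //; first exact: (subgroup_sym sH1).
  by rewrite !mulgA mulgVK mulgK.
- by case: uH1; have := subgroup_trans sH1 uyt (subgroup_sym sH1 yt); rewrite mulgK.
Qed.

End Transport.

(** * Finite convex subsets of the Cayley tree *)

Section PairCounting.
Local Open Scope classical_set_scope.
Local Open Scope group_scope.
Variable k : nat.
Local Notation F := (free_group 'I_k).

(** Translated to contain 1, the set is prefix-closed; the rank formula for the trivial subgroup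
    then reads [V = E + 1]. *)
Lemma convex_card (Y : seq F) : uniq Y -> Y != [::] ->
  (forall y z s x t, y \in Y -> z \in Y -> fgword (y^-1 * z) = s ++ x :: t ->
    y * \prod_(c <- s) fg_letter c \in Y) ->
  size Y = (\sum_(j < k) count (fun y => (y * fg_gen j)%g \in Y) Y).+1.
Proof.
move=> uY Y0 cY; have [y0 y0Y] : exists y0, y0 \in Y.
  by case: (Y) Y0 => // y s _; exists y; exact: mem_head.
pose Z := map (mul y0^-1) Y.
have ZE z : (z \in Z) = (y0 * z \in Y).
  by rewrite -{1}(mulKg y0 z) mem_map //; exact: mulgI.
have uZ : uniq Z by rewrite map_inj_uniq //; exact: mulgI.
have Z1 : 1 \in Z by rewrite ZE mulg1.
have [P tP PZ] : exists2 P, tree P & P =i Z.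
  apply: prefix_closed_tree => // u v x; rewrite !ZE => uY' uvx.
  have := cY _ _ (fgword v) x [::] y0Y uY'; rewrite mulKg fg_expand; apply.
  by rewrite uvx cats1.
have s1 := trivial_subgroup F.
have [m [e [eP]]] := span_basis s1 tP.
have spE : span [set 1] P = [set 1 : F].
  apply/seteqP; split; first exact: span_sub.
  by move=> z ->; exact: (subgroup1 (span_subgroup _ _)).
rewrite spE in eP.
have := free_basis_rank_uniq eP (free_basis_trivial (fun i : 'I_0 => 1 : F)) => m0.
have nc s : uniq s -> ncosets [set 1 : F] s = size s.
  move=> us; rewrite /ncosets undup_id ?size_map // map_inj_uniq // => u v.
  by move/(coset_rep_eq _ _ s1) => /= /eqP; rewrite divg_eq1 => /eqP.
rewrite m0 add0n nc ?tree_uniq // (perm_size (uniq_perm (tree_uniq tP) uZ PZ)) size_map => ->.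
congr (_.+1); apply: eq_bigr => j _; rewrite /nedges nc ?filter_uniq ?tree_uniq //.
have /perm_size -> : perm_eq (edges_at P j) [seq z <- Z | z * fg_gen j \in Z].
  apply: uniq_perm => [||z]; [exact/filter_uniq/tree_uniq|exact: filter_uniq|].
  by rewrite !mem_filter !PZ.
rewrite size_filter count_map; apply: eq_count => y /=.
by rewrite ZE mulgA mulVKg.
Qed.

Lemma size_fibers (T T' : eqType) (f : T -> T') (s : seq T) (cs : seq T') : uniq cs ->
  {in s, forall x, f x \in cs} -> size s = (\sum_(c <- cs) count (fun x => f x == c) s)%N.
Proof.
move=> ucs; elim: s => [|x s IH] fs; first by rewrite big1.
rewrite /= IH => [|y ys]; last by apply: fs; rewrite inE ys orbT.
rewrite big_split /= -[LHS]add1n; congr addn.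
rewrite -[LHS](_ : count_mem (f x) cs = 1%N); last first.
  by rewrite count_uniq_mem // fs ?mem_head.
by rewrite -sum1_count big_mkcond; apply: eq_bigr => c _ /=; rewrite eq_sym; case: eqP.
Qed.

End PairCounting.

(** * Counting the extensions by one free generator *)

Section ImmediateExtensions.
Local Open Scope classical_set_scope.
Local Open Scope group_scope.
Variable k : nat.
Local Notation F := (free_group 'I_k).
Variables (H : set F) (P : seq F).
Hypotheses (sH : is_subgroup H) (tP : tree P) (HP : span H P = H).

Let rep := coset_rep H.
Let cov := covered H P.
(** Vertices of the graph of [H] as coset representatives; [EE j] lists its edges with label [j] by
    their sources. *)
Let VV := undup (map rep P).
Let EE j := undup (map rep (edges_at P j)).

Let repP y : H (rep y * y^-1) := coset_repP y sH.
Let repE y z : rep y = rep z <-> H (y * z^-1) := coset_rep_eq y z sH.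
Let repK y : rep (rep y) = rep y := coset_repK y sH.

Let cov_rep y z : rep y = rep z -> cov y -> cov z.
Proof.
move=> /repE/(subgroup_sym sH) zy yc; rewrite -(mulgVK y z).
exact: coveredM.
Qed.

Let rep_mul y z x : rep y = rep z -> rep (y * x) = rep (z * x).
Proof. by move=> /repE yz; apply/repE; rewrite invgM mulgA mulgK. Qed.

Let memVV u : u \in VV <-> rep u = u /\ cov u.
Proof.
rewrite mem_undup; split=> [/mapP[w wP ->]|[uE [w wP uw]]].
  split; first exact: repK.
  by exists w.
by apply/mapP; exists w => //; rewrite -uE; apply/repE.
Qed.

Let memEE j u : u \in EE j <-> [/\ rep u = u, cov u & cov (u * fg_gen j)].
Proof.
rewrite mem_undup; split=> [/mapP[w /edges_atP[wP wjP] ->]|[uE uc ujc]].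
  split; first exact: repK.
    by exists w.
  by apply: (@cov_rep (w * fg_gen j)); [apply/esym/rep_mul/repK|apply: covered_mem].
have : covered_edge H P u (j, false) by apply/covered_edgeP.
move=> [w [wP wjP uw]]; apply/mapP; exists w; first by apply/edges_atP.
by rewrite -uE; apply/repE.
Qed.

Definition dcoset_pairs (S : seq F) (g : F) : seq (F * F) :=
  [seq uv <- [seq (u, v) | u <- S, v <- S] | `[< dcoset H (uv.1 * uv.2^-1) g >]].

Let mem_pairs S g u v : (u, v) \in dcoset_pairs S g <->
  [/\ u \in S, v \in S & dcoset H (u * v^-1) g].
Proof.
rewrite mem_filter; split=> [/andP[/asboolP h /allpairsP[[u' v'] /= [uS vS [uE vE]]]]|[uS vS h]].
  by rewrite uE vE in h *; split.
by apply/andP; split; [apply/asboolP|apply/allpairsP; exists (u, v)].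
Qed.

Let uniq_pairs S g : uniq S -> uniq (dcoset_pairs S g).
Proof. by move=> uS; apply/filter_uniq/allpairs_uniq => // -[a b] [c d]. Qed.

Section Fiber.
Variable g : F.
Hypothesis g_conj : forall h h', H h -> H h' -> g * h = h' * g -> h = 1.

(** The intersection of the covered subtree with its translate by [g^-1]. The map [q] to the
    vertices below [g y] and [y] is a bijection onto the vertex pairs over [H g H]. *)
Let Q y := cov y /\ cov (g * y).
Let q y := (rep (g * y), rep y).
Let sel uv := xget 1 [set y | Q y /\ q y = uv].

Let q_pairs y : Q y -> q y \in dcoset_pairs VV g.
Proof.
move=> [yc gyc]; apply/mem_pairs; split.
- by apply/memVV; split; [exact: repK|apply: cov_rep gyc; rewrite repK].
- by apply/memVV; split; [exact: repK|apply: cov_rep yc; rewrite repK].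
exists (rep (g * y) * (g * y)^-1), (y * (rep y)^-1).
by split; [exact: repP|exact: (subgroup_sym sH)|rewrite invgM !mulgA !mulgVK].
Qed.

Let q_inj y z : q y = q z -> y = z.
Proof.
move=> [/repE gyz /repE yz]; apply/eqP; rewrite -divg_eq1; apply/eqP.
apply: (g_conj yz gyz); by rewrite !mulgA invgM !mulgA mulgVK.
Qed.

Let selP uv : uv \in dcoset_pairs VV g -> Q (sel uv) /\ q (sel uv) = uv.
Proof.
case: uv => u v /mem_pairs[/memVV[uE uc] /memVV[vE vc] [h1 [h2 [H1 H2 uvE]]]].
suff h : Q (h2 * v) /\ q (h2 * v) = (u, v).
  by apply: (@xgetPex _ 1 [set y | Q y /\ q y = (u, v)]); exists (h2 * v).
have gE : g * (h2 * v) = h1^-1 * u.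
  by apply: (mulgI h1); rewrite mulVKg !mulgA -uvE mulgVK.
have Hh1 : H h1^-1 by exact: (subgroupV sH).
rewrite /Q /q gE; split.
  by split; [exact: (coveredM sH H2 vc)|exact: (coveredM sH Hh1 uc)].
by rewrite -{2}uE -{2}vE; congr pair; apply/repE; rewrite mulgK.
Qed.

(** The intersection of two subtrees is convex, so it has one more vertex than edges; [q] carries
    its vertices to pairs of vertices and its edges to pairs of edges with equal labels. *)
Lemma dcoset_pairs_card : dcoset_pairs VV g != [::] ->
  size (dcoset_pairs VV g) = (\sum_(j < k) size (dcoset_pairs (EE j) g)).+1.
Proof.
move=> p0; pose Y := map sel (dcoset_pairs VV g).
have YQ y : y \in Y <-> Q y.
  split=> [/mapP[uv /selP[h _] ->] //|Qy]; have [_ /q_inj yE] := selP (q_pairs Qy).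
  by rewrite -yE; apply: map_f; exact: q_pairs.
have uY : uniq Y.
  rewrite map_inj_in_uniq; first exact/uniq_pairs/undup_uniq.
  by move=> a b /selP[_ aE] /selP[_ bE] ab; rewrite -aE ab bE.
rewrite -(size_map sel) (convex_card uY); first last.
- move=> y z s x t /YQ[yc gyc] /YQ[zc gzc] yz; apply/YQ.
  have := covered_convex sH tP HP yc zc; rewrite yz => /walk_cat[_ [/covered_edge_start h _]].
  have := covered_convex sH tP HP gyc gzc.
  rewrite invgM -!mulgA mulKg yz => /walk_cat[_ [/covered_edge_start h' _]].
  by split=> //; rewrite mulgA.
- by rewrite -size_eq0 size_map size_eq0.
congr (_.+1); apply: eq_bigr => j _; rewrite -size_filter -(size_map q).
apply/perm_size/uniq_perm.
- by rewrite map_inj_uniq; [exact: filter_uniq|exact: q_inj].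
- exact/uniq_pairs/undup_uniq.
move=> [u v]; apply/mapP/idP => [[y]|].
  rewrite mem_filter => /andP[/YQ[yjc gyjc] /YQ Qy] ->.
  have := q_pairs Qy; rewrite /q => /mem_pairs[/memVV[? ?] /memVV[? ?] h].
  apply/mem_pairs; split=> //; apply/memEE; split=> //.
    apply: cov_rep gyjc; by rewrite mulgA; apply/esym/rep_mul/repK.
  by apply: cov_rep yjc; apply/esym/rep_mul/repK.
move=> /mem_pairs[/memEE[uE uc ujc] /memEE[vE vc vjc] h].
have uvV : (u, v) \in dcoset_pairs VV g.
  by apply/mem_pairs; split=> //; apply/memVV.
have [Qy qE] := selP uvV; exists (sel (u, v)) => //.
rewrite mem_filter; apply/andP; split; apply/YQ => //.
case: qE => guE vyE; split.
  by apply: cov_rep vjc; apply: rep_mul; rewrite vE vyE.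
by rewrite mulgA; apply: cov_rep ujc; apply: rep_mul; rewrite uE guE.
Qed.

End Fiber.

Variables (r : nat) (e : 'I_r -> F).
Hypothesis eH : free_basis H e.
(** The situation in which the coefficient of degree [r + 1] is computed: every other subgroup of a
    pattern has rank above [r]. *)
Hypothesis rank_gt : forall M, is_subgroup M -> span M P = M -> H `<=` M -> M <> H ->
  forall m (f : 'I_m -> F), free_basis M f -> (r < m)%N.

(** [M] has [r + 1] generators and rank above [r], so its rank is [r + 1] and the Hopf property
    makes these generators a basis. *)
Lemma immediate_basis u v : cov u -> cov v -> ~ H (u * v^-1) ->
  let M := adjoin H (u * v^-1) in
  span M P = M /\ free_basis M (cat_family e (fun _ : 'I_1 => u * v^-1)).
Proof.
move=> [w wP uw] [w' w'P vw] Huv M; have sM : is_subgroup M := adjoin_subgroup _ _.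
have HM : H `<=` M := @sub_adjoin _ _ _.
have MP : span M P = M.
  apply/seteqP; split; first exact: span_sub.
  have sS := span_subgroup M P.
  have HS : H `<=` span M P by rewrite -{1}HP; apply: span_mono_l.
  apply: adjoin_min => //.
  have -> : u * v^-1 = (u * w^-1) * (w * w'^-1) * (w' * v^-1) by rewrite !mulgA !mulgVK.
  have Hwv := subgroup_sym sH vw.
  apply: (subgroupM sS _ (HS _ Hwv)); apply: (subgroupM sS (HS _ uw)).
  apply: mem_span => //.
  have -> : w * w'^-1 = (w * u^-1) * (u * v^-1) * (v * w'^-1) by rewrite !mulgA !mulgVK.
  apply: (subgroupM sM _ (HM _ vw)).
  by apply: (subgroupM sM (HM _ (subgroup_sym sH uw))); exact: (@mem_adjoin _ H).
split=> //.
have ME : M = subgroup_generated (range (cat_family e (fun _ : 'I_1 => u * v^-1))).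
  rewrite range_cat_family -generatedU -(proj1 eH) /M /adjoin.
  apply/seteqP; split; apply: generated_min; try exact: generated_subgroup.
    move=> y [Hy|->]; first by apply: sub_generated; left.
    by apply: sub_generated; right; apply: sub_generated; exists ord0.
  move=> y [Hy|]; first by apply: sub_generated; left.
  move: y; apply: generated_min; first exact: generated_subgroup.
  by move=> _ [_ _ <-]; apply: sub_generated; right.
have [m [f [fM _]]] := span_basis sM tP; rewrite MP in fM.
have MH : M <> H by move=> MH; apply: Huv; rewrite -MH; exact: (@mem_adjoin _ H).
have rm := rank_gt sM MP HM MH fM.
have mr := free_basis_rank_le fM ME.
have mE : m = (r + 1)%N by lia.
by move: f fM; rewrite mE => f fM; exact: free_basis_hopf fM ME.
Qed.

(** Group the ordered pairs of distinct vertices by the extension they generate. Each extension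
    receives two trees, for [g] and for [g^-1], so its vertex pairs outnumber its edge pairs by
    two. *)
Lemma count_immediate : exists Ms : seq (set F),
  [/\ uniq Ms,
      forall M, M \in Ms <-> [/\ is_subgroup M, span M P = M, free_rank M = Some r.+1 & free_factor H M]
    & (2 * size Ms + \sum_(j < k) nedges H P j * (nedges H P j).-1 =
       ncosets H P * (ncosets H P).-1)%N].
Proof.
pose all (S : seq F) := [seq uv <- [seq (u, v) | u <- S, v <- S] | uv.1 != uv.2].
have mem_all S u v : (u, v) \in all S <-> [/\ u \in S, v \in S & u != v].
  rewrite mem_filter; split=> [/andP[/= uv /allpairsP[[a b] /= [aS bS [uE vE]]]]|[uS vS uv]].
    by rewrite uE vE in uv *; split.
  by apply/andP; split=> //; apply/allpairsP; exists (u, v).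
have uniq_all S : uniq S -> uniq (all S).
  by move=> uS; apply/filter_uniq/allpairs_uniq => // -[a b] [c d].
have size_all S : uniq S -> size (all S) = (size S * (size S).-1)%N.
  move=> uS; have := count_predC (fun uv : F * F => uv.1 == uv.2) [seq (u, v) | u <- S, v <- S].
  rewrite size_allpairs -!size_filter -/(all S).
  have /perm_size -> : perm_eq [seq uv <- [seq (u, v) | u <- S, v <- S] | uv.1 == uv.2] [seq (u, u) | u <- S].
    apply: uniq_perm => [||[u v]].
    - by apply/filter_uniq/allpairs_uniq => // -[a b] [c d].
    - by rewrite map_inj_uniq // => a b [].
    rewrite mem_filter; apply/andP/mapP => [[/= /eqP <- /allpairsP[[a b] /= [aS _ [-> _]]]]|[a aS [-> ->]]].
      by exists a.
    by split=> //; apply/allpairsP; exists (a, a).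
  rewrite size_map => h; have {h} : (size S + size (all S) = size S * size S)%N by exact: h.
  case: (size S) => [|n]; first by rewrite mul0n.
  by rewrite mulSn => /addnI ->; rewrite mulnC.
have notH u v : rep u = u -> rep v = v -> u != v -> ~ H (u * v^-1).
  by move=> uE vE uv /repE; rewrite uE vE => uv'; rewrite uv' eqxx in uv.
pose f (uv : F * F) := adjoin H (uv.1 * uv.2^-1).
pose Ms := undup (map f (all VV)); exists Ms; split; first exact: undup_uniq.
  move=> M; rewrite mem_undup; split=> [/mapP[[u v] /mem_all[/memVV[uE uc] /memVV[vE vc] uv] ->]|].
    have [MP bM] := immediate_basis uc vc (notH _ _ uE vE uv); rewrite /f /=; split=> //.
    - exact: adjoin_subgroup.
    - by rewrite (free_rank_basis bM) addn1.
    - exact: basis_free_factor eH bM.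
  (* Conversely, a meeting point of the two translates provides two vertices whose identification
     gives [M]. *)
  move=> [sM MP /free_rank_Some[c cM] HM].
  have [t [ME tM]] := free_factor_adjoin eH cM HM.
  have Ht : ~ H t by rewrite ME in tM; exact: (free_adjoin_notin eH tM).
  have nMH : ~ M `<=` H by move=> MH; apply: Ht; apply: MH; rewrite ME; exact: (@mem_adjoin _ H t).
  have [y [yc tyc]] := meeting_vertex sH sM tP HP MP nMH ME.
  have tE : rep (t * y) * (rep y)^-1 = (rep (t * y) * (t * y)^-1) * t * (y * (rep y)^-1).
    by rewrite invgM !mulgA !mulgVK.
  apply/mapP; exists (rep (t * y), rep y); last first.
    by rewrite /f /= tE ME adjoin_dcoset //; exact: (subgroup_sym sH).
  apply/mem_all; split.
  - by apply/memVV; split; [exact: repK|apply: cov_rep tyc; rewrite repK].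
  - by apply/memVV; split; [exact: repK|apply: cov_rep yc; rewrite repK].
  - by apply/eqP => /repE; rewrite mulgK.
have uV : uniq VV := undup_uniq _.
have fib M : M \in Ms ->
    exists g, [/\ size (dcoset_pairs VV g) = (\sum_(j < k) size (dcoset_pairs (EE j) g)).+1,
      size (dcoset_pairs VV g^-1) = (\sum_(j < k) size (dcoset_pairs (EE j) g^-1)).+1 &
      forall S, {subset S <= VV} -> uniq S ->
      count (fun uv => f uv == M) (all S) = (size (dcoset_pairs S g) + size (dcoset_pairs S g^-1))%N].
  rewrite mem_undup => /mapP[[u0 v0] /mem_all[u0V v0V uv0] ->].
  have [u0E u0c] := (memVV u0).1 u0V; have [v0E v0c] := (memVV v0).1 v0V.
  have [MP bM] := immediate_basis u0c v0c (notH _ _ u0E v0E uv0).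
  pose g := u0 * v0^-1; rewrite -/g in MP bM; exists g.
  have gg d : dcoset H d d by exists 1, 1; rewrite mul1g mulg1; split=> //; exact: (subgroup1 sH).
  have conj_g h h' : H h -> H h' -> g * h = h' * g -> h = 1 := free_adjoin_conj eH bM (h := h) (h' := h').
  split.
  - apply: dcoset_pairs_card => //.
    have : (u0, v0) \in dcoset_pairs VV g by apply/mem_pairs; split.
    by case: (dcoset_pairs _ _).
  - apply: dcoset_pairs_card => [h h' Hh Hh' gh|].
      have h'1 : h' = 1.
        apply: (conj_g h' h) => //; apply: (mulIg g^-1); rewrite mulgK -mulgA -gh.
        by rewrite mulVKg.
      by apply: (mulgI g^-1); rewrite gh h'1 mul1g mulg1.
    have : (v0, u0) \in dcoset_pairs VV g^-1.
      by apply/mem_pairs; split=> //; rewrite /g invgM invgK.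
    by case: (dcoset_pairs _ _).
  move=> S SV uS; rewrite -size_cat -size_filter; apply/perm_size/uniq_perm.
  - exact/filter_uniq/uniq_all.
  - rewrite cat_uniq !uniq_pairs // andbT /=; apply/hasPn => -[u v] /mem_pairs[_ _ [h1 [h2 [H1 H2 uvE]]]].
    apply/negP => /mem_pairs[_ _ [h3 [h4 [H3 H4 uvE']]]].
    apply: (free_adjoin_dcosetV eH bM); exists (h3^-1 * h1), (h2 * h4^-1).
    split; [exact: (subgroupM sH (subgroupV sH H3))|exact: (subgroupM sH _ (subgroupV sH H4))|].
    have -> : h3^-1 * h1 * g^-1 * (h2 * h4^-1) = h3^-1 * (h1 * g^-1 * h2) * h4^-1 by rewrite !mulgA.
    by rewrite -uvE uvE' !mulgA mulVg mul1g mulgK.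
  move=> [u v]; rewrite mem_filter mem_cat.
  have ok d : d = g \/ d = g^-1 -> dcoset H (u * v^-1) d -> adjoin H (u * v^-1) = adjoin H g /\ u != v.
    move=> dg [h1 [h2 [H1 H2 uvE]]].
    have dE : adjoin H d = adjoin H g by case: dg => -> //; rewrite adjoinV.
    have aE : adjoin H (u * v^-1) = adjoin H g by rewrite uvE adjoin_dcoset.
    split=> //; apply/eqP => uv; apply: (free_adjoin_notin eH bM).
    have : adjoin H (u * v^-1) = H by rewrite uv mulgV adjoin_id //; exact: (subgroup1 sH).
    by rewrite aE => AH; rewrite -AH; exact: (@mem_adjoin _ H g).
  apply/andP/orP => [[/eqP fE /mem_all[uS' vS' uv]]|[]/mem_pairs[uS' vS' h]].
  - by case: (free_adjoin_uniq eH bM fE) => h; [left|right]; apply/mem_pairs.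
  - have [|aE uv] := ok _ _ h; first by left.
    by split; [apply/eqP|apply/mem_all].
  - have [|aE uv] := ok _ _ h; first by right.
    by split; [apply/eqP|apply/mem_all].
have EV j : {subset EE j <= VV} by move=> u /memEE[uE uc _]; apply/memVV.
have fM S : {subset S <= VV} -> {in all S, forall uv, f uv \in Ms}.
  move=> SV [u v] /mem_all[uS vS uv]; rewrite mem_undup; apply: map_f; apply/mem_all.
  by split=> //; exact: SV.
rewrite -[(_ * _)%N in RHS]size_all // (size_fibers (undup_uniq _) (fM VV _)) //.
have -> : (\sum_(j < k) nedges H P j * (nedges H P j).-1 =
    \sum_(M <- Ms) \sum_(j < k) count (fun uv => f uv == M) (all (EE j)))%N.
  rewrite exchange_big; apply: eq_bigr => j _.
  by rewrite -(size_fibers (undup_uniq _) (fM _ (EV j))) -size_all //; exact: undup_uniq.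
rewrite -[(2 * size Ms)%N]addn0 -iter_addn -count_predT -big_const_seq -big_split.
apply: eq_big_seq => M /fib[g [gE gE' gS]]; rewrite gS // gE gE' /=.
rewrite (eq_bigr (fun j => (size (dcoset_pairs (EE j) g) + size (dcoset_pairs (EE j) g^-1))%N)) => [|j _].
  by rewrite big_split /= [RHS]addSn [in RHS]addnS add2n.
by rewrite gS ?undup_uniq //; exact: EV.
Qed.

End ImmediateExtensions.

(** * Expansions in powers of [1 / n] *)

Section Expansions.
Variable R : realType.
Local Open Scope classical_set_scope.
Local Open Scope ring_scope.
Implicit Types (f g : nat -> R) (a b c : nat -> int).

Let partial a (n m : nat) : R := series (fun i => (a i)%:~R / n%:R ^+ i : R) m.

Definition expands f a := \forall n \near \oo,
  series (fun i => (a i)%:~R / n%:R ^+ i : R) @ \oo --> f n.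

Lemma near_ooP (P : nat -> Prop) : (\forall n \near \oo, P n) <-> exists N, forall n, (N <= n)%N -> P n.
Proof. by split=> [[N _ h]|[N h]]; exists N. Qed.

Lemma expandsP f a : expands f a <-> exists N, forall n, (N <= n)%N -> partial a n @ \oo --> f n.
Proof. exact: near_ooP. Qed.

Let partialS a n m : partial a n m.+1 = partial a n m + (a m)%:~R / n%:R ^+ m.
Proof. by rewrite /partial seriesSr. Qed.

Let partial0 a n : partial a n 0 = 0.
Proof. by rewrite /partial /series /= big_geq. Qed.

Lemma expands_near f g a : (\forall n \near \oo, f n = g n) -> expands f a -> expands g a.
Proof.
move=> /near_ooP[N fg] /expandsP[M fa]; apply/expandsP; exists (maxn N M) => n.
by rewrite geq_max => /andP[Nn Mn]; rewrite -fg //; exact: fa.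
Qed.

Lemma expandsD f g a b : expands f a -> expands g b -> expands (fun n => f n + g n) (fun i => a i + b i).
Proof.
move=> /expandsP[N fa] /expandsP[M gb]; apply/expandsP; exists (maxn N M) => n.
rewrite geq_max => /andP[Nn Mn].
have -> : partial (fun i => a i + b i) n = partial a n \+ partial b n.
  apply/funext; elim=> [|m IH] /=; first by rewrite !partial0 addr0.
  by rewrite !partialS IH /= rmorphD mulrDl addrACA.
exact: cvgD (fa _ Nn) (gb _ Mn).
Qed.

Lemma expandsN f a : expands f a -> expands (fun n => - f n) (fun i => - a i).
Proof.
move=> /expandsP[N fa]; apply/expandsP; exists N => n Nn.
have -> : partial (fun i => - a i) n = \- partial a n.
  apply/funext; elim=> [|m IH] /=; first by rewrite !partial0 oppr0.
  by rewrite !partialS IH /= rmorphN mulNr opprD.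
exact: cvgN (fa _ Nn).
Qed.

Lemma expands0 : expands (fun=> 0) (fun=> 0).
Proof.
apply/expandsP; exists 0%N => n _.
have -> : partial (fun=> 0) n = cst 0.
  by apply/funext; elim=> [|m IH] /=; rewrite ?partial0 // partialS IH /= mul0r addr0.
exact: cvg_cst.
Qed.

Lemma expands_sum (T : finType) (P : pred T) (f : T -> nat -> R) (a : T -> nat -> int) :
  (forall t, P t -> expands (f t) (a t)) ->
  expands (fun n => \sum_(t | P t) f t n) (fun i => \sum_(t | P t) a t i).
Proof.
move=> fa; pose S s n := \sum_(t <- s | P t) f t n; pose A s i := \sum_(t <- s | P t) a t i.
suff h s : expands (S s) (A s) by exact: h.
elim: s => [|t s IH].
  have -> : S [::] = (fun=> 0) by apply/funext => n; rewrite /S big_nil.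
  have -> : A [::] = (fun=> 0) by apply/funext => i; rewrite /A big_nil.
  exact: expands0.
case: (boolP (P t)) => Pt.
  have -> : S (t :: s) = (fun n => f t n + S s n) by apply/funext => n; rewrite /S big_cons Pt.
  have -> : A (t :: s) = (fun i => a t i + A s i) by apply/funext => i; rewrite /A big_cons Pt.
  by apply: expandsD => //; apply: fa.
have -> : S (t :: s) = S s by apply/funext => n; rewrite /S big_cons (negbTE Pt).
have -> // : A (t :: s) = A s by apply/funext => i; rewrite /A big_cons (negbTE Pt).
Qed.

Lemma expands1 : expands (fun=> 1) (fun i => (i == 0%N)%:Z).
Proof.
apply/expandsP; exists 0%N => n _; rewrite -cvg_shiftS /=.
have -> : (fun m => partial (fun i => (i == 0%N)%:Z) n m.+1) = cst 1.
  apply/funext; elim=> [|m IH] /=; rewrite partialS ?IH ?partial0 /= ?mul0r ?addr0 //.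
  by rewrite add0r expr0 divr1.
exact: cvg_cst.
Qed.

Definition shift_coef a (i : nat) : int := if i is i'.+1 then a i' else 0.

Lemma expands_shift f a : expands f a -> expands (fun n => f n / n%:R) (shift_coef a).
Proof.
move=> /expandsP[N fa]; apply/expandsP; exists N.+1 => n Nn; rewrite -cvg_shiftS /=.
have n0 : n%:R != 0 :> R by rewrite pnatr_eq0 -lt0n (leq_trans _ Nn).
have -> : (fun m => partial (shift_coef a) n m.+1) = (fun m => partial a n m * n%:R^-1).
  apply/funext; elim=> [|m IH] /=; first by rewrite partialS !partial0 /= mul0r addr0 mul0r.
  by rewrite partialS IH partialS mulrDl /= exprSr invfM mulrA.
by apply: cvgMr_tmp; apply: fa; rewrite ltnW.
Qed.

Let partial_mul a b (l n m : nat) : (0 < n)%N -> b 0%N = a 0%N ->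
  (forall i, b i.+1 = a i.+1 - l%:Z * a i) ->
  partial b n m.+1 = partial a n m.+1 - l%:R / n%:R * partial a n m.
Proof.
move=> n0 b0 bS; elim: m => [|m IH]; first by rewrite !partialS !partial0 b0 mulr0 subr0.
rewrite partialS IH bS [in RHS]partialS [X in _ = _ - _ * X]partialS.
rewrite rmorphB rmorphM /= mulrDr mulrBl opprD addrACA; congr (_ + _); congr (_ - _).
by rewrite exprS invfM mulrACA.
Qed.

Definition mul_coef (l : nat) a (i : nat) : int := if i is i'.+1 then a i - l%:Z * a i' else a 0%N.

Lemma expands_mul l f a : expands f a -> expands (fun n => f n * (1 - l%:R / n%:R)) (mul_coef l a).
Proof.
move=> /expandsP[N fa]; apply/expandsP; exists N.+1 => n Nn; rewrite -cvg_shiftS /=.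
have n0 : (0 < n)%N by rewrite (leq_trans _ Nn).
have -> : (fun m => partial (mul_coef l a) n m.+1) =
    (fun m => partial a n m.+1) - (fun m => l%:R / n%:R * partial a n m).
  by apply/funext => m; rewrite (@partial_mul a _ l).
have fan : partial a n @ \oo --> f n by apply: fa; rewrite ltnW.
rewrite mulrBr mulr1 [f n * _]mulrC; apply: cvgB; last exact: cvgMl_tmp.
by rewrite -cvg_shiftS in fan.
Qed.

Lemma normr_div_exp (x : R) (n i : nat) : `|x / n%:R ^+ i| = `|x| / n%:R ^+ i.
Proof. by rewrite normrM normfV (ger0_norm (exprn_ge0 _ _)). Qed.

(** Convergence at the single point [N.+1] bounds the terms there, so the coefficients grow at most
    geometrically. *)
Lemma expands_bound f a : expands f a -> exists (N : nat) (C : R),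
  [/\ (0 < N)%N, 0 <= C & forall i, `|(a i)%:~R| <= C * N%:R ^+ i].
Proof.
move=> /expandsP[N fa]; have := fa N.+1 (leqnSn N) => faN.
have h : (fun i => (a i)%:~R / N.+1%:R ^+ i : R) @ \oo --> 0.
  by apply: cvg_series_cvg_0; apply/cvg_ex; exists (f N.+1).
have [C C0 Ca] : exists2 C, 0 < C & forall i, `|(a i)%:~R / N.+1%:R ^+ i : R| <= C.
  have : bounded_fun (fun i => (a i)%:~R / N.+1%:R ^+ i : R).
    by apply: cvg_seq_bounded; apply/cvg_ex; exists 0.
  by move/ex_strict_bound_gt0 => [C C0 Ca]; exists C => // i; apply/ltW/Ca.
exists N.+1, C; split=> // [|i]; first exact: ltW.
have := Ca i; rewrite normr_div_exp.
by rewrite ler_pdivrMr // exprn_gt0.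
Qed.

(** Solves [b i.+1 - l * b i = a i.+1], so that multiplication by [1 - l / n] gives back [a]; the
    coefficients remain integers. *)
Fixpoint div_coef (l : nat) a (i : nat) : int :=
  if i is i'.+1 then a i + l%:Z * div_coef l a i' else a 0%N.

(** The point is convergence: coefficients bounded by [C * (N + l)^i] are summable for [n > N + l].
    The sum is then identified by multiplying back. *)
Lemma expands_div l f a : expands f a -> expands (fun n => f n / (1 - l%:R / n%:R)) (div_coef l a).
Proof.
move=> fa; have [N [C [N0 C0 Ca]]] := expands_bound fa; set b := div_coef l a.
have Cb i : `|(b i)%:~R| <= C * (N + l)%:R ^+ i.
  elim: i => [|i IH]; first by have := Ca 0%N; rewrite !expr0.
  rewrite /b /= rmorphD rmorphM /= (le_trans (ler_normD _ _)) //.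
  rewrite exprSr mulrA natrD mulrDr; apply: lerD.
    rewrite (le_trans (Ca _)) // exprSr mulrA ler_wpM2r // ler_wpM2l // lerXn2r ?nnegrE //.
    by rewrite -natrD ler_nat leq_addr.
  rewrite normrM [X in X * _]ger0_norm ?ler0z // mulrC; apply: ler_wpM2r => //.
  by rewrite -natrD.
move: fa => /expandsP[M fa]; apply/expandsP; exists (M + (N + l)).+1 => n Mn.
have n0 : (0 < n)%N by lia.
have Nln : (N + l < n)%N by lia.
have n0' : 0 < n%:R :> R by rewrite ltr0n.
have cb : cvgn (partial b n).
  apply: normed_cvg; apply: (@series_le_cvg _ _ (geometric C ((N + l)%:R / n%:R))) => [i|i|i|].
  - exact: normr_ge0.
  - by rewrite /geometric /= mulr_ge0 // exprn_ge0 // divr_ge0.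
  - rewrite /geometric /= normr_div_exp.
    by rewrite expr_div_n mulrA ler_wpM2r // invr_ge0 exprn_ge0.
  apply: is_cvg_geometric_series; rewrite ger0_norm ?divr_ge0 //.
  by rewrite ltr_pdivrMr // mul1r ltr_nat.
move: cb => /cvg_ex[/= be bbe].
have ln0 : 1 - l%:R / n%:R != 0 :> R.
  rewrite subr_eq0 eq_sym; apply/eqP => /(congr1 (fun x => x * n%:R)).
  rewrite mul1r mulfVK ?gt_eqF // => /eqP; rewrite eqr_nat => /eqP; lia.
suff -> : f n / (1 - l%:R / n%:R) = be by [].
apply: (mulIf ln0); rewrite mulfVK //.
have fan : partial a n @ \oo --> f n by apply: fa; lia.
have ab : partial a n @ \oo --> be * (1 - l%:R / n%:R).
  rewrite -cvg_shiftS /=.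
  have -> : (fun m => partial a n m.+1) =
      (fun m => partial b n m.+1) - (fun m => l%:R / n%:R * partial b n m).
    by apply/funext => m; rewrite (@partial_mul b a l) // => i; rewrite /b /= addrK.
  rewrite mulrBr mulr1 [be * _]mulrC; apply: cvgB; last exact: cvgMl_tmp.
  by rewrite -cvg_shiftS in bbe.
exact: (cvg_unique (@norm_hausdorff _ R) fan ab).
Qed.

(** A first nonzero coefficient, being an integer, has absolute value at least 1, whereas the
    vanishing sum bounds it by [n^i] times the tail, which is [O(1 / n)]. *)
Lemma expands_uniq0 c : expands (fun=> 0) c -> forall i, c i = 0.
Proof.
move=> c0; have [N [C [N0 C0 Cc]]] := expands_bound c0.
apply: ltn_ind => i IH; apply/eqP; rewrite -[_ == 0]negbK; apply/negP => ci.
have ci1 : 1 <= `|(c i)%:~R| :> R.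
  by rewrite -intr_norm (ler_int R 1) -gtz0_ge1 normr_gt0.
move: c0 => /expandsP[M cM].
have [K CK] : exists K : nat, C * 2 * N%:R ^+ i.+1 < K%:R.
  by exists (Num.bound (C * 2 * N%:R ^+ i.+1)); apply: archi_boundP; rewrite !mulr_ge0 // exprn_ge0.
(* [n >= M] gives convergence to 0, [n >= 2 N] the ratio [q <= 1/2], and [n >= K] the
   contradiction. *)
pose n := (M + N + N + K)%N.
have n0 : (0 < n)%N by rewrite /n; lia.
have n0' : 0 < n%:R :> R by rewrite ltr0n.
pose q : R := N%:R / n%:R.
have q0 : 0 <= q by rewrite divr_ge0.
have q2 : 2 * q <= 1.
  by rewrite /q mulrA ler_pdivrMr // mul1r -natrM ler_nat /n; lia.
(* The factor 2 makes the bound telescope: for [q <= 1/2] a further term [q^j] is at most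
   [2 (q^j - q^(j+1))]. *)
have tail m : `|partial c n (i.+1 + m) - (c i)%:~R / n%:R ^+ i| <= C * 2 * (q ^+ i.+1 - q ^+ (i.+1 + m)).
  elim: m => [|m IHm].
    rewrite addn0 subrr mulr0 partialS.
    have -> : partial c n i = 0.
      have : forall j, (j <= i)%N -> partial c n j = 0.
        elim=> [|j IHj] ji; first exact: partial0.
        by rewrite partialS IHj ?(ltnW ji) // IH // mul0r addr0.
      exact.
    by rewrite add0r subrr normr0.
  rewrite addnS partialS addrAC (le_trans (ler_normD _ _)) //.
  apply: (@le_trans _ _ (C * 2 * (q ^+ i.+1 - q ^+ (i.+1 + m)) + C * q ^+ (i.+1 + m))).
    apply: lerD => //; rewrite normr_div_exp.
    by rewrite /q expr_div_n mulrA ler_wpM2r // invr_ge0 exprn_ge0.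
  rewrite -mulrA -mulrDr -[leRHS]mulrA; apply: ler_wpM2l => //.
  rewrite !mulrBr -addrA lerD2l exprSr.
  set x := q ^+ (i.+1 + m); have x0 : 0 <= x by rewrite exprn_ge0.
  rewrite [X in - X + _]mulr_natl mulr2n opprD subrK lerN2.
  by rewrite mulrCA -[leRHS]mulr1; apply: ler_wpM2l.
have lim0 : (fun m => `|partial c n (i.+1 + m) - (c i)%:~R / n%:R ^+ i|) @ \oo --> (`|0 - (c i)%:~R / n%:R ^+ i| : R).
  apply: cvg_norm; apply: cvgB; last exact: cvg_cst.
  have := cM n; rewrite -(cvg_shiftn i.+1) /=; under eq_fun do rewrite addnC.
  by apply; rewrite /n; lia.
have : `|0 - (c i)%:~R / n%:R ^+ i| <= C * 2 * q ^+ i.+1.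
  rewrite -(cvg_lim _ lim0) //; apply: limr_le; first by apply/cvg_ex; eexists; exact: lim0.
  apply: nearW => m; apply: le_trans (tail m) _.
  by rewrite ler_wpM2l ?mulr_ge0 // gerBl exprn_ge0.
rewrite sub0r normrN normr_div_exp.
rewrite ler_pdivrMr ?exprn_gt0 // /q expr_div_n -!mulrA.
have -> : (n%:R ^+ i.+1)^-1 * n%:R ^+ i = n%:R^-1 :> R.
  by rewrite exprS invfM mulfVK // expf_neq0 // gt_eqF.
move=> h; have := le_trans ci1 h; rewrite !mulrA ler_pdivlMr // mul1r.
apply/negP; rewrite -ltNge (lt_le_trans CK) // ler_nat /n; lia.
Qed.

Lemma expands_uniq f a b : expands f a -> expands f b -> a = b.
Proof.
move=> fa fb; apply/funext => i; apply/eqP; rewrite -subr_eq0; apply/eqP.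
apply: (@expands_uniq0 (fun i => a i - b i) _ i).
apply: expands_near (expandsD fa (expandsN fb)).
by apply/near_ooP; exists 0%N => n _; rewrite subrr.
Qed.

End Expansions.

(** * The first two coefficients of products and quotients *)

Section LeadingTerms.
Variable R : realType.
Local Open Scope ring_scope.

(** The shape [n^-d (1 + c / n + ...)]. *)
Definition leads (f : nat -> R) (d : nat) (c : int) (a : nat -> int) :=
  [/\ expands f a, forall i, (i < d)%N -> a i = 0, a d = 1 & a d.+1 = c].

Definition has_lead f d c := exists a, leads f d c a.

Lemma has_lead1 : has_lead (fun=> 1) 0 0.
Proof. by exists (fun i => (i == 0%N)%:Z); split=> //; exact: expands1. Qed.

Lemma has_lead_shift f d c : has_lead f d c -> has_lead (fun n => f n / n%:R) d.+1 c.
Proof.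
move=> [a [fa a0 ad ac]]; exists (shift_coef a); split=> //; first exact: expands_shift.
by case=> // i; exact: a0.
Qed.

Lemma has_lead_mul l f d c : has_lead f d c ->
  has_lead (fun n => f n * (1 - l%:R / n%:R)) d (c - l%:Z).
Proof.
move=> [a [fa a0 ad ac]]; exists (mul_coef l a); split; first exact: expands_mul.
- case=> [|i] id /=; first exact: a0.
  by rewrite !a0 ?mulr0 ?subr0 // ltnW.
- by case: d a0 ad {ac} => //= d a0 ->; rewrite a0 // mulr0 subr0.
- by rewrite /= ac ad mulr1.
Qed.

Lemma has_lead_div l f d c : has_lead f d c ->
  has_lead (fun n => f n / (1 - l%:R / n%:R)) d (c + l%:Z).
Proof.
move=> [a [fa a0 ad ac]]; exists (div_coef l a).
have b0 i : (i < d)%N -> div_coef l a i = 0.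
  elim: i => [|i IH] id /=; first exact: a0.
  by rewrite a0 // IH ?mulr0 // ltnW.
have bd : div_coef l a d = 1.
  by case: d a0 ad b0 {ac} => //= d _ -> b0; rewrite b0 // mulr0 addr0.
by split=> //; [exact: expands_div|rewrite /= ac bd mulr1].
Qed.

Lemma eq_has_lead f g d c : f =1 g -> has_lead f d c -> has_lead g d c.
Proof. by move=> /funext ->. Qed.

(** To first order the factors [1 - l / n] add up: a numerator factor subtracts [l] and a
    denominator factor adds it. *)
Lemma has_lead_prod d (ls ds : seq nat) :
  has_lead (fun n => (n%:R ^+ d)^-1 * (\prod_(l <- ls) (1 - l%:R / n%:R)) /
    \prod_(l <- ds) (1 - l%:R / n%:R)) d ((sumn ds)%:Z - (sumn ls)%:Z).
Proof.
have h1 : has_lead (fun n => (n%:R ^+ d)^-1) d 0.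
  elim: d => [|d IH]; first by apply: eq_has_lead has_lead1 => n; rewrite expr0 invr1.
  by apply: eq_has_lead (has_lead_shift IH) => n; rewrite exprSr invfM.
have h2 : has_lead (fun n => (n%:R ^+ d)^-1 * (\prod_(l <- ls) (1 - l%:R / n%:R))) d (- (sumn ls)%:Z).
  elim: ls => [|l ls IH]; first by apply: eq_has_lead h1 => n; rewrite big_nil mulr1.
  have := has_lead_mul l IH; rewrite -opprD addrC -PoszD; apply: eq_has_lead => n.
  by rewrite big_cons mulrCA [RHS]mulrC.
elim: ds => [|l ds IH]; first by rewrite sub0r; apply: eq_has_lead h2 => n; rewrite big_nil divr1.
have := has_lead_div l IH; rewrite addrAC -PoszD addnC; apply: eq_has_lead => n.
by rewrite big_cons invfM -[LHS]mulrA; congr (_ * _); exact: mulrC.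
Qed.

Lemma ffact_ratio (m E : nat) : (0 < m)%N -> (E <= m)%N ->
  (m ^_ E)%:R = m%:R ^+ E * \prod_(l <- iota 0 E) (1 - l%:R / m%:R) :> R.
Proof.
move=> m0; elim: E => [|E IH] Em; first by rewrite big_nil expr0 mulr1.
rewrite ffactnSr natrM IH ?(ltnW Em) // -addn1 iotaD big_cat big_seq1 /= add0n addn1 exprSr.
rewrite -!mulrA; congr (_ * _); rewrite mulrCA; congr (_ * _).
rewrite natrB ?(ltnW Em) // mulrBr mulr1 mulrCA divff ?mulr1 //.
by rewrite pnatr_eq0 -lt0n.
Qed.

(** The exponent [d = E - V + 1] collects the powers of [n.+1]: [V - 1] from labelling the vertices
    other than the root, against [E] from the constrained values of the permutations. *)
Lemma count_ratio (k n V d : nat) (E : 'I_k -> nat) : (0 < V)%N -> (V <= n.+1)%N ->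
  (forall j, E j <= n.+1)%N -> (d + V = (\sum_j E j).+1)%N ->
  (n ^_ V.-1 * \prod_(j < k) (n.+1 - E j)`!)%N%:R / (n.+1`! ^ k)%N%:R =
  (n.+1%:R ^+ d)^-1 * (\prod_(l <- iota 0 V) (1 - l%:R / n.+1%:R)) /
    \prod_(l <- flatten [seq iota 0 (E j) | j <- enum 'I_k]) (1 - l%:R / n.+1%:R) :> R.
Proof.
move=> V0 Vn En dV; set m := n.+1 in Vn En *.
have m0 : m%:R != 0 :> R by rewrite pnatr_eq0.
have f0 : (m`!)%:R != 0 :> R by rewrite pnatr_eq0 -lt0n fact_gt0.
have VE : (n ^_ V.-1)%:R = m%:R ^+ V / m%:R * \prod_(l <- iota 0 V) (1 - l%:R / m%:R) :> R.
  apply: (mulfI m0); rewrite -natrM -ffactSS prednK // ffact_ratio //.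
  by rewrite !mulrA [m%:R * _ / _]mulrAC mulfV // mul1r.
have PE : (\prod_(j < k) (m - E j)`!)%N%:R / (m`! ^ k)%N%:R =
    (\prod_(j < k) (m%:R ^+ E j * \prod_(l <- iota 0 (E j)) (1 - l%:R / m%:R)))^-1 :> R.
  rewrite natrX -[k in _ ^+ k]card_ord -prodr_const natr_prod -prodfV -big_split -prodfV /=.
  apply: eq_bigr => j _; rewrite -ffact_ratio //.
  have -> : (m`!)%:R = (m ^_ E j)%:R * ((m - E j)`!)%:R :> R by rewrite -natrM ffact_fact.
  by rewrite invfM mulrCA mulfV ?mulr1 // pnatr_eq0 -lt0n fact_gt0.
rewrite natrM -mulrA PE VE big_split /= prodrXr invfM !mulrA; congr (_ / _); last first.
  by rewrite big_flatten big_map big_enum.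
rewrite mulrAC; congr (_ * _).
have mk (i : nat) : m%:R ^+ i != 0 :> R by rewrite expf_neq0.
apply: (mulfI (mk d)); rewrite mulfV // !mulrA -exprD dV exprS [m%:R * _]mulrC.
by rewrite mulfK // mulfV.
Qed.

End LeadingTerms.

(** * The probability of fixing a point *)

Section FixingProbability.
Local Open Scope classical_set_scope.
Local Open Scope group_scope.
Variable k : nat.
Local Notation F := (free_group 'I_k).

Lemma card_fset_set_finset (T : choiceType) (U : finType) (h : U -> T) (A : {set U}) (B : set T) :
  injective h -> (forall x, B x <-> exists2 a, a \in A & h a = x) -> #|` fset_set B| = #|A|.
Proof.
move=> hi BA.
have BE : B = h @` [set` A] by apply/seteqP; split=> x; rewrite BA => -[a aA <-]; exists a.
have fB : finite_set B by rewrite BE; apply: finite_image; exact: finite_finset.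
have -> : fset_set B = [fset h a | a in A]%fset.
  apply/fsetP => x; rewrite in_fset_set //; apply/idP/imfsetP => [|[a aA ->]] /=.
    by rewrite inE => /BA[a aA <-]; exists a.
  by rewrite inE; apply/BA; exists a.
by rewrite card_imfset //= cardE.
Qed.

Lemma hom_fun_inj n : injective (fun a : {ffun 'I_k -> 'S_n} => fg_eval a : F -> 'S_n).
Proof.
by move=> a b ab; apply/ffunP => j; rewrite -(fg_eval_gen a) -(fg_eval_gen b) ab.
Qed.

Lemma homsE n (f : F -> 'S_n) : homs k n f -> exists a : {ffun 'I_k -> 'S_n}, fg_eval a = f.
Proof.
move=> fM; exists [ffun j => f (fg_gen j)]; apply/funext => u.
by rewrite (fg_morphE fM); apply: eq_bigr => x _; rewrite ffunE.
Qed.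

Lemma card_homs n : #|` fset_set (homs k n)| = (n`! ^ k)%N.
Proof.
rewrite (@card_fset_set_finset _ _ _ [set: {ffun 'I_k -> 'S_n}]%SET _ (@hom_fun_inj n)).
  by rewrite cardsT card_ffun card_Sn card_ord.
move=> f; split=> [/homsE[a <-]|[a _ <-]]; first by exists a; rewrite ?inE.
exact: fg_evalM.
Qed.

Variables (H : set F) (P : seq F).
Hypotheses (sH : is_subgroup H) (tP : tree P) (HP : span H P = H).
Let N := size P.

(* A pattern records which pairs of words of [P] are identified; the relevant
   ones come from the subgroups containing [H]. *)
Definition over_pattern (E : {set 'I_N * 'I_N}) : bool :=
  `[< exists M, [/\ is_subgroup M, H `<=` M & E = coset_pattern M P] >].

(** Recovers [span M P] from the pattern of [M], so that patterns stand for the subgroups generated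
    over the tree. *)
Definition pattern_subgroup (E : {set 'I_N * 'I_N}) : set F :=
  subgroup_generated [set z | exists i j, (i, j) \in E /\ z = nth 1 P i * (nth 1 P j)^-1].

Lemma pattern_subgroupE M : pattern_subgroup (coset_pattern M P) = span M P.
Proof.
congr subgroup_generated; apply/seteqP; split=> z.
  move=> [i [j [/mem_coset_pattern Mz ->]]]; split=> //.
  by exists (nth 1 P i), (nth 1 P j); rewrite !mem_nth.
move=> [Mz [u [v [uP vP zE]]]].
have iP : (index u P < size P)%N by rewrite index_mem.
have jP : (index v P < size P)%N by rewrite index_mem.
exists (Ordinal iP), (Ordinal jP); split; last by rewrite /= !nth_index.
by apply/coset_patternP; rewrite -zE.
Qed.

Lemma coset_pattern_span M : is_subgroup M -> coset_pattern (span M P) P = coset_pattern M P.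
Proof.
move=> sM; apply/setP => -[i j]; apply/idP/idP => /mem_coset_pattern h; apply/mem_coset_pattern.
  exact: (span_sub sM h).
by apply: mem_span; rewrite ?mem_nth.
Qed.

Lemma over_patternP E : over_pattern E ->
  let M := pattern_subgroup E in
  [/\ is_subgroup M, H `<=` M, span M P = M & E = coset_pattern M P].
Proof.
move=> /asboolP[J [sJ HJ ->]]; rewrite pattern_subgroupE /=; split.
- exact: span_subgroup.
- by rewrite -HP; exact: span_mono_l.
- exact: span_span.
- by rewrite coset_pattern_span.
Qed.

Lemma pattern_over M : is_subgroup M -> H `<=` M -> span M P = M ->
  over_pattern (coset_pattern M P) /\ pattern_subgroup (coset_pattern M P) = M.
Proof. by move=> sM HM MP; split; [apply/asboolP; exists M|rewrite pattern_subgroupE]. Qed.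

(** The orbit pattern is the coset pattern of the stabiliser of 0. It lies over [H] exactly when the
    stabiliser contains [H], as [H] is generated by quotients of words of [P]. *)
Lemma card_fixing_homs n : #|` fset_set (fixing_homs k n.+1 H)| =
  (\sum_(E | over_pattern E) (n ^_ (ncosets (pattern_subgroup E) P).-1 *
     \prod_(j < k) (n.+1 - nedges (pattern_subgroup E) P j)`!))%N.
Proof.
rewrite (@card_fset_set_finset _ _ _ [set a | over_pattern (orbit_pattern P a)]%SET _ (@hom_fun_inj n.+1)).
  rewrite -sum1_card (partition_big (fun a => orbit_pattern P a) over_pattern) /=; last by move=> a; rewrite inE.
  apply: eq_bigr => E oE; have [sM HM MP EM] := over_patternP oE.
  rewrite -card_orbit_pattern // -EM -sum1_card; apply: eq_bigl => a; rewrite !inE.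
  by case: eqP => [->|]; rewrite ?andbF // oE.
have stab a : is_subgroup [set w | orbit_pt (n := n) a w = ord0].
  apply/is_subgroupP; split=> [|u v /= ua va|u /= ua]; rewrite /orbit_pt.
  - by rewrite /= fg_eval1 perm1.
  - by rewrite fg_evalM permM -/(orbit_pt a u) ua.
  - by rewrite fg_evalV -{1}ua permK.
have stabE a u v : orbit_pt (n := n) a u = orbit_pt a v <-> orbit_pt a (u * v^-1) = ord0.
  rewrite /orbit_pt fg_evalM permM fg_evalV; split=> [->|h]; first by rewrite permK.
  by apply: (@perm_inj _ (fg_eval a v)^-1); rewrite h permK.
have patE a : orbit_pattern P a = coset_pattern [set w | orbit_pt (n := n) a w = ord0] P.
  by apply/eqP/orbit_patternP => u v _ _; exact: stabE.
have fixE a : over_pattern (orbit_pattern P a) <-> (H `<=` [set w | orbit_pt (n := n) a w = ord0]).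
  split=> [|h]; last by apply/asboolP; exists [set w | orbit_pt (n := n) a w = ord0].
  move=> /asboolP[M [sM HM aM]]; rewrite -HP; apply: span_min => // u v uP vP uv.
  apply/stabE; have /orbit_patternP aM' : orbit_pattern P a == coset_pattern M P by apply/eqP.
  by apply/(aM' u v uP vP); exact: HM.
move=> f; split=> [[/homsE[a <-] fH]|[a]].
  exists a => //; rewrite inE; apply/fixE => w Hw; exact: fH.
rewrite inE => /fixE aH <-; split=> [|w Hw i i0]; first exact: fg_evalM.
have -> : i = ord0 by exact: val_inj.
exact: aH.
Qed.

Variables (R : realType) (r : nat) (e : 'I_r -> F).
Hypothesis eH : free_basis H e.

Local Open Scope ring_scope.

(** By the rank formula the truncated subtraction is exact on patterns over [H]. *)
Definition pattern_rank (E : {set 'I_N * 'I_N}) : nat :=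
  ((\sum_(j < k) nedges (pattern_subgroup E) P j).+1 - ncosets (pattern_subgroup E) P)%N.

Lemma pattern_rankE E : over_pattern E ->
  (pattern_rank E + ncosets (pattern_subgroup E) P = (\sum_(j < k) nedges (pattern_subgroup E) P j).+1)%N /\
  free_rank (pattern_subgroup E) = Some (pattern_rank E).
Proof.
move=> /over_patternP[sM HM MP EM]; have [m [f [fM mE]]] := span_basis sM tP.
rewrite MP in fM; rewrite /pattern_rank -mE addnK; split=> //.
exact: free_rank_basis fM.
Qed.

Let triangle (V : nat) : int := (sumn (iota 0 V))%:Z.

(** Summing the expansions of all patterns gives an expansion of [Phi]; by uniqueness it is the one
    selected in [Phi_coef]. *)
Lemma Phi_leads : exists a : {set 'I_N * 'I_N} -> nat -> int,
  (forall E, over_pattern E -> [/\ forall i, (i < pattern_rank E)%N -> a E i = 0,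
      a E (pattern_rank E) = 1 &
      a E (pattern_rank E).+1 =
        (\sum_(j < k) triangle (nedges (pattern_subgroup E) P j)) -
        triangle (ncosets (pattern_subgroup E) P)])
  /\ Phi_coef R H = (fun i => \sum_(E | over_pattern E) a E i - (i == r)%:Z).
Proof.
pose ds (E : {set 'I_N * 'I_N}) := flatten [seq iota 0 (nedges (pattern_subgroup E) P j) | j <- enum 'I_k].
pose fE (E : {set 'I_N * 'I_N}) (n : nat) : R :=
  (n%:R ^+ pattern_rank E)^-1 * (\prod_(l <- iota 0 (ncosets (pattern_subgroup E) P)) (1 - l%:R / n%:R)) /
    \prod_(l <- ds E) (1 - l%:R / n%:R).
pose c (E : {set 'I_N * 'I_N}) : int := (sumn (ds E))%:Z - triangle (ncosets (pattern_subgroup E) P).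
pose a E := xget (fun=> 0) [set a | leads (fE E) (pattern_rank E) (c E) a].
have aP E : leads (fE E) (pattern_rank E) (c E) (a E).
  have [a' a'P] := has_lead_prod R (pattern_rank E) (iota 0 (ncosets (pattern_subgroup E) P)) (ds E).
  by apply: (@xgetPex _ (fun=> 0) [set a | leads (fE E) (pattern_rank E) (c E) a]); exists a'.
have rE : expands (fun n => (n%:R ^+ r)^-1 : R) (fun i => (i == r)%:Z).
  elim: r => [|r' IH].
    by apply: (expands_near _ (expands1 R)); apply/near_ooP; exists 0%N => n _; rewrite expr0 invr1.
  have -> : (fun i => (i == r'.+1)%:Z) = shift_coef (fun i => (i == r')%:Z).
    by apply/funext => -[|i] //=; rewrite eqSS.
  apply: (expands_near _ (expands_shift IH)).
  by apply/near_ooP; exists 0%N => n _; rewrite exprSr invfM.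
exists a; split=> [E _|].
  have [_ a0 a1 ac] := aP E; split=> //; rewrite ac /c; congr (_ - _).
  rewrite /ds /triangle sumn_flatten -map_comp sumnE big_map big_enum /=.
  exact: (big_morph Posz PoszD).
have PhiE : expands (@Phi R k H) (fun i => \sum_(E | over_pattern E) a E i - (i == r)%:Z).
  have aE E : over_pattern E -> expands (fE E) (a E) by have [] := aP E.
  apply: expands_near (expandsD (expands_sum aE) (expandsN rE)).
  (* Beyond the sum of all vertex and edge counts no falling factorial vanishes and no subtraction
     is truncated. *)
  apply/near_ooP; exists (\sum_(E | over_pattern E) (ncosets (pattern_subgroup E) P +
     \sum_(j < k) nedges (pattern_subgroup E) P j)).+1%N => -[//|n] Nn.
  rewrite /Phi (free_rank_basis eH) card_homs card_fixing_homs natr_sum mulr_suml.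
  congr (_ - _); apply/esym/eq_bigr => E oE; have [rkE _] := pattern_rankE oE.
  have le : (ncosets (pattern_subgroup E) P + \sum_(j < k) nedges (pattern_subgroup E) P j <= n.+1)%N.
    by rewrite (leq_trans _ (ltnW Nn)) // (bigD1 E) //= leq_addr.
  apply: count_ratio => //.
  - exact: ncosets_gt0.
  - exact: leq_trans (leq_addr _ _) le.
  - move=> j; apply: leq_trans (leq_trans (leq_addl _ _) le).
    by rewrite (bigD1 j) //= leq_addr.
rewrite /Phi_coef; apply: xget_unique => [|c1 c1P]; first exact: PhiE.
exact: (expands_uniq c1P PhiE).
Qed.

End FixingProbability.

Lemma Posz_sum (T : finType) (P : pred T) (f : T -> nat) :
  Posz (\sum_(t | P t) f t) = (\sum_(t | P t) Posz (f t))%R.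
Proof. exact: (big_morph Posz PoszD). Qed.

(** * Comparing patterns with the primitivity rank *)

Section PrimitivityRank.
Local Open Scope classical_set_scope.
Local Open Scope group_scope.
Variables (R : realType) (k : nat).
Local Notation F := (free_group 'I_k).
Variables (H : set F) (P : seq F) (r : nat) (e : 'I_r -> F).
Hypotheses (sH : is_subgroup H) (tP : tree P) (HP : span H P = H).
Hypothesis eH : free_basis H e.

Let pat := {set 'I_(size P) * 'I_(size P)}.
Let sub (E : pat) := pattern_subgroup E.
Let rk (E : pat) := pattern_rank E.
Let over (E : pat) := over_pattern H E.
Let nonfree (E : pat) := over E && ~~ `[< free_factor H (sub E) >].
Let E0 : pat := coset_pattern H P.

Let over_rk E : over E -> exists f : 'I_(rk E) -> F, free_basis (sub E) f.
Proof. by move=> /(pattern_rankE tP HP)[_ /free_rank_Some]. Qed.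

Let sub_inj : {in over &, injective sub}.
Proof.
move=> E E' /(over_patternP HP)[_ _ _ EE] /(over_patternP HP)[_ _ _ EE'] ss.
by rewrite EE EE' -[pattern_subgroup E]/(sub E) ss.
Qed.

Let over_E0 : over E0. Proof. by apply/asboolP; exists H; split. Qed.

Let sub_E0 : sub E0 = H.
Proof. by rewrite /sub /E0 pattern_subgroupE HP. Qed.

Let rk_E0 : rk E0 = r.
Proof.
have [f] := over_rk over_E0; rewrite sub_E0 => fH; exact: free_basis_rank_uniq fH eH.
Qed.

Let over_of M : is_subgroup M -> H `<=` M -> span M P = M -> exists2 E, over E & sub E = M.
Proof. by move=> sM HM MP; exists (coset_pattern M P); have [] := pattern_over sM HM MP. Qed.

Let ff_rk E : over E -> free_factor H (sub E) -> E <> E0 -> (r < rk E)%N.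
Proof.
move=> oE HE EE0; rewrite ltnNge; apply/negP => le; apply: EE0.
have [f fE] := over_rk oE; apply: sub_inj => //; rewrite sub_E0.
by rewrite -(free_factor_rank eH fE HE le).
Qed.

Let ffE0 : free_factor H (sub E0).
Proof. by rewrite sub_E0; exact: free_factor_refl eH. Qed.

(** [span J P] contains [H] and is a free factor of [J]; were [H] a free factor of it, [H] would be
    one of [J]. Its rank is at most that of [J], with equality only for [J] itself. *)
Lemma nonfree_extension_pattern J m : nonfree_extension H J -> free_rank J = Some m ->
  exists E, [/\ nonfree E, (rk E <= m)%N & rk E = m -> sub E = J].
Proof.
move=> [sJ HJ nJ] /free_rank_Some[g gJ]; pose J0 := span J P.
have HJ0 : H `<=` J0 by rewrite -HP; exact: span_mono_l.
have [m0 [f [fJ0 _]]] := span_basis sJ tP.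
have [Q [tQ gQ]] := tree_extend_all (codom g) tP.
have JQ : span J (Q ++ P) = J := span_generated (free_basis_generated gJ) tQ gQ.
have P0 : P != [::] by have := tree_one tP; case: (P).
have [n [f' [ff' _]]] := span_extension sJ tQ P0 fJ0; rewrite JQ in ff'.
have J0J : free_factor J0 J := basis_free_factor fJ0 ff'.
have nJ0 : ~ free_factor H J0.
  by move=> HJ0'; apply: nJ; exact: free_factor_trans eH fJ0 gJ HJ0' J0J.
have mE := free_basis_rank_uniq gJ ff'.
have [E oE EJ0] := over_of (span_subgroup J P) HJ0 (span_span P sJ).
have rkE : rk E = m0.
  have [f0] := over_rk oE; rewrite EJ0 => f0J; exact: free_basis_rank_uniq f0J fJ0.
exists E; split; first by rewrite /nonfree oE /= EJ0; apply/asboolP.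
  by rewrite rkE mE leq_addr.
by rewrite rkE EJ0 => m0m; apply: (free_factor_rank fJ0 gJ J0J); rewrite m0m.
Qed.

Lemma pattern_nonfree_extension E : nonfree E ->
  nonfree_extension H (sub E) /\ free_rank (sub E) = Some (rk E).
Proof.
move=> /andP[oE /asboolP nE]; have [sM HM _ _] := over_patternP HP oE.
by split=> //; have [_] := pattern_rankE tP HP oE.
Qed.

Lemma primitivity_rankP i : primitivity_rank H = Some i <->
  (exists2 E, nonfree E & rk E = i) /\ (forall E, nonfree E -> (i <= rk E)%N).
Proof.
split=> [/least_Some[[J [HJ Ji]] imin]|[[E nE Ei] imin]].
  have imin' E : nonfree E -> (i <= rk E)%N.
    by move=> /pattern_nonfree_extension[nE rE]; apply: imin; exists (sub E).
  split=> //; have [E [nE Ei _]] := nonfree_extension_pattern HJ Ji.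
  by exists E => //; apply/eqP; rewrite eqn_leq Ei imin'.
apply: least_eq; first by exists (sub E); rewrite -Ei; exact: pattern_nonfree_extension.
move=> m [J [HJ Jm]]; have [E' [nE' E'm _]] := nonfree_extension_pattern HJ Jm.
exact: leq_trans (imin _ nE') E'm.
Qed.

(** By minimality of the rank, critical subgroups equal their spans and so correspond to the nonfree
    patterns of rank [i]. *)
Lemma card_critical i : primitivity_rank H = Some i ->
  (critical H #= `I_#|[set E : pat | nonfree E && (rk E == i)]%SET|)%card.
Proof.
move=> pi; have [_ imin] := (primitivity_rankP i).1 pi.
pose A := [fset sub E | E in [set E : pat | nonfree E && (rk E == i)]%SET]%fset.
have -> : critical H = [set` A].
  apply/seteqP; split=> J.
    move=> [HJ]; rewrite pi => Ji.
    have [E [nE Ei EJ]] := nonfree_extension_pattern HJ Ji.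
    have rkE : rk E = i by apply/eqP; rewrite eqn_leq Ei imin.
    by apply/imfsetP; exists E => /=; rewrite ?inE ?nE ?rkE ?eqxx ?EJ.
  move=> /imfsetP[E /= ]; rewrite inE => /andP[nE /eqP Ei] ->.
  by have [h1 h2] := pattern_nonfree_extension nE; split=> //; rewrite h2 Ei pi.
apply/card_eq_fsetP; rewrite card_in_imfset /= ?cardE // => E E'.
by rewrite !inE => /andP[/andP[oE _] _] /andP[/andP[oE' _] _]; exact: sub_inj.
Qed.

Lemma two_triangle V : (2 * sumn (iota 0 V) = V * V.-1)%N.
Proof.
elim: V => // V IH; have -> : iota 0 V.+1 = iota 0 V ++ [:: V] by rewrite -addn1 iotaD.
rewrite sumn_cat mulnDr IH /= addn0; case: V {IH} => //= V.
by rewrite [(V.+1 * V)%N]mulnC -mulnDl addn2.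
Qed.

(** All patterns other than [E0] have rank at least [j], so each contributes 1 or 0. The leading
    term of [E0] cancels the subtracted power, and its second coefficient enters only for
    [j = r + 1]. *)
Lemma Phi_coefE j : (j <= r.+1)%N -> (forall E, nonfree E -> (j <= rk E)%N) ->
  Phi_coef R H j = Posz #|[set E : pat | nonfree E && (rk E == j)]%SET|.
Proof.
move=> jr jmin; have [a [aP ->]] := Phi_leads tP HP R eH.
have n0 : ~~ nonfree E0 by rewrite negb_and negbK; apply/orP; right; apply/asboolP.
have ovE E : over E -> [|| nonfree E, E == E0 | (r < rk E)%N].
  move=> oE; rewrite /nonfree oE /=; case: asboolP => //= HE; apply/orP.
  by case: (E =P E0) => [|ne]; [left|right; exact: ff_rk].
have aE E : over E -> E != E0 -> a E j = Posz (rk E == j).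
  move=> oE EE0; have [a0 a1 _] := aP E oE.
  have jE : (j <= rk E)%N.
    case/or3P: (ovE E oE) => [/jmin //|E0E|rE]; first by rewrite E0E in EE0.
    exact: leq_trans jr rE.
  case: eqP => [<- //|jn]; rewrite a0 // ltn_neqAle jE andbT.
  by apply/eqP => jE'; apply: jn.
rewrite (bigD1 E0) //=.
have -> : (\sum_(E : pat | over_pattern H E && (E != E0)) a E j =
    Posz #|[set E : pat | over E && (E != E0) && (rk E == j)]%SET|)%R.
  rewrite -sum1_card big_mkcond [RHS]Posz_sum.
  rewrite [RHS]big_mkcond; apply: eq_bigr => E _; rewrite inE -[over_pattern H E]/(over E).
  by case: andP => //= -[oE EE0]; rewrite aE //; case: (rk E == j).
have [a0 a1 a2] := aP E0 over_E0; rewrite -/(rk E0) rk_E0 in a0 a1 a2.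
have [jr'|jr'] := leqP j r.
  have -> : a E0 j = Posz (j == r).
    by move: jr'; rewrite leq_eqVlt => /predU1P[->|jr']; rewrite ?eqxx ?a1 // a0 // ltn_eqF.
  rewrite addrAC subrr add0r; congr Posz; apply: eq_card => E; rewrite !inE.
  case: (rk E =P j) => [rE|]; rewrite ?andbF // !andbT.
  apply/andP/idP => [[oE EE0]|nE].
    case/or3P: (ovE E oE) => // [E0E|]; first by rewrite E0E in EE0.
    by rewrite rE ltnNge jr'.
  split; first by case/andP: nE.
  by apply: contraNneq n0 => <-.
have jE : j = r.+1 by apply/eqP; rewrite eqn_leq jr.
have rank_gt M : is_subgroup M -> span M P = M -> H `<=` M -> M <> H ->
    forall m (f : 'I_m -> F), free_basis M f -> (r < m)%N.
  move=> sM MP HM MH m f fM; have [E oE EM] := over_of sM HM MP.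
  have [f' f'E] := over_rk oE; rewrite EM in f'E.
  rewrite -(free_basis_rank_uniq f'E fM).
  case/or3P: (ovE E oE) => // [/jmin|/eqP EE0]; first by rewrite jE.
  by case: MH; rewrite -EM EE0 sub_E0.
have [Ms [uMs MsP Mcount]] := count_immediate sH tP HP eH rank_gt.
have MsE : size Ms = #|[set E : pat | over E && `[< free_factor H (sub E) >] && (rk E == r.+1)]%SET|.
  rewrite cardE -(size_map sub); apply/perm_size/uniq_perm => //.
    rewrite map_inj_in_uniq ?enum_uniq // => E E'; rewrite !mem_enum !inE.
    by move=> /andP[/andP[oE _] _] /andP[/andP[oE' _] _]; exact: sub_inj.
  move=> M; apply/idP/mapP => [/MsP[sM MP rM HM]|[E]].
    have [E oE EM] := over_of sM (free_factor_sub HM) MP; exists E => //.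
    rewrite mem_enum inE oE EM /= (asboolT HM) /=; apply/eqP.
    have [_] := pattern_rankE tP HP oE; rewrite -/(sub E) EM rM => -[->//].
  rewrite mem_enum inE => /andP[/andP[oE /asboolP HE] /eqP rE] ->.
  have [sM HM MP _] := over_patternP HP oE; apply/MsP; split=> //.
  by have [_ ->] := pattern_rankE tP HP oE; rewrite -/(rk E) rE.
have cH : (a E0 j = - Posz (size Ms))%R.
  rewrite jE a2 -/(sub E0) sub_E0.
  rewrite -Posz_sum.
  have : (2 * size Ms + 2 * \sum_(j < k) sumn (iota 0 (nedges H P j)) =
          2 * sumn (iota 0 (ncosets H P)))%N.
    by rewrite two_triangle -Mcount big_distrr /=; congr addn; apply: eq_bigr => j' _; exact: two_triangle.
  rewrite -mulnDr => /eqP; rewrite eqn_mul2l /= => /eqP <-.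
  by rewrite PoszD opprD addrCA subrr addr0.
(* In rank [r + 1] a pattern is nonfree or has [H] as a free factor; the latter are cancelled by the
   coefficient of [E0]. *)
have -> : #|[set E : pat | over E && (E != E0) && (rk E == j)]%SET| =
  (#|[set E : pat | nonfree E && (rk E == j)]%SET| + size Ms)%N.
  pose A1 := [set E : pat | nonfree E && (rk E == j)]%SET.
  pose A2 := [set E : pat | over E && `[< free_factor H (sub E) >] && (rk E == r.+1)]%SET.
  have A12 : (A1 :&: A2 = finset.set0)%SET.
    apply/setP => E; rewrite !inE /nonfree; case: (`[< _ >]); by rewrite ?andbF //= ?andbF.
  rewrite MsE -/A1 -/A2 -cardsUI A12 cards0 addn0; apply: eq_card => E; rewrite !inE /nonfree jE.
  case: (over E) => //=; case: (rk E =P r.+1) => [rE|]; rewrite ?andbF // !andbT orNb.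
  by apply/eqP => EE0; move: rE; rewrite EE0 rk_E0 => /n_Sn.
by rewrite cH jE eqn_leq ltnn /= subr0 PoszD addrCA addNr addr0.
Qed.

Lemma primitivity_rank_phi j : (j <= r.+1)%N ->
  primitivity_rank H = Some j -> phi R H = Some j.
Proof.
move=> jr /primitivity_rankP[[E nE Ej] jmin]; apply: least_eq => [|n].
  rewrite /= Phi_coefE //= -lt0n; apply/card_gt0P; exists E.
  by rewrite inE nE Ej eqxx.
rewrite /= leqNgt; apply: contraNN => nj; rewrite Phi_coefE.
- rewrite -[X in Posz X](_ : 0%N = _) //; apply/esym/eqP; rewrite cards_eq0.
  apply/eqP/setP => E'; rewrite !inE; apply/negP => /andP[nE' /eqP E'n].
  by have := jmin _ nE'; rewrite E'n leqNgt nj.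
- exact: leq_trans (ltnW nj) jr.
- by move=> E' /jmin; apply: leq_trans; exact: ltnW.
Qed.

(** If all nonfree ranks exceeded [i], the nonzero coefficient of degree [i] would be an empty
    count; a smaller primitivity rank is excluded by the converse direction. *)
Lemma phi_primitivity_rank i : (i <= r.+1)%N ->
  phi R H = Some i -> primitivity_rank H = Some i.
Proof.
move=> ir phii; have [/= ai imin] := least_Some phii.
have late : (forall E, nonfree E -> (i < rk E)%N) -> False.
  move=> ni; move: ai; rewrite Phi_coefE // => [|E /ni]; last exact: ltnW.
  rewrite eqz_nat -lt0n => /card_gt0P[E]; rewrite inE => /andP[nE /eqP Ei].
  by have := ni E nE; rewrite Ei ltnn.
case pi: (primitivity_rank H) => [i'|].
  have [i'i|ii'] := leqP i' i; first by rewrite -phii (primitivity_rank_phi _ pi) // (leq_trans i'i).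
  case: late => E nE; apply: leq_trans ii' _.
  by have [_ ->] := (primitivity_rankP i').1 pi.
case: late => E nE; case: (least_None pi (m := rk E)).
by exists (sub E); exact: pattern_nonfree_extension.
Qed.

Lemma critical_count i : (i <= r.+1)%N -> primitivity_rank H = Some i ->
  exists2 m : nat, (critical H #= `I_m)%card & Phi_coef R H i = Posz m.
Proof.
move=> ir pi; exists #|[set E : pat | nonfree E && (rk E == i)]%SET|; first exact: card_critical.
by apply: Phi_coefE => //; have [_] := (primitivity_rankP i).1 pi.
Qed.

End PrimitivityRank.

Local Open Scope classical_set_scope.
Local Open Scope card_scope.
Local Open Scope ring_scope.

Theorem proposition1p9 (R : realType) (k : nat) (H : set (free_group 'I_k))
    (subH : is_subgroup H) (fgH : finitely_generated H) (i : nat)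
    (hi : if free_rank H is Some r then (i <= r.+1)%N else true) :
  (primitivity_rank H = Some i <-> phi R H = Some i) /\
  (primitivity_rank H = Some i -> phi R H = Some i ->
   exists2 m : nat, critical H #= `I_m & Phi_coef R H i = m%:Z).
Proof.
have [s HE] := fgH; have [Q [tP sP]] := tree_extend_all s (tree_root 'I_k).
have HP := span_generated HE tP sP.
have [r [e eH]] := finitely_generated_basis HE.
rewrite (free_rank_basis eH) in hi.
split; last by move=> pi _; exact: (critical_count R subH tP HP eH hi pi).
split; first exact: (primitivity_rank_phi R subH tP HP eH hi).
exact: (phi_primitivity_rank subH tP HP eH hi).
Qed.
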